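(* Let $G\subset \mathrm{Conf}(\mathbb{E}^3)$ be a connected Lie subgroup which acts on $\mathbb{E}^3$ with cohomogeneity one. Then, up to conjugacy in $\mathrm{Conf}(\mathbb{E}^3)$, $G$ admits the same orbits in $\mathbb{E}^3$ as those induced by one of the following groups: $$\mathscr{P},\quad SO(2)\times \mathscr{L},\quad \mathcal{N}_a\ltimes \mathscr{L}\ (\text{for some constant } a\in\mathbb{R}^* ),\quad \mathbb{R}_+^*\ltimes \mathscr{L},\quad SO(3),\quad \mathbb{R}_+^*\times SO(2).$$
   Context: Cohomogeneity: an action of a Lie group $G$ on an $n$-manifold $M$ is of cohomogeneity $k$ if the maximum dimension among the $G$-orbits in $M$ is $n-k$. Lie subgroups are not assumed to be closed. ''Up to conjugacy $G$ admits the same orbits as $H$'' means that some conjugate of $G$ has exactly the same orbits as $H$. $\mathbb{E}^3$ is $3$-dimensional Euclidean space with a chosen origin. $\mathrm{Conf}(\mathbb{E}^3)$ is identified with $(\mathbb{R}^*\times O(3))\ltimes\mathbb{R}^3$, where $\mathbb{R}^*=\mathbb{R}\setminus\{0\}$, with product $(\alpha,A,v)(\beta,B,w)=(\alpha\beta,AB,\alpha A(w)+v)$, the element $(\alpha,A,v)$ acting by $x\mapsto\alpha A(x)+v$. Let $\{e_1,e_2,e_3\}$ be the standard basis of $\mathbb{R}^3$ and $R_t=\begin{bmatrix}\cos t&\sin t&0\\-\sin t&\cos t&0\\0&0&1\end{bmatrix}$. Inside this group: $\mathscr{P}=\mathbb{R}e_1\oplus\mathbb{R}e_2$ and $\mathscr{L}=\mathbb{R}e_3$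 are groups of translations $(1,\mathrm{Id},v)$; $\mathbb{R}_+^*=\{(\alpha,\mathrm{Id},0):\alpha>0\}$; $SO(3)=\{(1,A,0):A\in SO(3)\}$; $SO(2)=\{(1,R_t,0):t\in\mathbb{R}\}$; $\mathcal{N}_a=\{(e^{at},R_t,0):t\in\mathbb{R}\}$ for $a\in\mathbb{R}^*$. Products and semi-direct products are the subgroups generated by the indicated factors. *)

(* Defs.v *)
From HB Require Import structures.
From mathcomp Require Import all_boot all_order all_algebra.
From mathcomp Require Import all_classical all_reals all_analysis.
Set Implicit Arguments.
Unset Strict Implicit.
Unset Printing Implicit Defensive.
Import Order.TTheory GRing.Theory Num.Theory.
Import numFieldNormedType.Exports.

Local Open Scope classical_set_scope.
Local Open Scope ring_scope.

(* [Cn n D f] is the class C^n of f on D; it is meaningful for D open only. *)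
Fixpoint Cn {R : realType} (n : nat) {V W : normedModType R}
    (D : set V) (f : V -> W) : Prop :=
  if n is n'.+1 then
    (forall x, D x -> differentiable f x) /\
    (forall v, Cn n' D (fun x => 'd f x v))
  else forall x, D x -> {for x, continuous f}.

Definition smooth {R : realType} {V W : normedModType R}
    (D : set V) (f : V -> W) : Prop := forall n, Cn n D f.

(* A countable family of local parametrizations with values in V. A finite
   family is padded with empty domains. *)
Record atlas (R : realType) (k : nat) (V : normedModType R) := Atlas {
  pdom : nat -> set 'rV[R]_k;
  param : nat -> 'rV[R]_k -> V }.

(* F : D -> V is smooth as a map into the manifold described by M, i.e., every
   local expression (param i)^-1 \o F has an open domain and is smooth on it. *)
Definition smooth_into {R : realType} {k : nat} {V W : normedModType R}
    (M : atlas k V) (D : set W) (F : W -> V) : Prop :=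
  forall i, let D' := D `&` F @^-1` (param M i @` pdom M i) in
    open D' /\
    exists g : W -> 'rV[R]_k, smooth D' g /\
      forall w, D' w -> pdom M i (g w) /\ param M i (g w) = F w.

(* S is an immersed (not necessarily embedded) k-dimensional submanifold of V,
   for the manifold structure given by the parametrizations of M: the last
   clause says that the transition maps are smooth with open domains. The
   topology of S is the one for which all parametrizations are open embeddings;
   it is finer than the subspace topology, hence Hausdorff, and it is second
   countable since M is countable. *)
Definition immersed_submanifold {R : realType} {k : nat} {V : normedModType R}
    (S : set V) (M : atlas k V) : Prop :=
  S = \bigcup_i (param M i @` pdom M i) /\
  forall i, [/\ open (pdom M i),
    smooth (pdom M i) (param M i),
    (forall u, pdom M i u -> injective ('d (param M i) u)),
    {in pdom M i &, injective (param M i)} &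
    smooth_into M (pdom M i) (param M i)].

Definition manifold_open {R : realType} {k : nat} {V : normedModType R}
    (M : atlas k V) (A : set V) : Prop :=
  forall i, open (pdom M i `&` param M i @^-1` A).

Definition manifold_connected {R : realType} {k : nat} {V : normedModType R}
    (S : set V) (M : atlas k V) : Prop :=
  forall A B : set V, manifold_open M A -> manifold_open M B ->
    A `|` B = S -> A `&` B = set0 -> A = set0 \/ B = set0.

Definition has_dim {R : realType} {V : normedModType R} (S : set V) (d : nat) :
    Prop := exists M : atlas d V, immersed_submanifold S M.

(* Triples (alpha, A, v), as a subset of an ambient normed space. *)
Notation triple R := (R * 'M[R]_3 * 'cV[R]_3)%type.

Section ConformalGroup.
Variable R : realType.
Implicit Types (g h c : triple R) (G H A B : set (triple R)) (x : 'cV[R]_3).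

Definition Conf : set (triple R) :=
  [set g | g.1.1 != 0 /\ g.1.2^T *m g.1.2 = 1%:M].

Definition conf1 : triple R := (1, 1%:M, 0).

Definition cmul g h : triple R :=
  (g.1.1 * h.1.1, g.1.2 *m h.1.2, g.1.1 *: (g.1.2 *m h.2) + g.2).

Definition cinv g : triple R :=
  (g.1.1^-1, invmx g.1.2, - (g.1.1^-1 *: (invmx g.1.2 *m g.2))).

Definition cact g x : 'cV[R]_3 := g.1.1 *: (g.1.2 *m x) + g.2.

Definition subgroup G : Prop :=
  [/\ G `<=` Conf, G conf1, (forall g h, G g -> G h -> G (cmul g h)) &
      (forall g, G g -> G (cinv g))].

Definition generated A : set (triple R) :=
  [set g | forall H, subgroup H -> A `<=` H -> H g].

(* The subgroup carries a connected manifold structure, not necessarily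
   inducing the subspace topology, for which it is a Lie group and its
   inclusion is an immersion. Conf being an embedded submanifold of the space of
   triples, immersions into Conf are immersions into that space. *)
Definition connected_Lie_subgroup G : Prop :=
  subgroup G /\
  exists (k : nat) (M : atlas k (triple R)),
    [/\ immersed_submanifold G M,
        (forall i j, smooth_into M (pdom M i `*` pdom M j)
           (fun p => cmul (param M i p.1) (param M j p.2))),
        (forall i, smooth_into M (pdom M i) (fun u => cinv (param M i u))) &
        manifold_connected G M].

Definition conf_orbit G x : set 'cV[R]_3 := [set cact g x | g in G].

(* The maximal orbit dimension is 3 - k. *)
Definition cohomogeneity (k : nat) G : Prop :=
  (exists x d, has_dim (conf_orbit G x) d /\ (d + k = 3)%N) /\
  (forall x d, has_dim (conf_orbit G x) d -> (d + k <= 3)%N).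

Definition conj_set c G : set (triple R) :=
  [set cmul (cmul c g) (cinv c) | g in G].

Definition same_orbits_upto_conj G H : Prop :=
  exists2 c, Conf c & forall x, conf_orbit (conj_set c G) x = conf_orbit H x.

(* [basis_vec i] is e_(i + 1). *)
Definition basis_vec (i : 'I_3) : 'cV[R]_3 := delta_mx i 0.

Definition rotz (t : R) : 'M[R]_3 := \matrix_(i, j)
  nth 0 (nth [::] [:: [:: cos t;    sin t; 0];
                      [:: - sin t;  cos t; 0];
                      [:: 0;        0;     1]] i) j.

Definition grpP : set (triple R) :=
  [set g | exists a b, g = (1, 1%:M, a *: basis_vec 0 + b *: basis_vec 1)].

Definition grpL : set (triple R) :=
  [set g | exists a, g = (1, 1%:M, a *: basis_vec 2)].

Definition grpRpos : set (triple R) :=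
  [set g | exists2 a : R, 0 < a & g = (a, 1%:M, 0)].

Definition grpSO3 : set (triple R) :=
  [set g | exists2 A : 'M[R]_3, A^T *m A = 1%:M /\ \det A = 1 & g = (1, A, 0)].

Definition grpSO2 : set (triple R) :=
  [set g | exists t, g = (1, rotz t, 0)].

Definition grpN (a : R) : set (triple R) :=
  [set g | exists t, g = (expR (a * t), rotz t, 0)].

Definition grp_prod A B : set (triple R) := generated (A `|` B).

End ConformalGroup.

Arguments Conf : clear implicits.
Arguments conf1 : clear implicits.
Arguments grpP : clear implicits.
Arguments grpL : clear implicits.
Arguments grpRpos : clear implicits.
Arguments grpSO3 : clear implicits.
Arguments grpSO2 : clear implicits.
Arguments grpN : clear implicits.

(* Main.v *)
Require Import Defs.
From mathcomp Require Import all_boot all_order all_algebra.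
From mathcomp Require Import all_classical all_reals all_analysis.
From HB Require Import structures.
From mathcomp Require Import ring lra.
Import Order.TTheory GRing.Theory Num.Theory.
Import numFieldNormedType.Exports.
Set Implicit Arguments.
Unset Strict Implicit.
Unset Printing Implicit Defensive.
Local Open Scope classical_set_scope.
Local Open Scope ring_scope.

(** The group G is only used through its C^1 paths. Since a chart of G can be
    crossed along arcs, G is generated by such paths, and the velocities at 1 of
    the paths in G form a linear space closed under conjugation by G, hence under
    brackets: the Lie algebra of G ([tangent], [tangent_bracket],
    [Lie_subgroup_C1_connected]). An element of it is a scaling a, a rotation
    vector (p, q, r) and a translation (u, v, w), and generates an affine vector
    field on the space.

    The two halves of cohomogeneity one become two properties of this Lie algebra
    that survive conjugation ([nice]). If three of its fields were independent at
    some point, the inverse function theorem, applied to a product of three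
    paths, would make an orbit open, hence three-dimensional
    ([tangent_spans_orbit_open], [open_has_dim3]). If it were at most
    one-dimensional, all orbits would be points, circles, lines, helices or
    spirals; on these there is a continuous real function that takes no value more
    than twice, whereas every continuous function on a planar domain takes some
    value three times ([thin_not_thick], [planar_fibre3]).

    Linear algebra then classifies the Lie algebras up to conjugation by
    rotations and translations ([nice_classification]), according to the
    translations they contain. With a plane of translations, all fields are
    parallel to the plane. With a line of translations, the bracket forces
    rotations to be about this line, and in the orthogonal plane the fields have a
    common zero and are proportional: otherwise an orbit would be open. Without
    translations, either all rotations have one axis, and the algebra is spanned
    by a dilation and a rotation that fix the same point, or the rotation vectors
    fill the space; then the translation part is a derivation of the cross
    product, so that all rotations fix a common point, and there is no dilation.

    It remains to recover the orbits. First integrals of the fields confine the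
    orbits of G to the leaves of an explicit equivalence relation
    ([orbit_invariant]). The orbits are open in the leaves: complete the fields
    tangent to the leaf by transversal paths of similarities to a spanning set
    ([local_leaf]); as the leaves are path-connected, they are orbits
    ([path_in_orbit]). The orbits of the model groups are the same leaves
    ([normal_form_orbits]). *)

(** * Curves of class C^1 *)

Section C1Functions.
Variable R : realType.
Implicit Types f g : R -> R.

(** Curves are taken on the whole line; an arc of a chart is run through as a
    function of sin t. *)
Definition C1 f : Prop :=
  exists2 f' : R -> R, continuous f' & forall t : R, is_derive t 1 f (f' t).

Lemma C1_cst (c : R) : C1 (fun=> c).
Proof. by exists (fun=> 0) => t; [exact: cvg_cst | exact: is_derive_cst]. Qed.

Lemma C1_continuous f : C1 f -> continuous f.
Proof.
move=> [f' _ df] t; apply: differentiable_continuous.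
by apply/derivable1_diffP; exact: (@ex_derive _ _ _ _ _ _ _ (df t)).
Qed.

Lemma C1D f g : C1 f -> C1 g -> C1 (fun t => f t + g t).
Proof.
move=> [f' cf df] [g' cg dg]; exists (fun t => f' t + g' t).
  by move=> t; apply: cvgD; [exact: cf | exact: cg].
by move=> t; have ? := df t; have ? := dg t; exact: is_deriveD.
Qed.

Lemma C1N f : C1 f -> C1 (fun t => - f t).
Proof.
move=> [f' cf df]; exists (fun t => - f' t).
  by move=> t; apply: cvgN; exact: cf.
by move=> t; have ? := df t; exact: is_deriveN.
Qed.

Lemma C1M f g : C1 f -> C1 g -> C1 (fun t => f t * g t).
Proof.
move=> Cf Cg; have := (C1_continuous Cf, C1_continuous Cg) => -[kf kg].
move: Cf Cg => [f' cf df] [g' cg dg]; exists (fun t => f t * g' t + g t * f' t).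
  move=> t; apply: cvgD; apply: cvgM;
    [exact: kf | exact: cg | exact: kg | exact: cf].
by move=> t; have ? := df t; have ? := dg t; exact: is_deriveM.
Qed.

Lemma C1V f : (forall t, f t != 0) -> C1 f -> C1 (fun t => (f t)^-1).
Proof.
move=> f0 Cf; have kf := C1_continuous Cf.
move: Cf => [f' cf df]; exists (fun t => - ((f t)^-1 * (f t)^-1) * f' t).
  move=> t; apply: cvgM; last exact: cf.
  by apply: cvgN; apply: cvgM; apply: cvgV => //; exact: kf.
move=> t; have ? := df t.
have ? := f0 t; apply: is_derive_eq.
by rewrite /GRing.scale /= expr2 invfM; ring.
Qed.

Lemma C1_sum n (F : 'I_n -> R -> R) :
  (forall i, C1 (F i)) -> C1 (fun t => \sum_i F i t).
Proof.
elim: n F => [|n IH] F CF.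
  by under eq_fun do rewrite big_ord0; exact: C1_cst.
by under eq_fun do rewrite big_ord_recl; apply: C1D => //; apply: IH.
Qed.

Lemma C1_comp f g : C1 f -> C1 g -> C1 (fun t => f (g t)).
Proof.
move=> Cf Cg; have kg := C1_continuous Cg.
move: Cf Cg => [f' cf df] [g' cg dg]; exists (fun t => f' (g t) * g' t).
  move=> t; apply: cvgM; last exact: cg.
  by apply: continuous_comp; [exact: kg | exact: cf].
by move=> t; have ? := df (g t); have ? := dg t; exact: is_derive1_comp.
Qed.

Lemma C1_id : C1 id.
Proof. by exists (fun=> 1) => t; [exact: cvg_cst | exact: is_derive_id]. Qed.

Lemma C1_sin : C1 (@sin R).
Proof. by exists cos; [exact: continuous_cos | move=> t; exact: is_derive_sin]. Qed.

Lemma C1_cos : C1 (@cos R).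
Proof.
exists (fun t => - sin t); last by move=> t; exact: is_derive_cos.
by move=> t; apply: cvgN; exact: continuous_sin.
Qed.

Lemma C1_expR : C1 (@expR R).
Proof. by exists expR; [exact: continuous_expR | move=> t; exact: is_derive_expR]. Qed.

Lemma is_derive_uniq f (t a b : R) : is_derive t 1 f a -> is_derive t 1 f b -> a = b.
Proof. by move=> [_ <-] [_ <-]. Qed.

(** By the mean value theorem. Strictness, with two moving points, is what makes
    Newton's iteration contract. *)
Lemma C1_strict f (a e : R) : C1 f -> is_derive (0 : R) 1 f a -> 0 < e ->
  exists2 d : R, 0 < d & forall s t : R, `|s| < d -> `|t| < d ->
    `|f s - f t - (s - t) * a| <= e * `|s - t|.
Proof.
move=> Cf fa e0; have kf := C1_continuous Cf; move: Cf => [f' cf df].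
have {fa} <- : f' 0 = a by exact: is_derive_uniq (df 0) fa.
have /cvgrPdist_lt/(_ _ e0)/nbhs_ballP[d /= d0 fd] := cf 0.
exists d => // s t.
wlog st : s t / s <= t => [W sd td|sd td].
  have [/W|/ltW/W] := leP s t; first by apply.
  move=> /(_ td sd); rewrite (distrC t s).
  by rewrite (_ : f t - _ - _ = - (f s - f t - (s - t) * f' 0)) ?normrN //; ring.
have [x|c] := MVT_segment st (fun x _ => df x).
  exact: continuous_subspaceT.
rewrite in_itv /= => /andP[sc ct] fts.
have cd : `|c| < d.
  rewrite ltr_norml; move: sd td; rewrite !ltr_norml => /andP[? ?] /andP[? ?].
  by apply/andP; split; lra.
rewrite (_ : _ - _ = (f' 0 - f' c) * (t - s)); last by move: fts; lra.
rewrite normrM [`|s - t|]distrC ler_wpM2r //.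
by apply/ltW/fd; rewrite /ball /= sub0r normrN.
Qed.

End C1Functions.

Section MatrixCurves.
Variable R : realType.

Definition C1mx m n (M : R -> 'M[R]_(m, n)) := forall i j, C1 (fun t => M t i j).

Definition mxder m n (M : R -> 'M[R]_(m, n)) (t : R) (D : 'M[R]_(m, n)) :=
  forall i j, is_derive t 1 (fun s => M s i j) (D i j).

Lemma mxder_cst m n (A : 'M[R]_(m, n)) t : mxder (fun=> A) t 0.
Proof. by move=> i j; rewrite mxE; exact: is_derive_cst. Qed.

Lemma mxder_uniq m n (M : R -> 'M[R]_(m, n)) t D E :
  mxder M t D -> mxder M t E -> D = E.
Proof. by move=> MD ME; apply/matrixP => i j; apply: is_derive_uniq. Qed.

Lemma is_derive_bigsum n (F : 'I_n -> R -> R) (D : 'I_n -> R) (t : R) :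
  (forall i, is_derive t 1 (F i) (D i)) ->
  is_derive t 1 (fun s => \sum_i F i s) (\sum_i D i).
Proof.
move=> FD; rewrite (_ : (fun s => _) = \sum_i F i).
  exact: is_derive_sum.
by apply/funext => s; rewrite fct_sumE.
Qed.

Lemma mxder_mul m n p (M : R -> 'M[R]_(m, n)) (N : R -> 'M[R]_(n, p)) t D E :
  mxder M t D -> mxder N t E ->
  mxder (fun s => M s *m N s) t (D *m N t + M t *m E).
Proof.
move=> MD NE i k; under eq_fun do rewrite mxE.
rewrite !mxE -big_split /=; apply: is_derive_bigsum => j.
have ? := MD i j; have ? := NE j k.
apply: is_derive_eq.
by rewrite /GRing.scale /=; ring.
Qed.

Lemma mxder_comp m n (M : R -> 'M[R]_(m, n)) (g : R -> R) t D c :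
  mxder M (g t) D -> is_derive t 1 g c ->
  mxder (fun s => M (g s)) t (c *: D).
Proof.
move=> MD gc i j; have ? := MD i j.
by rewrite mxE mulrC; exact: is_derive1_comp.
Qed.

Lemma C1mxP m n (M : R -> 'M[R]_(m, n)) t : C1mx M -> exists D, mxder M t D.
Proof.
move=> CM; have /choice[f fP] : forall ij : 'I_m * 'I_n,
    exists a, is_derive t 1 (fun s => M s ij.1 ij.2) a.
  by move=> [i j]; have [f' _ /(_ t)] := CM i j; exists (f' t).
by exists (\matrix_(i, j) f (i, j)) => i j; rewrite mxE; exact: (fP (i, j)).
Qed.

Lemma C1mxM m n p (M : R -> 'M[R]_(m, n)) (N : R -> 'M[R]_(n, p)) :
  C1mx M -> C1mx N -> C1mx (fun s => M s *m N s).
Proof.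
move=> CM CN i k; under eq_fun do rewrite mxE.
by apply: C1_sum => j; exact: C1M.
Qed.

Lemma C1mxD m n (M N : R -> 'M[R]_(m, n)) :
  C1mx M -> C1mx N -> C1mx (fun s => M s + N s).
Proof. by move=> CM CN i k; under eq_fun do rewrite mxE; exact: C1D. Qed.

Lemma C1mxZ m n (a : R -> R) (M : R -> 'M[R]_(m, n)) :
  C1 a -> C1mx M -> C1mx (fun s => a s *: M s).
Proof. by move=> Ca CM i k; under eq_fun do rewrite mxE; exact: C1M. Qed.

Lemma C1mx_cst m n (M : 'M[R]_(m, n)) : C1mx (fun=> M).
Proof. by move=> i k; exact: C1_cst. Qed.

Lemma C1mx_tr m n (M : R -> 'M[R]_(m, n)) : C1mx M -> C1mx (fun s => (M s)^T).
Proof. by move=> CM i k; under eq_fun do rewrite mxE; exact: CM. Qed.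

End MatrixCurves.

(** * Strict derivatives and local surjectivity *)

Section MatrixNorm.
Variable R : realType.

(** Banach's fixed point theorem asks for a structure that joins completeness and
    the norm. *)
HB.instance Definition _ (m n : nat) :=
  Complete.copy 'M[R]_(m, n) 'M[R]_(m, n).

Lemma ler_entry_norm m n (M : 'M[R]_(m, n)) i j : `|M i j| <= `|M|.
Proof.
rewrite [leRHS]/Num.Def.normr /= mx_normrE.
exact: (le_bigmax _ (fun ij : 'I_m * 'I_n => `|M ij.1 ij.2|) (i, j)).
Qed.

Lemma mx_norm_le m n (M : 'M[R]_(m, n)) c :
  0 <= c -> (forall i j, `|M i j| <= c) -> `|M| <= c.
Proof.
move=> c0 Mc; rewrite [leLHS]/Num.Def.normr /= mx_normrE.
by apply: bigmax_le => //= -[i j] _; exact: Mc.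
Qed.

Lemma mx_normM m n p (M : 'M[R]_(m, n)) (N : 'M[R]_(n, p)) :
  `|M *m N| <= n%:R * `|M| * `|N|.
Proof.
apply: mx_norm_le => [|i k]; first by rewrite !mulr_ge0.
rewrite mxE (le_trans (ler_norm_sum _ _ _))//.
have -> : n%:R * `|M| * `|N| = \sum_(j < n) `|M| * `|N|.
  by rewrite sumr_const card_ord -mulrA mulr_natl.
by apply: ler_sum => j _; rewrite normrM ler_pM // ler_entry_norm.
Qed.

End MatrixNorm.

Section StrictDerivative.
Variables (R : realType) (k : nat).
Local Notation V := 'cV[R]_k.

(** D is the strict derivative of f at 0. *)
Definition sdiff m n (f D : V -> 'M[R]_(m, n)) : Prop :=
  forall e : R, 0 < e -> exists2 d : R, 0 < d &
    forall s t : V, `|s| < d -> `|t| < d ->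
      `|f s - f t - D (s - t)| <= e * `|s - t|.

Definition bounded_op m n (D : V -> 'M[R]_(m, n)) :=
  exists2 C : R, 0 <= C & forall h, `|D h| <= C * `|h|.

Lemma bounded_opD m n (D E : V -> 'M[R]_(m, n)) :
  bounded_op D -> bounded_op E -> bounded_op (fun h => D h + E h).
Proof.
move=> [C C0 DC] [C' C0' EC]; exists (C + C'); first exact: addr_ge0.
by move=> h; rewrite (le_trans (ler_normD _ _))// mulrDl lerD.
Qed.

Lemma sdiff_continuous m n (f D : V -> 'M[R]_(m, n)) (e : R) :
  sdiff f D -> bounded_op D -> 0 < e ->
  exists2 d : R, 0 < d & forall s : V, `|s| < d -> `|f s - f 0| <= e.
Proof.
move=> fD [C C0 DC] e0; have [d d0 fd] := fD 1 ltr01.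
exists (Num.min d (e / (1 + C))).
  by rewrite lt_min d0 divr_gt0 // ltr_wpDr.
move=> s; rewrite lt_min => /andP[sd se].
have := fd s 0 sd; rewrite normr0 => /(_ d0); rewrite subr0 mul1r => fs.
rewrite -[f s - f 0](subrK (D s)) (le_trans (ler_normD _ _))//.
rewrite (le_trans (lerD fs (DC s)))// -{1}[`|s|]mul1r -mulrDl.
by rewrite mulrC -ler_pdivlMr ?ltW // ltr_wpDr.
Qed.

(** With h = s - t, the error of the product rule is
    (fs - ft - Dh) gs + Dh (gs - g0) + ft (gs - gt - Eh) + (ft - f0) Eh. *)
Lemma sdiff_mul m n p (f D : V -> 'M[R]_(m, n)) (g E : V -> 'M[R]_(n, p)) :
  sdiff f D -> bounded_op D -> sdiff g E -> bounded_op E ->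
  sdiff (fun s => f s *m g s) (fun h => D h *m g 0 + f 0 *m E h).
Proof.
move=> fD bD gE bE e e0; have [[C C0 DC] [C' C0' EC]] := (bD, bE).
pose B := `|f 0| + `|g 0| + 1.
have B0 : 0 < B by rewrite ltr_wpDl // addr_ge0.
(* the four error terms are bounded by n e1 |h| times B, C, B and C' *)
pose K := n%:R * (B + C + B + C') + 1.
have K0 : 0 < K by rewrite ltr_wpDl // mulr_ge0 // !addr_ge0 // ltW.
pose e1 := e / K; have e10 : 0 < e1 by rewrite divr_gt0.
have m0 : 0 < Num.min e1 1 by rewrite lt_min e10 ltr01.
have [d1 d10 H1] := fD _ e10; have [d2 d20 H2] := gE _ e10.
have [d3 d30 H3] := sdiff_continuous fD bD m0.
have [d4 d40 H4] := sdiff_continuous gE bE m0.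
exists (Num.min (Num.min d1 d2) (Num.min d3 d4)).
  by rewrite !lt_min d10 d20 d30 d40.
move=> s t; rewrite !lt_min => /andP[/andP[s1 s2] /andP[_ s4]].
move=> /andP[/andP[t1 t2] /andP[t3 _]].
have := H3 t t3; have := H4 s s4; rewrite !le_min => /andP[gs1 gs2] /andP[ft1 ft2].
have gB : `|g s| <= B.
  rewrite -[g s](subrK (g 0)) (le_trans (ler_normD _ _))//.
  by have := normr_ge0 (f 0); rewrite /B; lra.
have fB : `|f t| <= B.
  rewrite -[f t](subrK (f 0)) (le_trans (ler_normD _ _))//.
  by have := normr_ge0 (g 0); rewrite /B; lra.
set h := s - t; have {}H1 := H1 s t s1 t1; have {}H2 := H2 s t s2 t2.
rewrite -/h in H1 H2.
have -> : f s *m g s - f t *m g t - (D h *m g 0 + f 0 *m E h) =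
    (f s - f t - D h) *m g s + D h *m (g s - g 0) +
    f t *m (g s - g t - E h) + (f t - f 0) *m E h.
  rewrite !mulmxBl !mulmxBr.
  move: (f s *m g s) (f t *m g s) (D h *m g s) (D h *m g 0) (f t *m g t)
    (f t *m E h) (f 0 *m E h) => a b c x y z w.
  by apply/matrixP => i j; rewrite !mxE; ring.
have bnd q (M : 'M[R]_(m, q)) (N : 'M[R]_(q, p)) a b :
    `|M| <= a -> `|N| <= b -> `|M *m N| <= q%:R * (a * b).
  move=> Ma Nb; rewrite (le_trans (mx_normM _ _))// -mulrA ler_wpM2l //.
  by rewrite ler_pM.
apply: (@le_trans _ _ (n%:R * (e1 * `|h| * B) + n%:R * (C * `|h| * e1) +
  n%:R * (B * (e1 * `|h|)) + n%:R * (e1 * (C' * `|h|)))).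
  do 3 (apply: (le_trans (ler_normD _ _)); apply: lerD; last exact: bnd).
  exact: bnd.
rewrite (_ : _ + _ = (K - 1) * e1 * `|h|); last by rewrite /K; ring.
rewrite ler_wpM2r // mulrBl mul1r /e1 mulrC divfK ?gt_eqF //.
by rewrite lerBlDr lerDl ltW.
Qed.

Lemma min_delta (T : finType) (P : T -> R -> Prop) :
  (forall x d d', 0 < d' -> d' <= d -> P x d -> P x d') ->
  (forall x, exists2 d : R, 0 < d & P x d) ->
  exists2 d : R, 0 < d & forall x, P x d.
Proof.
move=> Pmono exd; have /choice[d dP] : forall x, exists d, 0 < d /\ P x d.
  by move=> x; have [d d0 Pd] := exd x; exists d.
have dgt x : 0 < d x by case: (dP x).
exists (\big[Num.min/1]_x d x) => [|x].
  by apply: lt_bigmin.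
apply: Pmono (dP x).2; last exact: bigmin_le_cond.
exact: lt_bigmin.
Qed.

Lemma sdiff_curve m n (M : R -> 'M[R]_(m, n)) (i : 'I_k) D :
  C1mx M -> mxder M 0 D -> sdiff (fun s => M (s i 0)) (fun h => h i 0 *: D).
Proof.
move=> CM MD e e0.
have [||d d0 dP] := @min_delta ('I_m * 'I_n)%type (fun ab d =>
  forall s t : R, `|s| < d -> `|t| < d ->
   `|M s ab.1 ab.2 - M t ab.1 ab.2 - (s - t) * D ab.1 ab.2| <= e * `|s - t|).
- by move=> x d d' _ d'd H s t sd td; apply: H; exact: lt_le_trans d'd.
- by move=> [a b]; exact: C1_strict.
exists d => // s t sd td; apply: mx_norm_le => [|a b].
  by rewrite mulr_ge0 // ltW.
have sk (u : V) : `|u| < d -> `|u i 0| < d by exact/le_lt_trans/ler_entry_norm.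
rewrite !mxE; apply: le_trans (dP (a, b) _ _ (sk _ sd) (sk _ td)) _.
apply: ler_wpM2l; first exact: ltW.
by rewrite (_ : _ - _ = (s - t) i 0) ?ler_entry_norm // !mxE.
Qed.

Lemma bounded_op_curve m n (i : 'I_k) (D : 'M[R]_(m, n)) :
  bounded_op (fun h : V => h i 0 *: D).
Proof.
exists `|D| => // h; rewrite normrZ mulrC ler_wpM2l //; exact: ler_entry_norm.
Qed.

End StrictDerivative.

(** Newton's iteration with the fixed derivative M contracts a small ball. *)
Lemma sdiff_locally_onto (R : realType) k (F : 'cV[R]_k -> 'cV[R]_k)
    (M : 'M[R]_k) (r : R) :
  sdiff F (mulmx M) -> M \in unitmx -> 0 < r ->
  exists2 d : R, 0 < d &
    forall y, `|y - F 0| < d -> exists2 s, `|s| < r & F s = y.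
Proof.
move=> FM Mu r0; pose c := k%:R * `|invmx M| + 1.
have c0 : 0 < c by rewrite ltr_wpDl // mulr_ge0.
have e0 : 0 < (c *+ 2)^-1 by rewrite invr_gt0 mulrn_wgt0.
have [d d0 Fd] := FM _ e0.
pose q := Num.min r d / 2.
have q0 : 0 < q by rewrite divr_gt0 // lt_min r0 d0.
have [qr qd] : q < r /\ q < d.
  have : Num.min r d <= r /\ Num.min r d <= d by rewrite !ge_min !lexx orbT.
  by rewrite /q; split; lra.
exists (q / (c *+ 2)); first by rewrite divr_gt0 // mulrn_wgt0.
move=> y yd; pose Phi s := s - invmx M *m (F s - y).
have inv_le (z : 'cV[R]_k) : `|invmx M *m z| <= c * `|z|.
  by rewrite (le_trans (mx_normM _ _))// ler_wpM2r // lerDl.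
pose U := closed_ball_ (@Num.Def.normr _ 'cV[R]_k) 0 q.
have UE s : U s = (`|s| <= q) :> Prop by rewrite /U /closed_ball_ /= sub0r normrN.
have PhiL s t : U s -> U t -> `|Phi s - Phi t| <= 2^-1 * `|s - t|.
  rewrite !UE => sq tq.
  have -> : Phi s - Phi t = - (invmx M *m (F s - F t - M *m (s - t))).
    rewrite /Phi !mulmxBr !(mulKmx Mu).
    move: (invmx M *m F s) (invmx M *m F t) (invmx M *m y) => a b z.
    by apply/matrixP => i j; rewrite !mxE; ring.
  rewrite normrN (le_trans (inv_le _))//.
  have {}Fd := Fd s t (le_lt_trans sq qd) (le_lt_trans tq qd).
  rewrite (le_trans (ler_wpM2l (ltW c0) Fd))//.
  rewrite mulrA ler_wpM2r // -mulr_natr invfM mulrA divff ?mul1r //.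
  by rewrite gt_eqF.
have U0 : U 0 by rewrite UE normr0 ltW.
have Phi0 : `|Phi 0| <= q / 2.
  rewrite /Phi sub0r normrN (le_trans (inv_le _))// distrC.
  rewrite (le_trans (ler_wpM2l (ltW c0) (ltW yd)))//.
  rewrite (_ : c * _ = q / 2) //.
  by field; rewrite gt_eqF.
have PhiU : set_fun U U Phi.
  move=> s Us; rewrite UE -[Phi s](subrK (Phi 0)) (le_trans (ler_normD _ _))//.
  have := PhiL s 0 Us U0; rewrite subr0; move: Us Phi0; rewrite UE; lra.
have [|||s Us sE] := @banach_fixed_point R 'cV[R]_k U (mkfun_fun PhiU).
- have h0 : 0 <= 2^-1 :> R by rewrite invr_ge0.
  exists (NngNum h0); split => /=; first by rewrite invf_lt1 ?ltr1n.
  by move=> [s t] /= [Us Ut]; exact: PhiL.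
- exact: closed_closed_ball_.
- by exists 0.
exists s; first by move: Us; rewrite UE => /le_lt_trans; apply.
move: sE => /= /eqP; rewrite /Phi -subr_eq0 opprB addrC subrK => /eqP z.
have : M *m (invmx M *m (F s - y)) = 0 by rewrite z mulmx0.
by rewrite mulKVmx // => /eqP; rewrite subr_eq0 => /eqP.
Qed.

(** * Similarities and their Lie algebras *)

Section Subspaces.
Variable R : realType.

(** A subspace of maximal dimension inside S is S itself; project along it. *)
Lemma subspace_kernel (V : vectType R) (S : set V) :
  S 0 -> (forall a x y, S x -> S y -> S (a *: x + y)) ->
  exists f : 'End(V), forall x, S x <-> f x = 0.
Proof.
move=> S0 Slin.
pose P n := `[< exists2 U : {vspace V}, \dim U = n & forall x, x \in U -> S x >].
have exP : exists n, P n.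
  exists 0%N; apply/asboolP; exists 0%VS; first exact: dimv0.
  by move=> x; rewrite memv0 => /eqP ->.
have Pub n : P n -> (n <= \dim {:V})%N.
  by move=> /asboolP[U <- _]; exact/dimvS/subvf.
have [n /asboolP[U dU US] nmax] := ex_maxnP exP Pub.
have SU x : S x -> x \in U.
  move=> Sx; apply/negPn/negP => xU.
  have : P (\dim (U + <[x]>)).
    apply/asboolP; exists (U + <[x]>)%VS => // _ /memv_addP[u uU [_ /vlineP[a ->] ->]].
    by rewrite addrC; apply: Slin => //; exact: US.
  move=> /nmax; rewrite -dU => le_dim; move: xU.
  have /eqP -> : (U == U + <[x]>)%VS by rewrite eqEdim addvSl.
  by rewrite (subvP (addvSr U <[x]>)) // memv_line.
exists (\1 - projv U)%VF => x.
have -> : (\1 - projv U)%VF x = x - projv U x.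
  by rewrite add_lfunE opp_lfunE id_lfunE.
split=> [/SU xU|/eqP]; first by rewrite projv_id // subrr.
by rewrite subr_eq0 => /eqP ->; exact/US/memv_proj.
Qed.

End Subspaces.

Section SimilarityGroup.
Variable R : realType.
Implicit Types (g h c : triple R) (G : set (triple R)) (x y : 'cV[R]_3).

Lemma Conf_cmul g h : Conf R g -> Conf R h -> Conf R (cmul g h).
Proof.
move=> [g0 gA] [h0 hA]; split; first exact: mulf_neq0.
by rewrite /= trmx_mul -mulmxA (mulmxA _ g.1.2) gA mul1mx.
Qed.

Lemma Conf_conf1 : Conf R (conf1 R).
Proof. by split; rewrite /= ?oner_neq0 // trmx1 mulmx1. Qed.

Lemma Conf_unitmx g : Conf R g -> g.1.2 \in unitmx.
Proof. by case=> _ /mulmx1_unit[]. Qed.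

Lemma Conf_invmx g : Conf R g -> invmx g.1.2 = g.1.2^T.
Proof.
move=> gC; have gu := Conf_unitmx gC; case: gC => _ gA.
by rewrite -[RHS]mulmx1 -(mulmxV gu) mulmxA gA mul1mx.
Qed.

Lemma Conf_cinv g : Conf R g -> Conf R (cinv g).
Proof.
move=> gC; split; first by case: gC => g0 _; rewrite invr_eq0.
rewrite /= Conf_invmx // trmxK; have gu := Conf_unitmx gC.
by rewrite -(Conf_invmx gC) mulmxV.
Qed.

Lemma cmulA g h c : cmul g (cmul h c) = cmul (cmul g h) c.
Proof.
rewrite /cmul /= mulrA mulmxA; congr (_, _).
by rewrite mulmxDr scalerDr -!scalemxAr scalerA mulmxA addrA.
Qed.

Lemma cmul1g g : cmul (conf1 R) g = g.
Proof.
by case: g => [[a A] v]; rewrite /cmul /= mul1r !mul1mx scale1r addr0.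
Qed.

Lemma cmulg1 g : cmul g (conf1 R) = g.
Proof.
by case: g => [[a A] v]; rewrite /cmul /= mulr1 mulmx1 mulmx0 scaler0 add0r.
Qed.

Lemma cmulgV g : Conf R g -> cmul g (cinv g) = conf1 R.
Proof.
move=> gC; have gu := Conf_unitmx gC; case: gC => g0 _.
rewrite /cmul /= divff // mulmxV //; congr (_, _).
by rewrite mulmxN scalerN -scalemxAr scalerA divff // scale1r mulKVmx // addNr.
Qed.

Lemma cmulVg g : Conf R g -> cmul (cinv g) g = conf1 R.
Proof.
move=> gC; have gu := Conf_unitmx gC; case: gC => g0 _.
by rewrite /cmul /= mulVf // mulVmx // subrr.
Qed.

Lemma cact_cmul g h x : cact (cmul g h) x = cact g (cact h x).
Proof.
by rewrite /cact /= mulmxDr scalerDr -scalemxAr scalerA mulmxA addrA.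
Qed.

Lemma cact1 x : cact (conf1 R) x = x.
Proof. by rewrite /cact /= mul1mx scale1r addr0. Qed.

Lemma cactK g x : Conf R g -> cact (cinv g) (cact g x) = x.
Proof. by move=> gC; rewrite -cact_cmul cmulVg // cact1. Qed.

Lemma cactKV g x : Conf R g -> cact g (cact (cinv g) x) = x.
Proof. by move=> gC; rewrite -cact_cmul cmulgV // cact1. Qed.

(** Homogeneous coordinates make the action linear, so that the product rule
    for matrices applies to curves of similarities. *)
Definition rho g : 'M[R]_(3 + 1) := block_mx (g.1.1 *: g.1.2) g.2 0 1%:M.

Lemma rho_cmul g h : rho (cmul g h) = rho g *m rho h.
Proof.
rewrite /rho mulmx_block /= !mulmx0 !mul0mx !mulmx1 !addr0 !add0r.
by rewrite -!scalemxAl -scalemxAr scalerA.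
Qed.

Lemma rho1 : rho (conf1 R) = 1%:M.
Proof. by rewrite /rho /= scale1r -scalar_mx_block. Qed.

Lemma rho_cact g x : rho g *m col_mx x 1%:M = col_mx (cact g x) 1%:M.
Proof.
by rewrite /rho mul_block_col mulmx1 mul0mx mulmx1 add0r -scalemxAl.
Qed.

Lemma rhoV g : Conf R g -> rho (cinv g) *m rho g = 1%:M.
Proof. by move=> gC; rewrite -rho_cmul cmulVg // rho1. Qed.

Lemma rho_mulV g : Conf R g -> rho g *m rho (cinv g) = 1%:M.
Proof. by move=> gC; rewrite -rho_cmul cmulgV // rho1. Qed.

Definition C1path (gam : R -> triple R) : Prop :=
  [/\ C1 (fun t => (gam t).1.1), C1mx (fun t => (gam t).1.2) &
      C1mx (fun t => (gam t).2)].

Definition path_in G (gam : R -> triple R) : Prop :=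
  C1path gam /\ forall t, G (gam t).

Lemma C1path_cst g : C1path (fun=> g).
Proof. by split; [exact: C1_cst | exact: C1mx_cst | exact: C1mx_cst]. Qed.

Lemma C1path_cmul gam del :
  C1path gam -> C1path del -> C1path (fun t => cmul (gam t) (del t)).
Proof.
move=> [a1 A1 v1] [a2 A2 v2]; split=> /=; [exact: C1M | exact: C1mxM |].
by apply: C1mxD => //; apply: C1mxZ => //; exact: C1mxM.
Qed.

Lemma C1path_cinv gam : (forall t, Conf R (gam t)) ->
  C1path gam -> C1path (fun t => cinv (gam t)).
Proof.
move=> gC [Ca CA Cv]; have Ci : C1 (fun t => (gam t).1.1^-1).
  by apply: C1V => // t; case: (gC t).
have CT : C1mx (fun t => invmx (gam t).1.2).
  by under eq_fun do rewrite Conf_invmx //; exact: C1mx_tr.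
split=> //=; under eq_fun do rewrite -scaleNr.
by apply: C1mxZ; [exact: C1N | exact: C1mxM].
Qed.

Lemma C1path_comp gam (f : R -> R) :
  C1 f -> C1path gam -> C1path (fun t => gam (f t)).
Proof.
move=> Cf [Ca CA Cv]; split; first exact: (C1_comp Ca Cf).
  by move=> i j; exact: (C1_comp (CA i j) Cf).
by move=> i j; exact: (C1_comp (Cv i j) Cf).
Qed.

Lemma C1mx_block m1 m2 n1 n2 (A : R -> 'M[R]_(m1, n1)) (B : R -> 'M[R]_(m1, n2))
    (C : R -> 'M[R]_(m2, n1)) (D : R -> 'M[R]_(m2, n2)) :
  C1mx A -> C1mx B -> C1mx C -> C1mx D ->
  C1mx (fun t => block_mx (A t) (B t) (C t) (D t)).
Proof.
move=> CA CB CC CD i j.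
case: (split_ordP i) => i' ->; case: (split_ordP j) => j' ->.
- by under eq_fun do rewrite block_mxEul.
- by under eq_fun do rewrite block_mxEur.
- by under eq_fun do rewrite block_mxEdl.
- by under eq_fun do rewrite block_mxEdr.
Qed.

Lemma C1path_rho gam : C1path gam -> C1mx (fun t => rho (gam t)).
Proof.
move=> [Ca CA Cv]; apply: C1mx_block => //; try exact: C1mx_cst.
exact: C1mxZ.
Qed.

Lemma C1path_affine gam (a b : R) :
  C1path gam -> C1path (fun t => gam (a * t + b)).
Proof.
move=> Cg; apply: (C1path_comp _ Cg); apply: C1D; last exact: C1_cst.
by apply: C1M; [exact: C1_cst | exact: C1_id].
Qed.

Lemma is_derive_affine (a b t : R) : is_derive t 1 (fun s : R => a * s + b) a.
Proof.
apply: is_derive_eq.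
by rewrite /GRing.scale /=; ring.
Qed.

(** The Lie algebra of G, as the velocities at the identity of the paths in G. *)
Definition tangent G : set 'M[R]_(3 + 1) :=
  [set X | exists2 gam, path_in G gam &
     gam 0 = conf1 R /\ mxder (fun t => rho (gam t)) 0 X].

Lemma mxder_shift m n (M : R -> 'M[R]_(m, n)) (t a b : R) D :
  mxder M (a * t + b) D -> mxder (fun s => M (a * s + b)) t (a *: D).
Proof.
move=> MD; apply: (@mxder_comp _ _ _ M (fun s => a * s + b) t D a MD).
exact: is_derive_affine.
Qed.

Section LieAlgebra.
Variable G : set (triple R).
Hypothesis sG : subgroup G.

Let GC : G `<=` Conf R. Proof. by case: sG. Qed.
Let G1 : G (conf1 R). Proof. by case: sG. Qed.
Let GM g h : G g -> G h -> G (cmul g h). Proof. by case: sG => _ _ H _; exact: H. Qed.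
Let GV g : G g -> G (cinv g). Proof. by case: sG => _ _ _ H; exact: H. Qed.

Lemma path_cmul gam del :
  path_in G gam -> path_in G del -> path_in G (fun t => cmul (gam t) (del t)).
Proof.
by move=> [Cg Gg] [Cd Gd]; split; [exact: C1path_cmul | move=> t; exact: GM].
Qed.

Lemma path_cst g : G g -> path_in G (fun=> g).
Proof. by move=> Gg; split; [exact: C1path_cst | move=> t; exact: Gg]. Qed.

Lemma tangent0 : tangent G 0.
Proof. by exists (fun=> conf1 R); [exact: path_cst | split=> //; exact: mxder_cst]. Qed.

Lemma tangentD X Y : tangent G X -> tangent G Y -> tangent G (X + Y).
Proof.
move=> [gam pg [g0 dg]] [del pd [d0 dd]].
exists (fun t => cmul (gam t) (del t)); first exact: path_cmul.
split; first by rewrite g0 d0 cmulg1.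
under eq_fun do rewrite rho_cmul.
by have := mxder_mul dg dd; rewrite g0 d0 !rho1 mulmx1 mul1mx.
Qed.

Lemma tangentZ (c : R) X : tangent G X -> tangent G (c *: X).
Proof.
move=> [gam [Cg Gg] [g0 dg]]; exists (fun t => gam (c * t + 0)).
  by split=> // ; exact: C1path_affine.
split; first by rewrite mulr0 addr0.
by apply: (@mxder_shift _ _ (fun t => rho (gam t))); rewrite mulr0 addr0.
Qed.

Lemma tangent_lin (c : R) X Y :
  tangent G X -> tangent G Y -> tangent G (c *: X + Y).
Proof. by move=> TX TY; apply: tangentD => //; exact: tangentZ. Qed.

Lemma tangent_Ad g X :
  G g -> tangent G X -> tangent G (rho g *m X *m rho (cinv g)).
Proof.
move=> Gg [gam pg [g0 dg]].
exists (fun t => cmul (cmul g (gam t)) (cinv g)).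
  by apply: path_cmul; [apply: path_cmul => //|]; apply: path_cst => //; exact: GV.
split; first by rewrite g0 cmulg1 cmulgV //; exact: GC.
under eq_fun do rewrite !rho_cmul.
have := mxder_mul (mxder_mul (mxder_cst (rho g) 0) dg)
  (mxder_cst (rho (cinv g)) 0).
by rewrite mul0mx add0r mulmx0 addr0.
Qed.

(** A tangent vector is moved to the identity by right translation. *)
Lemma path_velocity gam (t : R) : path_in G gam ->
  exists2 Y, tangent G Y & mxder (fun s => rho (gam s)) t (Y *m rho (gam t)).
Proof.
move=> [Cg Gg]; have [D dg] := C1mxP t (C1path_rho Cg).
exists (D *m rho (cinv (gam t))); last by rewrite -mulmxA rhoV ?mulmx1 //; exact: GC.
exists (fun s => cmul (gam (1 * s + t)) (cinv (gam t))).
  apply: path_cmul; first by split=> //; exact: C1path_affine.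
  exact/path_cst/GV.
split; first by rewrite mulr0 add0r cmulgV //; exact: GC.
under eq_fun do rewrite rho_cmul.
have dg0 : mxder (fun s => rho (gam (1 * s + t))) 0 (1 *: D).
  by apply: (@mxder_shift _ _ (fun s => rho (gam s))); rewrite mulr0 add0r.
have := mxder_mul dg0 (mxder_cst (rho (cinv (gam t))) 0).
by rewrite mulmx0 addr0 scale1r.
Qed.

Lemma mxder_linear m n m' n' (f : 'Hom('M[R]_(m, n), 'M[R]_(m', n')))
    (M : R -> 'M[R]_(m, n)) (t : R) D :
  mxder M t D -> mxder (fun s => f (M s)) t (f D).
Proof.
have fE A i j : f A i j = \sum_a \sum_b A a b * f (delta_mx a b) i j.
  rewrite {1}[A]matrix_sum_delta linear_sum summxE; apply: eq_bigr => a _.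
  rewrite linear_sum summxE; apply: eq_bigr => b _.
  by rewrite linearZ mxE.
move=> MD i j; under eq_fun do rewrite fE.
rewrite fE; apply: is_derive_bigsum => a; apply: is_derive_bigsum => b.
have ? := MD a b; apply: is_derive_eq.
by rewrite /GRing.scale /= mulr0 add0r mulrC.
Qed.

(** The bracket is the derivative of a curve of conjugates, and the subspace
    tangent G, being the kernel of a linear map, contains such derivatives. *)
Lemma tangent_bracket X Y :
  tangent G X -> tangent G Y -> tangent G (X *m Y - Y *m X).
Proof.
move=> [gam [Cg Gg] [g0 dg]] TY.
have [f fP] := subspace_kernel tangent0 tangent_lin.
have [X' dV] := C1mxP 0 (C1path_rho (C1path_cinv (fun t => GC (Gg t)) Cg)).
have g1 : cinv (gam 0) = conf1 R.
  by rewrite g0 -[LHS]cmul1g cmulgV //; exact: GC.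
have X'E : X' = - X.
  have := mxder_mul dg dV; rewrite (_ : (fun s => _) = fun=> 1%:M); last first.
    by apply/funext => s; apply/rho_mulV/GC/Gg.
  rewrite g1 g0 rho1 mulmx1 mul1mx => /mxder_uniq/(_ (mxder_cst _ _)) /eqP.
  by rewrite addrC addr_eq0 => /eqP.
have := mxder_mul (mxder_mul dg (mxder_cst Y 0)) dV.
rewrite g1 g0 rho1 mulmx1 mulmx0 addr0 mul1mx X'E mulmxN.
move=> /(mxder_linear f); rewrite (_ : (fun s => _) = fun=> 0); last first.
  by apply/funext => s; apply/fP/tangent_Ad.
by move=> /mxder_uniq/(_ (mxder_cst _ _)) /fP.
Qed.

End LieAlgebra.

End SimilarityGroup.

(** * Coordinates *)

Section Coordinates.
Variable R : realType.
Implicit Types x y z : 'cV[R]_3.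

Definition vec3 (a b c : R) : 'cV[R]_3 := \col_i nth 0 [:: a; b; c] i.

Lemma ord3_ind (P : 'I_3 -> Prop) : P 0 -> P 1 -> P 2 -> forall i, P i.
Proof.
move=> P0 P1 P2 [[|[|[|//]]] i3].
- by rewrite (_ : Ordinal i3 = 0) //; exact: val_inj.
- by rewrite (_ : Ordinal i3 = 1) //; exact: val_inj.
- by rewrite (_ : Ordinal i3 = 2) //; exact: val_inj.
Qed.

Lemma sum3 (V : nmodType) (F : 'I_3 -> V) : \sum_i F i = F 0 + F 1 + F 2.
Proof.
rewrite !big_ord_recl big_ord0 addr0 addrA.
by congr (_ + F _ + F _); exact: val_inj.
Qed.

Lemma vec3E a b c :
  (vec3 a b c 0 0 = a) * (vec3 a b c 1 0 = b) * (vec3 a b c 2 0 = c).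
Proof. by rewrite !mxE. Qed.

Lemma vec3P x y : x 0 0 = y 0 0 -> x 1 0 = y 1 0 -> x 2 0 = y 2 0 -> x = y.
Proof.
move=> e0 e1 e2; apply/matrixP => i j; rewrite !ord1.
by elim/ord3_ind: i.
Qed.

Lemma vec3K x : vec3 (x 0 0) (x 1 0) (x 2 0) = x.
Proof. by apply: vec3P; rewrite vec3E. Qed.

Lemma addE x y i : (x + y) i 0 = x i 0 + y i 0. Proof. by rewrite mxE. Qed.
Lemma scaleE (c : R) x i : (c *: x) i 0 = c * x i 0. Proof. by rewrite mxE. Qed.
Lemma oppE x i : (- x) i 0 = - x i 0. Proof. by rewrite mxE. Qed.
Lemma zeroE i : (0 : 'cV[R]_3) i 0 = 0. Proof. by rewrite mxE. Qed.
Definition entryE := (addE, scaleE, oppE, zeroE).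

Lemma col3P (M N : 'M[R]_3) :
  (forall i, col i M = col i N) -> M = N.
Proof. by move=> MN; apply/matrixP => i j; have /colP/(_ i) := MN j; rewrite !mxE. Qed.

Definition det3 x y z : R :=
  x 0 0 * (y 1 0 * z 2 0 - y 2 0 * z 1 0) -
  x 1 0 * (y 0 0 * z 2 0 - y 2 0 * z 0 0) +
  x 2 0 * (y 0 0 * z 1 0 - y 1 0 * z 0 0).

Definition cols3 x y z : 'M[R]_3 := \matrix_(i, j) nth 0 [:: x; y; z] j i 0.

Lemma cols3E x y z i :
  (cols3 x y z i 0 = x i 0) * (cols3 x y z i 1 = y i 0) *
  (cols3 x y z i 2 = z i 0).
Proof. by rewrite !mxE. Qed.

Lemma col_cols3 x y z :
  (col 0 (cols3 x y z) = x) * (col 1 (cols3 x y z) = y) *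
  (col 2 (cols3 x y z) = z).
Proof. by do !split; apply/matrixP => i j; rewrite !ord1 !mxE. Qed.

Lemma cols3_mul x y z h :
  cols3 x y z *m h = h 0 0 *: x + h 1 0 *: y + h 2 0 *: z.
Proof.
apply/matrixP => i j; rewrite !ord1 !mxE sum3 !cols3E.
by rewrite !(mulrC _ (h _ _)).
Qed.

Lemma col_mul m n p (M : 'M[R]_(m, n)) (N : 'M[R]_(n, p)) j :
  col j (M *m N) = M *m col j N.
Proof. by rewrite !colE mulmxA. Qed.

Lemma det_mx3 (M : 'M[R]_3) :
  \det M = det3 (col 0 M) (col 1 M) (col 2 M).
Proof.
pose f (i j : nat) := M (inord i) (inord j).
have Mf i j : M i j = f i j by rewrite /f !inord_val.
rewrite (expand_det_row _ 0) sum3 /cofactor !(expand_det_row _ 0).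
rewrite !big_ord_recl !big_ord0 /cofactor !det_mx11 !mxE /det3 !mxE !Mf.
clearbody f; clear Mf; rewrite /= /bump /=.
rewrite -![((1 %% 3 + 1 %% 3) %% 3)%N]/2%N -![(1 %% 3)%N]/1%N.
by rewrite ?addn0 ?add0n -![(1 + 1)%N]/2%N; ring.
Qed.

Lemma cols3_unit x y z : det3 x y z != 0 -> cols3 x y z \in unitmx.
Proof.
move=> d0; rewrite unitmxE unitfE det_mx3.
by congr (_ != 0) : d0; rewrite /det3 !mxE.
Qed.

(** The affine vector field generated by X, at x. *)
Definition kact (X : 'M[R]_(3 + 1)) x : 'cV[R]_3 :=
  usubmx (X *m col_mx x 1%:M).

(** The field x |-> a x + (p, q, r) x x + (u, v, w), where the second term is a
    cross product. *)
Definition kmx (a p q r u v w : R) : 'M[R]_(3 + 1) :=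
  block_mx (cols3 (vec3 a r (- q)) (vec3 (- r) a p) (vec3 q (- p) a))
    (vec3 u v w) 0 0.

Lemma kact_kmx a p q r u v w x :
  kact (kmx a p q r u v w) x =
  vec3 (a * x 0 0 - r * x 1 0 + q * x 2 0 + u)
       (r * x 0 0 + a * x 1 0 - p * x 2 0 + v)
       (- q * x 0 0 + p * x 1 0 + a * x 2 0 + w).
Proof.
rewrite /kact /kmx mul_block_col col_mxKu mulmx1 cols3_mul.
by apply: vec3P; rewrite !(entryE, vec3E); ring.
Qed.

Lemma kmx_eq a p q r u v w a' p' q' r' u' v' w' :
  a = a' -> p = p' -> q = q' -> r = r' -> u = u' -> v = v' -> w = w' ->
  kmx a p q r u v w = kmx a' p' q' r' u' v' w'.
Proof. by move=> -> -> -> -> -> -> ->. Qed.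

Lemma kmx_lin c a p q r u v w a' p' q' r' u' v' w' :
  c *: kmx a p q r u v w + kmx a' p' q' r' u' v' w' =
  kmx (c * a + a') (c * p + p') (c * q + q') (c * r + r')
      (c * u + u') (c * v + v') (c * w + w').
Proof.
rewrite /kmx scale_block_mx add_block_mx !scaler0 !addr0; congr block_mx.
  apply: col3P; apply: ord3_ind; rewrite linearD linearZ /= !col_cols3;
    by apply: vec3P; rewrite !(entryE, vec3E); ring.
by apply: vec3P; rewrite !(entryE, vec3E).
Qed.

Lemma kmx0 : kmx 0 0 0 0 0 0 0 = 0.
Proof.
have := kmx_lin (-1) 0 0 0 0 0 0 0 0 0 0 0 0 0 0.
by rewrite scaleN1r addNr !mulr0 !addr0.
Qed.

Lemma kmx_bracket a p q r u v w a' p' q' r' u' v' w' :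
  kmx a p q r u v w *m kmx a' p' q' r' u' v' w' -
  kmx a' p' q' r' u' v' w' *m kmx a p q r u v w =
  kmx 0 (q * r' - r * q') (r * p' - p * r') (p * q' - q * p')
    (a * u' - r * v' + q * w' - (a' * u - r' * v + q' * w))
    (r * u' + a * v' - p * w' - (r' * u + a' * v - p' * w))
    (- q * u' + p * v' + a * w' - (- q' * u + p' * v + a' * w)).
Proof.
rewrite /kmx !mulmx_block !mulmx0 !mul0mx !addr0 opp_block_mx add_block_mx.
rewrite !subr0; congr block_mx.
  apply: col3P; apply: ord3_ind; rewrite linearB /= !col_mul !col_cols3 !cols3_mul;
    by apply: vec3P; rewrite !(entryE, vec3E); ring.
by apply: vec3P; rewrite !(cols3_mul, entryE, vec3E); ring.
Qed.

End Coordinates.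

(** * Vector fields and orbits *)

Section Orbits.
Variable R : realType.
Implicit Types (g h c : triple R) (G : set (triple R)) (x y : 'cV[R]_3).

Lemma mxder_tr m n (M : R -> 'M[R]_(m, n)) (t : R) D :
  mxder M t D -> mxder (fun s => (M s)^T) t D^T.
Proof. by move=> MD i j; under eq_fun do rewrite mxE; rewrite mxE; exact: MD. Qed.

Lemma block_kmx (N : 'M[R]_3) (u : 'cV[R]_3) (b : R) : N^T + N = b%:M ->
  block_mx N u 0 0 =
  kmx (b / 2) (N 2 1) (N 0 2) (N 1 0) (u 0 0) (u 1 0) (u 2 0).
Proof.
move=> NN; have NE i j : N j i + N i j = b *+ (i == j).
  by have /matrixP/(_ i j) := NN; rewrite !mxE.
rewrite /kmx vec3K; congr block_mx.
have := (NE 0 0, NE 1 1, NE 2 2, NE 0 1, NE 0 2, NE 1 2).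
rewrite !eqxx /= => -[[[[[e0 e1] e2] e01] e02] e12].
apply: col3P; apply: ord3_ind; rewrite col_cols3; apply: vec3P;
  rewrite vec3E mxE; lra.
Qed.

(** Differentiating A^T A = 1 leaves a skew matrix plus a scalar one. *)
Lemma tangent_kmx G X : G `<=` Conf R -> tangent G X ->
  exists a p q r u v w, X = kmx a p q r u v w.
Proof.
move=> GC [gam [Cg Gg] [g0 dg]].
pose N := ulsubmx X.
have dP : mxder (fun t => (gam t).1.1 *: (gam t).1.2) 0 N.
  move=> i j; have := dg (lshift 1 i) (lshift 1 j).
  by under eq_fun do rewrite block_mxEul; rewrite /N !mxE.
have [b [c' _ dc']] : exists b : R, C1 (fun t => (gam t).1.1 * (gam t).1.1).
  by exists 0; case: Cg => Ca _ _; exact: C1M.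
have P2 t : ((gam t).1.1 *: (gam t).1.2)^T *m ((gam t).1.1 *: (gam t).1.2) =
    ((gam t).1.1 * (gam t).1.1)%:M.
  have [_ AA] := GC _ (Gg t).
  rewrite [(_ *: _)^T]linearZ /= -scalemxAl -scalemxAr AA scalerA.
  by rewrite scalemx1.
have NN : N^T + N = (c' 0)%:M.
  have := mxder_mul (mxder_tr dP) dP.
  under eq_fun do rewrite P2.
  rewrite g0 /= scale1r trmx1 mulmx1 mul1mx => /mxder_uniq; apply=> i j.
  under eq_fun do rewrite mxE.
  rewrite mxE; case: (i == j); first exact: dc'.
  exact: is_derive_cst.
have low i j : X (rshift 3 i) j = 0.
  have := dg (rshift 3 i) j; case: (split_ordP j) => k ->.
    under eq_fun do rewrite block_mxEdl mxE.
    by move=> /is_derive_uniq; apply; exact: is_derive_cst.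
  under eq_fun do rewrite block_mxEdr mxE.
  by move=> /is_derive_uniq; apply; exact: is_derive_cst.
exists (c' 0 / 2), (N 2 1), (N 0 2), (N 1 0).
exists (ursubmx X 0 0), (ursubmx X 1 0), (ursubmx X 2 0).
have dl : dlsubmx X = 0 by apply/matrixP => i j; rewrite !mxE low.
have dr : drsubmx X = 0 by apply/matrixP => i j; rewrite !mxE low.
by apply: etrans (esym (submxK X)) _; rewrite dl dr (block_kmx _ NN).
Qed.

Lemma orbit_ode G gam (t : R) : subgroup G -> path_in G gam ->
  exists2 X, tangent G X & forall x i, is_derive t 1
    (fun s => cact (gam s) x i 0) (kact X (cact (gam t) x) i 0).
Proof.
move=> sG pg; have [Y TY dY] := path_velocity sG t pg.
exists Y => // x i.
have := mxder_mul dY (mxder_cst (col_mx x (1%:M : 'M[R]_1)) t).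
rewrite mulmx0 addr0 -mulmxA rho_cact => /(_ (lshift 1 i) 0).
under eq_fun do rewrite rho_cact col_mxEu.
by rewrite /kact [in X in _ -> X]mxE.
Qed.

(** The map (s1, s2, s3) |-> gam1(s1) gam2(s2) gam3(s3) x has the invertible
    strict derivative with columns Xi(x). *)
Lemma paths_locally_onto gam1 gam2 gam3 X1 X2 X3 x (r : R) :
  C1path gam1 -> C1path gam2 -> C1path gam3 ->
  gam1 0 = conf1 R -> gam2 0 = conf1 R -> gam3 0 = conf1 R ->
  mxder (fun t => rho (gam1 t)) 0 X1 -> mxder (fun t => rho (gam2 t)) 0 X2 ->
  mxder (fun t => rho (gam3 t)) 0 X3 ->
  det3 (kact X1 x) (kact X2 x) (kact X3 x) != 0 -> 0 < r ->
  exists2 d : R, 0 < d & forall y, `|y - x| < d ->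
    exists s1 s2 s3, [/\ `|s1| < r, `|s2| < r, `|s3| < r &
      y = cact (gam1 s1) (cact (gam2 s2) (cact (gam3 s3) x))].
Proof.
move=> C1g C2g C3g g1 g2 g3 d1 d2 d3 dn0 r0.
have sd (i : 'I_3) (gam : R -> triple R) X (Cg : C1path gam)
    (dX : mxder (fun t => rho (gam t)) 0 X) :=
  sdiff_curve i (C1path_rho Cg) dX.
pose hx := col_mx x (1%:M : 'M[R]_1).
pose F (s : 'cV[R]_3) :=
  cact (gam1 (s 0 0)) (cact (gam2 (s 1 0)) (cact (gam3 (s 2 0)) x)).
pose P (s : 'cV[R]_3) :=
  rho (gam1 (s 0 0)) *m rho (gam2 (s 1 0)) *m rho (gam3 (s 2 0)).
have FP s : F s = usubmx (P s *m hx).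
  by rewrite /P /hx -!mulmxA !rho_cact col_mxKu.
pose D (h : 'cV[R]_3) := h 0 0 *: X1 + h 1 0 *: X2 + h 2 0 *: X3.
have sP : sdiff P D.
  have := sdiff_mul (sdiff_mul (sd 0 _ _ C1g d1) (bounded_op_curve 0 X1)
    (sd 1 _ _ C2g d2) (bounded_op_curve 1 X2)) _ (sd 2 _ _ C3g d3)
    (bounded_op_curve 2 X3).
  have bD : bounded_op (fun h : 'cV[R]_3 =>
      h 0 0 *: X1 *m rho (gam2 ((0 : 'cV[R]_3) 1 0)) +
      rho (gam1 ((0 : 'cV[R]_3) 0 0)) *m (h 1 0 *: X2)).
    under eq_fun do rewrite !mxE g1 g2 !rho1 mulmx1 mul1mx.
    by apply: bounded_opD; exact: bounded_op_curve.
  move=> /(_ bD) H e e0; have [d d0 dP] := H e e0; exists d => // s t sd' td'.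
  have := dP s t sd' td'; congr (`|_ - _| <= _).
  by rewrite !zeroE g1 g2 g3 !rho1 !(mulmx1, mul1mx).
have usD (A B : 'cV[R]_(3 + 1)) : usubmx (A + B) = usubmx A + usubmx B.
  exact: linearD.
have usZ (b : R) (A : 'cV[R]_(3 + 1)) : usubmx (b *: A) = b *: usubmx A.
  exact: linearZ.
have usB (A B : 'cV[R]_(3 + 1)) : usubmx (A - B) = usubmx A - usubmx B.
  exact: linearB.
have sF : sdiff F (mulmx (cols3 (kact X1 x) (kact X2 x) (kact X3 x))).
  move=> e e0; pose K := (3 + 1)%:R * `|hx| + 1.
  have K0 : 0 < K by rewrite ltr_wpDl // mulr_ge0.
  have [d d0 dP] := sP (e / K) (divr_gt0 e0 K0); exists d => // s t sd' td'.
  have -> : F s - F t - cols3 (kact X1 x) (kact X2 x) (kact X3 x) *m (s - t) =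
      usubmx ((P s - P t - D (s - t)) *m hx).
    rewrite !mulmxBl !usB -!FP; congr (_ - _).
    rewrite cols3_mul /D !mulmxDl !usD -!scalemxAl.
    by rewrite !usZ.
  apply: (@le_trans _ _ `|(P s - P t - D (s - t)) *m hx|).
    by apply: mx_norm_le => // i j; rewrite mxE ler_entry_norm.
  apply: (le_trans (mx_normM _ _)); rewrite mulrAC.
  apply: (@le_trans _ _ (K * (e / K * `|s - t|))).
    apply: ler_pM; rewrite ?mulr_ge0 //; last exact: dP.
    by rewrite /K lerDl.
  by rewrite mulrA mulrCA divff ?mulr1 // gt_eqF.
have [d d0 dF] := sdiff_locally_onto sF (cols3_unit dn0) r0.
have F0 : F 0 = x by rewrite /F !zeroE g1 g2 g3 !cact1.
exists d => // y; rewrite -{1}F0 => /dF[s sr <-].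
exists (s 0 0), (s 1 0), (s 2 0); split=> //;
  exact: le_lt_trans (ler_entry_norm _ _ _) sr.
Qed.

Definition orbit_open G x := exists2 d : R, 0 < d &
  forall y, `|y - x| < d -> conf_orbit G x y.

(** The case excluded by cohomogeneity one. *)
Lemma tangent_spans_orbit_open G X1 X2 X3 x : subgroup G ->
  tangent G X1 -> tangent G X2 -> tangent G X3 ->
  det3 (kact X1 x) (kact X2 x) (kact X3 x) != 0 -> orbit_open G x.
Proof.
move=> [_ _ GM _] [gam1 [C1g G1g] [g1 d1]] [gam2 [C2g G2g] [g2 d2]].
move=> [gam3 [C3g G3g] [g3 d3]] dn0.
have [d d0 dP] := paths_locally_onto C1g C2g C3g g1 g2 g3 d1 d2 d3 dn0 ltr01.
exists d => // y /dP[s1 [s2 [s3 [_ _ _ ->]]]].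
exists (cmul (gam1 s1) (cmul (gam2 s2) (gam3 s3))); last by rewrite !cact_cmul.
by apply: (GM) => //; apply: (GM).
Qed.

End Orbits.

(** * Conjugation *)

Section Conjugation.
Variable R : realType.
Implicit Types (g h c d : triple R) (G : set (triple R)) (x y : 'cV[R]_3).

(** Normed spaces, so that continuity refers to the topology of the norm. *)
Definition E2 : normedModType R := 'rV[R]_2.
Definition E3 : normedModType R := 'cV[R]_3.

(** Chains of paths in G starting at 1 reach all of G, in the form of an induction
    principle. *)
Definition C1_connected G : Prop := forall A : set (triple R),
  A (conf1 R) ->
  (forall gam s t, path_in G gam -> A (gam s) -> A (gam t)) -> G `<=` A.

(** Some orbit is at least two-dimensional, in a purely topological sense. *)
Definition thick G : Prop :=
  exists (U : set E2) (phi : E2 -> E3) (x : 'cV[R]_3),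
  [/\ open U, U !=set0, forall u, U u -> {for u, continuous phi},
      {in U &, injective phi} & forall u, U u -> conf_orbit G x (phi u)].

(** The Lie algebra has dimension at most one. *)
Definition thin G : Prop :=
  exists X, forall Y, tangent G Y -> exists s : R, Y = s *: X.

Lemma orbit_refl G x : subgroup G -> conf_orbit G x x.
Proof. by case=> _ G1 _ _; exists (conf1 R); rewrite ?cact1. Qed.

Lemma orbit_sym G x y : subgroup G -> conf_orbit G x y -> conf_orbit G y x.
Proof.
move=> [GC _ _ GV] [g Gg <-]; exists (cinv g); first exact: GV.
by rewrite cactK //; exact: GC.
Qed.

Lemma orbit_trans G x y z : subgroup G ->
  conf_orbit G x y -> conf_orbit G y z -> conf_orbit G x z.
Proof.
move=> [_ _ GM _] [g Gg <-] [h Gh <-].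
by exists (cmul h g); rewrite ?cact_cmul //; exact: GM.
Qed.

Lemma cinvM g h : Conf R g -> Conf R h ->
  cinv (cmul g h) = cmul (cinv h) (cinv g).
Proof.
move=> gC hC; have ghC := Conf_cmul gC hC.
have e : cmul (cmul g h) (cmul (cinv h) (cinv g)) = conf1 R.
  by rewrite cmulA -(cmulA g) cmulgV // cmulg1 cmulgV.
by rewrite -[LHS]cmulg1 -e cmulA cmulVg // cmul1g.
Qed.

Lemma cinvK g : Conf R g -> cinv (cinv g) = g.
Proof.
move=> gC; have giC := Conf_cinv gC.
by rewrite -[LHS]cmulg1 -(cmulVg gC) cmulA cmulVg // cmul1g.
Qed.

Lemma conj_setM c d G : Conf R c -> Conf R d ->
  conj_set c (conj_set d G) = conj_set (cmul c d) G.
Proof.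
move=> cC dC; rewrite /conj_set image_comp; apply: eq_imagel => g _ /=.
by rewrite cinvM // !cmulA.
Qed.

Lemma conj_set1 G : conj_set (conf1 R) G = G.
Proof.
rewrite /conj_set (_ : cinv (conf1 R) = conf1 R).
  under eq_imagel do rewrite cmulg1 cmul1g.
  exact: image_id.
by rewrite -[LHS]cmul1g cmulgV //; exact: Conf_conf1.
Qed.

Lemma conj_setK c G : Conf R c -> conj_set (cinv c) (conj_set c G) = G.
Proof.
by move=> cC; rewrite conj_setM ?cmulVg ?conj_set1 //; exact: Conf_cinv.
Qed.

Lemma subgroup_conj c G : Conf R c -> subgroup G -> subgroup (conj_set c G).
Proof.
move=> cC [GC G1 GM GV]; have ciC := Conf_cinv cC; split.
- by move=> _ [g Gg <-]; do 2 (apply: Conf_cmul => //); exact: GC.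
- by exists (conf1 R) => //; rewrite cmulg1 cmulgV.
- move=> _ _ [g Gg <-] [h Gh <-]; exists (cmul g h); first exact: GM.
  by rewrite !cmulA -(cmulA _ (cinv c) c) cmulVg // cmulg1.
- move=> _ [g Gg <-]; exists (cinv g); first exact: GV.
  by rewrite !cinvM ?cinvK ?cmulA //; [exact: GC | apply: Conf_cmul => //; exact: GC].
Qed.

Lemma path_conj c G gam :
  path_in G gam -> path_in (conj_set c G) (fun t => cmul (cmul c (gam t)) (cinv c)).
Proof.
move=> [Cg Gg]; split; last by move=> t; exists (gam t).
by do 2 (try apply: C1path_cmul); try exact: C1path_cst.
Qed.

Lemma C1_connected_conj c G : Conf R c ->
  C1_connected G -> C1_connected (conj_set c G).
Proof.
move=> cC Gc A A1 AP _ [g Gg <-].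
apply: (Gc (fun g => A (cmul (cmul c g) (cinv c)))) Gg => /=.
  by rewrite cmulg1 cmulgV.
by move=> gam s t pg; exact: (AP _ _ _ (path_conj c pg)).
Qed.

Lemma orbit_conj c G x y : Conf R c ->
  conf_orbit (conj_set c G) (cact c x) (cact c y) <-> conf_orbit G x y.
Proof.
move=> cC; split=> [[_ [g Gg <-]]|[g Gg <-]].
  rewrite !cact_cmul cactK // => /(congr1 (cact (cinv c))).
  by rewrite !cactK // => <-; exists g.
exists (cmul (cmul c g) (cinv c)); first by exists g.
by rewrite !cact_cmul cactK.
Qed.

Lemma cactB c x y : cact c x - cact c y = c.1.1 *: (c.1.2 *m (x - y)).
Proof. by rewrite /cact opprD addrACA subrr addr0 -scalerBr -mulmxBr. Qed.

Lemma cact_lipschitz c : exists2 K : R, 0 < K &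
  forall x y, `|cact c x - cact c y| <= K * `|x - y|.
Proof.
exists (`|c.1.1| * (3%:R * `|c.1.2|) + 1); first by rewrite ltr_wpDl.
move=> x y; rewrite cactB normrZ mulrDl mul1r ler_wpDr //.
by rewrite -mulrA ler_wpM2l //; exact: mx_normM.
Qed.

Lemma lipschitz_continuous (V W : normedModType R) (f : V -> W) (K : R) :
  0 < K -> (forall x y : V, `|f x - f y| <= K * `|x - y|) -> continuous f.
Proof.
move=> K0 fK x; apply/cvgrPdist_lt => e e0; apply/nbhs_normP.
exists (e / K) => /= [|y]; first by rewrite divr_gt0.
rewrite /ball_ /= ltr_pdivlMr // mulrC => xy.
exact: le_lt_trans (fK _ _) xy.
Qed.

Lemma cact_continuous c : continuous (cact c : E3 -> E3).
Proof.
have [K K0 cK] := cact_lipschitz c.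
exact: (@lipschitz_continuous E3 E3 (cact c) K).
Qed.

Lemma thick_conj c G : Conf R c -> thick G -> thick (conj_set c G).
Proof.
move=> cC [U [phi [x [Uo U0 phic phii phiG]]]].
exists U, (cact c \o phi), (cact c x); split=> //.
- move=> u Uu; apply: continuous_comp; [exact: phic | exact: cact_continuous].
- move=> u v Uu Uv /= /(congr1 (cact (cinv c))).
  by rewrite !cactK //; exact: phii.
- by move=> u Uu; apply/orbit_conj => //; exact: phiG.
Qed.

Lemma orbit_open_conj c G x : Conf R c ->
  orbit_open (conj_set c G) (cact c x) -> orbit_open G x.
Proof.
move=> cC [d d0 dP]; have [K K0 cK] := cact_lipschitz c.
exists (d / K); first by rewrite divr_gt0.
move=> y yd; apply/(orbit_conj _ _ _ cC)/dP.
by rewrite (le_lt_trans (cK _ _))// mulrC -ltr_pdivlMr.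
Qed.

Lemma tangent_conj c G X : Conf R c ->
  tangent G X -> tangent (conj_set c G) (rho c *m X *m rho (cinv c)).
Proof.
move=> cC [gam pg [g0 dg]].
exists (fun t => cmul (cmul c (gam t)) (cinv c)); first exact: path_conj.
split; first by rewrite g0 cmulg1 cmulgV.
under eq_fun do rewrite !rho_cmul.
have := mxder_mul (mxder_mul (mxder_cst (rho c) 0) dg)
  (mxder_cst (rho (cinv c)) 0).
by rewrite mul0mx add0r mulmx0 addr0.
Qed.

Lemma tangent_conjV c G X : Conf R c ->
  tangent (conj_set c G) X -> tangent G (rho (cinv c) *m X *m rho c).
Proof.
move=> cC /(tangent_conj (Conf_cinv cC)).
by rewrite conj_setK // cinvK.
Qed.

Lemma rho_conjK c X : Conf R c ->
  rho c *m (rho (cinv c) *m X *m rho c) *m rho (cinv c) = X.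
Proof.
by move=> cC; rewrite !mulmxA rho_mulV // mul1mx -mulmxA rho_mulV // mulmx1.
Qed.

Lemma same_orbits_conj c G H : Conf R c ->
  same_orbits_upto_conj (conj_set c G) H -> same_orbits_upto_conj G H.
Proof.
move=> cC [d dC dP]; exists (cmul d c); first exact: Conf_cmul.
by move=> x; rewrite -dP conj_setM.
Qed.

Lemma Conf_translation (b : 'cV[R]_3) : Conf R (1, 1%:M, b).
Proof. by split; rewrite /= ?oner_neq0 // trmx1 mulmx1. Qed.

Lemma Conf_rotation (A : 'M[R]_3) : A^T *m A = 1%:M -> Conf R (1, A, 0).
Proof. by move=> AA; split; rewrite //= oner_neq0. Qed.

Lemma kmx_trans_conj a p q r u v w (b : 'cV[R]_3) :
  let b' := kact (kmx a p q r 0 0 0) b in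
  rho (1, 1%:M, b) *m kmx a p q r u v w *m rho (cinv (1, 1%:M, b)) =
  kmx a p q r (u - b' 0 0) (v - b' 1 0) (w - b' 2 0).
Proof.
rewrite /= kact_kmx !vec3E /rho /kmx !mulmx_block /=.
rewrite !scale1r invr1 scale1r invmx1 !(mulmx1, mul1mx, mulmx0, mul0mx, addr0).
congr block_mx; first by rewrite scale1r mulmx1.
rewrite mulmxN cols3_mul.
by apply: vec3P; rewrite !(entryE, vec3E); ring.
Qed.

Lemma trans_rot_conj (A : 'M[R]_3) (u : 'cV[R]_3) :
  rho (1, A, 0) *m kmx 0 0 0 0 (u 0 0) (u 1 0) (u 2 0) *m
    rho (cinv (1, A, 0)) =
  kmx 0 0 0 0 ((A *m u) 0 0) ((A *m u) 1 0) ((A *m u) 2 0).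
Proof.
rewrite /rho /kmx /= !vec3K oppr0.
have -> : cols3 (vec3 0 0 0) (vec3 0 0 0) (vec3 0 0 0) = 0 :> 'M[R]_3.
  apply: col3P; apply: ord3_ind; rewrite col_cols3;
    by apply: vec3P; rewrite vec3E !mxE.
by rewrite !mulmx_block !(mulmx0, mul0mx, addr0, add0r, mulmx1, scale1r).
Qed.

Definition nsq x : R := x 0 0 ^+ 2 + x 1 0 ^+ 2 + x 2 0 ^+ 2.

Lemma nsq_ge0 x : 0 <= nsq x.
Proof. by rewrite !addr_ge0 // sqr_ge0. Qed.

Lemma nsq_eq0 x : nsq x = 0 -> x = 0.
Proof.
move=> /eqP; rewrite !paddr_eq0 ?addr_ge0 ?sqr_ge0 // !sqrf_eq0.
by move=> /andP[/andP[/eqP e0 /eqP e1] /eqP e2]; apply: vec3P; rewrite entryE.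
Qed.

Lemma trmx_mul_self x : x^T *m x = (nsq x)%:M.
Proof.
by apply/matrixP => i j; rewrite !ord1 !mxE sum3 !mxE /nsq !expr2 eqxx.
Qed.

Lemma nsq_isometry (A : 'M[R]_3) x : A^T *m A = 1%:M -> nsq (A *m x) = nsq x.
Proof.
move=> AA; have : (A *m x)^T *m (A *m x) = x^T *m x.
  by rewrite trmx_mul -mulmxA (mulmxA A^T) AA mul1mx.
by rewrite !trmx_mul_self => /matrixP/(_ 0 0); rewrite !mxE eqxx.
Qed.

(** The rotation by pi about the line spanned by x. *)
Definition half_turn x : 'M[R]_3 := (2 / nsq x) *: (x *m x^T) - 1%:M.

Lemma half_turnE x y : half_turn x *m y =
  (2 * (x 0 0 * y 0 0 + x 1 0 * y 1 0 + x 2 0 * y 2 0) / nsq x) *: x - y.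
Proof.
rewrite mulmxBl mul1mx -scalemxAl -mulmxA; congr (_ - y).
apply/matrixP => i j; rewrite !ord1 !mxE big_ord1 !mxE sum3 !mxE.
by ring.
Qed.

Lemma half_turn_rotation x : nsq x != 0 ->
  (half_turn x)^T *m half_turn x = 1%:M /\ \det (half_turn x) = 1.
Proof.
move=> x0; split.
  pose U := x *m x^T.
  have UU : U *m U = nsq x *: U.
    by rewrite /U mulmxA -(mulmxA x) trmx_mul_self mul_mx_scalar -scalemxAl.
  have HT : (half_turn x)^T = half_turn x.
    by apply/matrixP => i j; rewrite !mxE !big_ord1 !mxE eq_sym; ring.
  rewrite HT /half_turn -/U.
  rewrite mulmxBl mul1mx mulmxBr mulmx1 -scalemxAl -scalemxAr UU !scalerA.
  rewrite (_ : 2 / nsq x * (2 / nsq x) * nsq x = 2 / nsq x + 2 / nsq x).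
    by rewrite scalerDl addrK subKr.
  by field.
rewrite det_mx3 /det3 !mxE !big_ord1 !mxE /=.
rewrite /nsq in x0 *; move: x0.
move: (x 0 0) (x 1 0) (x 2 0) => a b e abe0.
by field.
Qed.

(** The half-turn about the bisector of x and y exchanges them. *)
Lemma rotation_exists x y : nsq x = nsq y ->
  exists A : 'M[R]_3, [/\ A^T *m A = 1%:M, \det A = 1 & A *m x = y].
Proof.
move=> xy; have [s0|s0] := eqVneq (nsq (x + y)) 0; last first.
  exists (half_turn (x + y)); have [? ?] := half_turn_rotation s0.
  split=> //; rewrite half_turnE.
  have -> : 2 * (((x + y) 0 0) * x 0 0 + (x + y) 1 0 * x 1 0 +
      (x + y) 2 0 * x 2 0) = nsq (x + y).
    by move: xy; rewrite /nsq !entryE; lra.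
  by rewrite divff // scale1r addrC addKr.
have yE : y = - x.
  by apply/eqP; rewrite -addr_eq0 addrC; apply/eqP/nsq_eq0.
rewrite {}yE {s0 xy}; have [x01|x01] := eqVneq (x 0 0 ^+ 2 + x 1 0 ^+ 2) 0.
  have [x0 x1] : x 0 0 = 0 /\ x 1 0 = 0.
    move/eqP: x01; rewrite paddr_eq0 ?sqr_ge0 // !sqrf_eq0.
    by move=> /andP[/eqP ? /eqP ?].
  pose u := vec3 (1 : R) 0 0; have u0 : nsq u != 0.
    by rewrite /nsq !vec3E !(expr1n, expr0n) !addr0 oner_neq0.
  have [? ?] := half_turn_rotation u0; exists (half_turn u); split=> //.
  rewrite half_turnE x0 x1 !vec3E !(mulr0, mul0r, addr0).
  by rewrite scale0r sub0r.
(* a half-turn about any axis orthogonal to x sends x to - x *)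
pose u := vec3 (x 1 0) (- x 0 0) 0; have u0 : nsq u != 0.
  by rewrite /nsq !vec3E sqrrN expr0n addr0 addrC.
have [? ?] := half_turn_rotation u0; exists (half_turn u); split=> //.
rewrite half_turnE !vec3E (_ : 2 * _ = 0); last by ring.
by rewrite mul0r scale0r sub0r.
Qed.

Lemma rotate_to_axis x :
  exists2 A : 'M[R]_3, A^T *m A = 1%:M & A *m x = vec3 0 0 (Num.sqrt (nsq x)).
Proof.
have [|A [AA _ Ax]] := @rotation_exists x (vec3 0 0 (Num.sqrt (nsq x))).
  by rewrite {2}/nsq !vec3E !expr0n !add0r sqr_sqrtr ?nsq_ge0.
by exists A.
Qed.

End Conjugation.

(** * First integrals along paths *)

Section FirstIntegrals.
Variable R : realType.
Implicit Types (g h c : triple R) (G : set (triple R)) (x y : 'cV[R]_3).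

Lemma derive_eq (f : R -> R) (t a b : R) :
  is_derive t 1 f a -> a = b -> is_derive t 1 f b.
Proof. by move=> ? <-. Qed.

Lemma nsq_cact g x y : Conf R g ->
  nsq (cact g x - cact g y) = g.1.1 ^+ 2 * nsq (x - y).
Proof.
move=> [_ gA]; rewrite cactB -(nsq_isometry (x - y) gA) /nsq !entryE.
by ring.
Qed.

Lemma nsqB x y : nsq (x - y) =
  (x 0 0 - y 0 0) ^+ 2 + (x 1 0 - y 1 0) ^+ 2 + (x 2 0 - y 2 0) ^+ 2.
Proof. by rewrite /nsq !entryE. Qed.

(** Along a path in G all points move by the same element X of the Lie algebra;
    L is the logarithm of the scaling factor. *)
Lemma path_ode G gam : subgroup G -> path_in G gam ->
  exists L : R -> R, forall t : R, exists a p q r u v w,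
  [/\ tangent G (kmx a p q r u v w), is_derive t 1 L a &
    forall x i, is_derive t 1 (fun s => cact (gam s) x i 0)
      (kact (kmx a p q r u v w) (cact (gam t) x) i 0)].
Proof.
move=> sG pg; have GC : G `<=` Conf R by case: sG.
pose z := vec3 (1 : R) 0 0.
pose D t := nsq (cact (gam t) z - cact (gam t) 0).
have D0 t : 0 < D t.
  have gC := GC _ (pg.2 t); rewrite /D nsq_cact // subr0 mulr_gt0 //.
    by rewrite lt_def sqr_ge0 sqrf_eq0 andbT; case: gC.
  by rewrite /nsq !vec3E !expr0n !addr0 expr1n.
exists (fun t => ln (D t) / 2) => t.
have [X TX dX] := orbit_ode t sG pg.
have [a [p [q [r [u [v [w XE]]]]]]] := tangent_kmx GC TX.
exists a, p, q, r, u, v, w; rewrite -XE; split=> //.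
have dD : is_derive t 1 D (2 * a * D t).
  have dz i := dX z i; have d0 i := dX 0 i.
  rewrite /D; under eq_fun do rewrite nsqB.
  have := (dz 0, dz 1, dz 2, d0 0, d0 1, d0 2).
  rewrite XE !kact_kmx !vec3E => -[[[[[? ?] ?] ?] ?] ?].
  apply: is_derive_eq.
  by rewrite nsqB /GRing.scale /=; ring.
have ? := is_derive1_ln (D0 t).
have ? : is_derive t 1 (fun t => ln (D t)) ((D t)^-1 * (2 * a * D t)).
  exact: is_derive1_comp.
apply: (@is_derive_eq _ _ _ (fun t => ln (D t) * 2^-1)).
by rewrite /GRing.scale /=; field; rewrite gt_eqF.
Qed.

(** Undoing the flow, that is, scaling by expR (- a tau) and rotating by
    - r tau, gives a first integral. *)
Lemma planar_flow (a r : R) (y0 y1 tau : R -> R) :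
  (forall t : R, exists s : R, [/\ is_derive t 1 tau s,
    is_derive t 1 y0 (s * (a * y0 t - r * y1 t)) &
    is_derive t 1 y1 (s * (r * y0 t + a * y1 t))]) ->
  forall t t', let d := tau t' - tau t in
    y0 t' = expR (a * d) * (cos (r * d) * y0 t - sin (r * d) * y1 t) /\
    y1 t' = expR (a * d) * (sin (r * d) * y0 t + cos (r * d) * y1 t).
Proof.
move=> dy t t' d.
pose E s := expR (- a * (tau s - tau t)).
pose C s := cos (r * (tau s - tau t)).
pose S s := sin (r * (tau s - tau t)).
have dE (s b : R) : is_derive s 1 tau b -> [/\ is_derive s 1 E (- a * b * E s),
    is_derive s 1 C (- r * b * S s) & is_derive s 1 S (r * b * C s)].
  move=> dtau.
  have da (k : R) : is_derive s 1 (fun s => k * (tau s - tau t)) (k * b).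
    by apply: is_derive_eq; rewrite /GRing.scale /=; ring.
  split.
  - apply: derive_eq (is_derive1_comp (is_derive_expR _) (da (- a))) _.
    by rewrite mulrC.
  - apply: derive_eq (is_derive1_comp (is_derive_cos _) (da r)) _.
    by rewrite /S; ring.
  - apply: derive_eq (is_derive1_comp (is_derive_sin _) (da r)) _.
    by rewrite /C; ring.
have u_cst : forall s, E s * (C s * y0 s + S s * y1 s) =
    E t * (C t * y0 t + S t * y1 t).
  move=> s; apply: (is_derive_0_is_cst (f := fun s => E s * (C s * y0 s + S s * y1 s))).
  move=> {}s; have [b [dt d0 d1]] := dy s; have [? ? ?] := dE s b dt.
  by apply: is_derive_eq; rewrite /GRing.scale /=; ring.
have v_cst : forall s, E s * (C s * y1 s - S s * y0 s) =
    E t * (C t * y1 t - S t * y0 t).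
  move=> s; apply: (is_derive_0_is_cst (f := fun s => E s * (C s * y1 s - S s * y0 s))).
  move=> {}s; have [b [dt d0 d1]] := dy s; have [? ? ?] := dE s b dt.
  by apply: is_derive_eq; rewrite /GRing.scale /=; ring.
have := u_cst t'; have := v_cst t'.
rewrite /E /C /S subrr !mulr0 expR0 cos0 sin0 -/d !(mul1r, mul0r) addr0 subr0.
move=> <- <-; have e1 : expR (a * d) * expR (- a * d) = 1.
  by rewrite mulNr expRN divff // expR_eq0.
have := cos2Dsin2 (r * d); move: e1 (y0 t') (y1 t').
move: (expR _) (expR _) (cos _) (sin _) => A B c s AB z0 z1 cs.
split.
  by rewrite -[LHS]mul1r -AB -[LHS]mul1r -cs; ring.
by rewrite -[LHS]mul1r -AB -[LHS]mul1r -cs; ring.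
Qed.

(** The condition a b = 0 holds once the fixed point of the flow, if a != 0, is at
    the origin; then y is affine or exponential in the time tau. *)
Lemma vertical_flow (a b : R) (y tau : R -> R) : a * b = 0 ->
  (forall t : R, exists s : R, is_derive t 1 tau s /\
    is_derive t 1 y (s * (a * y t + b))) ->
  forall t t', let d := tau t' - tau t in y t' = expR (a * d) * y t + b * d.
Proof.
move=> /eqP; rewrite mulf_eq0 => ab dy t t' d.
have [a0|a0] := eqVneq a 0.
  have := @is_derive_0_is_cst R (fun s => y s - b * tau s) t' t.
  rewrite a0 mul0r expR0 mul1r /d => H; have {}H : y t' - b * tau t' = y t - b * tau t.
    apply: H => s; have [k [? ?]] := dy s.
    by apply: is_derive_eq; rewrite a0 /GRing.scale /=; ring.
  by move: H; lra.
have b0 : b = 0 by move: ab; rewrite (negPf a0) => /eqP.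
pose E s := expR (- a * (tau s - tau t)).
have u_cst : E t' * y t' = E t * y t.
  apply: (is_derive_0_is_cst (f := fun s => E s * y s)) => s.
  have [k [? ?]] := dy s.
  have da : is_derive s 1 (fun s => - a * (tau s - tau t)) (- a * k).
    by apply: is_derive_eq; rewrite /GRing.scale /=; ring.
  have ? : is_derive s 1 E (expR (- a * (tau s - tau t)) * (- a * k)).
    exact: (@is_derive1_comp R expR _ s _ _ (is_derive_expR _) da).
  by apply: is_derive_eq; rewrite b0 /E /GRing.scale /=; ring.
move: u_cst; rewrite /E subrr mulr0 expR0 mul1r -/d => <-.
by rewrite b0 mul0r addr0 mulrA -expRD mulNr subrr expR0 mul1r.
Qed.

(** The points x and y lie on one integral curve of the field with scaling a,
    rotation r about the third axis and translation b along it. *)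
Definition flow_rel (a r b : R) x y := exists d : R,
  [/\ y 0 0 = expR (a * d) * (cos (r * d) * x 0 0 - sin (r * d) * x 1 0),
      y 1 0 = expR (a * d) * (sin (r * d) * x 0 0 + cos (r * d) * x 1 0) &
      y 2 0 = expR (a * d) * x 2 0 + b * d].

Lemma flow_rel_refl a r b x : flow_rel a r b x x.
Proof.
by exists 0; rewrite !mulr0 expR0 cos0 sin0 !(mul1r, mul0r) subr0 add0r addr0.
Qed.

Lemma flow_rel_trans a r b x y z : a * b = 0 ->
  flow_rel a r b x y -> flow_rel a r b y z -> flow_rel a r b x z.
Proof.
move=> ab [d [y0 y1 y2]] [d' [z0 z1 z2]]; exists (d + d').
rewrite !mulrDr expRD cosD sinD; split.
- by rewrite z0 y0 y1; ring.
- by rewrite z1 y0 y1; ring.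
- have e : expR (a * d') * b = b.
    move/eqP: ab; rewrite mulf_eq0 => /orP[] /eqP ->; last by rewrite mulr0.
    by rewrite mul0r expR0 mul1r.
  rewrite z2 y2 mulrDr [_ * (b * d)]mulrA e; ring.
Qed.

(** The form in which first integrals are used: E says that they agree. *)
Lemma orbit_invariant G (E : 'cV[R]_3 -> 'cV[R]_3 -> Prop) :
  C1_connected G -> (forall x, E x x) ->
  (forall x y z, E x y -> E y z -> E x z) ->
  (forall gam s t x, path_in G gam -> E (cact (gam s) x) (cact (gam t) x)) ->
  forall x y, conf_orbit G x y -> E x y.
Proof.
move=> Gc Er Et Ep x _ [g Gg <-]; move: x.
apply: (Gc (fun g => forall x, E x (cact g x)) _ _ g Gg) => [x|gam s t pg H x].
  by rewrite cact1.
by apply: Et (H x) _; exact: Ep.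
Qed.

End FirstIntegrals.

(** * Groups with orbits of dimension at most one *)

Section PlanarDomains.
Variable R : realType.
Implicit Types (g h c : triple R) (G : set (triple R)) (x y : 'cV[R]_3).

Lemma affine_arc_continuous (V : normedModType R) (a b c : V) (p q : R -> R) :
  continuous p -> continuous q -> continuous (fun s => a + p s *: b + q s *: c).
Proof.
move=> pc qc s; apply: cvgD; first apply: cvgD.
- exact: cvg_cst.
- by apply: cvgZr_tmp; exact: pc.
- by apply: cvgZr_tmp; exact: qc.
Qed.

(** Three arcs with common end points and otherwise disjoint must all meet the
    fibre over an intermediate value, so a function on a planar domain has a
    fibre with at least three points. *)
Lemma planar_fibre3 (U : set (E2 R)) (phi : E2 R -> E3 R) (O : set 'cV[R]_3)
    (f : E3 R -> R) :
  open U -> U !=set0 -> (forall u, U u -> {for u, continuous phi}) ->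
  {in U &, injective phi} -> (forall u, U u -> O (phi u)) -> continuous f ->
  (forall y1 y2 y3, O y1 -> O y2 -> O y3 -> f y1 = f y2 -> f y1 = f y3 ->
     [\/ y1 = y2, y1 = y3 | y2 = y3]) -> False.
Proof.
move=> Uo [u Uu] phic phii phiO fc fib.
have /nbhs_normP[d d0 dU] : nbhs u U by exact: open_nbhs_nbhs.
have [e e0 ed] : exists2 e : R, 0 < e & e < d.
  by exists (d / 2); move: d0 => /= d0; lra.
pose v1 : 'rV[R]_2 := delta_mx 0 0; pose v2 : 'rV[R]_2 := delta_mx 0 1.
pose P (a b : R) : E2 R := u + a *: (v1 : E2 R) + b *: (v2 : E2 R).
have PU a b : `|a| <= e -> `|b| <= e -> U (P a b).
  move=> ae be; apply: dU; rewrite /ball_ /= /P !opprD !addrA subrr add0r.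
  apply: (@le_lt_trans _ _ e) => //.
  rewrite -opprD normrN; apply: mx_norm_le => [|i j]; first exact: ltW.
  rewrite !mxE !ord1 eqxx /=; case: j => [[|[|//]] j2] /=.
    by rewrite mulr1 mulr0 addr0.
  by rewrite mulr1 mulr0 add0r.
have Pinj a b a' b' : P a b = P a' b' -> a = a' /\ b = b'.
  rewrite /P -!addrA => /addrI /matrixP eP.
  have := eP 0 0; have := eP 0 1.
  by rewrite !mxE /= !(mulr0, mulr1, addr0, add0r) => -> ->.
pose k a b := f (phi (P a b)).
have kfib a1 b1 a2 b2 a3 b3 : `|a1| <= e -> `|b1| <= e -> `|a2| <= e ->
    `|b2| <= e -> `|a3| <= e -> `|b3| <= e ->
    k a1 b1 = k a2 b2 -> k a1 b1 = k a3 b3 ->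
    [\/ a1 = a2 /\ b1 = b2, a1 = a3 /\ b1 = b3 | a2 = a3 /\ b2 = b3].
  move=> h1 h2 h3 h4 h5 h6 e12 e13.
  have [U1 U2 U3] := And3 (PU _ _ h1 h2) (PU _ _ h3 h4) (PU _ _ h5 h6).
  have := fib _ _ _ (phiO _ U1) (phiO _ U2) (phiO _ U3) e12 e13.
  case=> /phii; rewrite !inE.
  - by move=> /(_ U1 U2)/Pinj; constructor.
  - by move=> /(_ U1 U3)/Pinj; constructor.
  - by move=> /(_ U2 U3)/Pinj; constructor.
have z0 : `|0 : R| <= e by rewrite normr0 ltW.
have ze : `|e| <= e by rewrite ger0_norm // ltW.
have zh : `|e / 2| <= e.
  by rewrite ger0_norm; [rewrite ler_pdivrMr //; lra | rewrite divr_ge0 // ltW].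
have [a [b [a0 b0 ab kab]]] : exists a b, [/\ 0 <= a, b <= e, a < b & k a 0 != k b 0].
  have [k1|k1] := eqVneq (k 0 0) (k (e / 2) 0); last first.
    by exists 0, (e / 2); split=> //; lra.
  have [k2|k2] := eqVneq (k 0 0) (k e 0); last by exists 0, e; split=> //; lra.
  by have := kfib _ _ _ _ _ _ z0 z0 zh z0 ze z0 k1 k2; case=> -[]; lra.
pose v := (k a 0 + k b 0) / 2.
(* the arcs with m = 0, 1, -1 run from P a 0 to P b 0 and meet nowhere else *)
have arc (m : R) : `|m| <= 1 -> exists s : R, [/\ 0 < s, s < 1 &
    k (a + s * (b - a)) (m * e * (s * (1 - s))) = v].
  move=> m1; pose p s := a + s * (b - a); pose q s := m * e * (s * (1 - s)).
  have pc : continuous p.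
    by apply: C1_continuous; apply: C1D; [exact: C1_cst |
      apply: C1M; [exact: C1_id | exact: C1_cst]].
  have qc : continuous q.
    apply: C1_continuous; apply: C1M; first exact: C1_cst.
    apply: C1M; first exact: C1_id.
    by apply: C1D; [exact: C1_cst | apply: C1N; exact: C1_id].
  have pqU s : 0 <= s -> s <= 1 -> U (P (p s) (q s)).
    move=> s0 s1; apply: PU.
      by rewrite /p ger0_norm; nra.
    have ss : 0 <= s * (1 - s) <= 1 by apply/andP; split; nra.
    rewrite /q normrM (normrM m) (ger0_norm (ltW e0)) (ger0_norm (andP ss).1).
    apply: (@le_trans _ _ (1 * e * 1)); last by lra.
    by apply: ler_pM => //; [rewrite mulr_ge0 // ltW | case/andP: ss |
      apply: ler_wpM2r => //; exact: ltW | case/andP: ss].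
  have [||s] := @IVT R (fun s => k (p s) (q s)) 0 1 v ler01.
  - apply: continuous_in_subspaceT => s; rewrite inE /= in_itv /= => /andP[s0 s1].
    apply: (@continuous_comp R (E2 R) R (fun s => P (p s) (q s)) (f \o phi)).
      exact: affine_arc_continuous.
    apply: (@continuous_comp (E2 R) (E3 R) R phi f); last exact: fc.
    by apply: phic; exact: pqU.
  - rewrite /p /q subr0 subrr !(mul0r, mulr0, mul1r) addr0 (addrC a) subrK.
    rewrite /v; have [lk|/ltW lk] := leP (k a 0) (k b 0); apply/andP; split; lra.
  rewrite in_itv /= => /andP[s0 s1] kv; exists s; split => //.
    rewrite lt_def s0 andbT; apply/eqP => s00; move: kv kab; rewrite s00 /p /q.
    by rewrite !(mul0r, mulr0) addr0 /v => kv /eqP; apply; lra.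
  rewrite lt_def s1 andbT; apply/eqP => s00; move: kv kab; rewrite -s00 /p /q.
  rewrite subrr !(mulr0, mul1r) (addrC a) subrK /v => kv /eqP; apply; lra.
have abe s : 0 < s -> s < 1 -> `|a + s * (b - a)| <= e.
  by move=> s0 s1; rewrite ger0_norm; nra.
have mse m s : `|m| <= 1 -> 0 < s -> s < 1 -> `|m * e * (s * (1 - s))| <= e.
  move=> m1 s0 s1; have ss : 0 <= s * (1 - s) <= 1 by apply/andP; split; nra.
  rewrite normrM (normrM m) (ger0_norm (ltW e0)) (ger0_norm (andP ss).1).
  apply: (@le_trans _ _ (1 * e * 1)); last by lra.
  by apply: ler_pM => //; [rewrite mulr_ge0 // ltW | case/andP: ss |
    apply: ler_wpM2r => //; exact: ltW | case/andP: ss].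
have n0 : `|0 : R| <= 1 by rewrite normr0.
have n1 : `|1 : R| <= 1 by rewrite normr1.
have nN1 : `|- 1 : R| <= 1 by rewrite normrN1.
have [s [s0 s1 sv]] := arc _ n0; have [t [t0 t1 tv]] := arc _ n1.
have [w [w0 w1 wv]] := arc _ nN1.
have := kfib _ _ _ _ _ _ (abe _ s0 s1) (mse _ _ n0 s0 s1) (abe _ t0 t1)
  (mse _ _ n1 t0 t1) (abe _ w0 w1) (mse _ _ nN1 w0 w1).
rewrite sv tv wv => /(_ erefl erefl).
have et : 0 < e * (t * (1 - t)) by rewrite !mulr_gt0 //; lra.
have ew : 0 < e * (w * (1 - w)) by rewrite !mulr_gt0 //; lra.
by case=> -[_]; rewrite -!mulrA ?mul0r; lra.
Qed.

Lemma kmx_inj (a p q r u v w a' p' q' r' u' v' w' : R) :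
  kmx a p q r u v w = kmx a' p' q' r' u' v' w' ->
  [/\ a = a', p = p', q = q', r = r' & [/\ u = u', v = v' & w = w']].
Proof.
move=> e; have k x i := congr1 (fun X => kact X x i 0) e.
have := (k 0 0, k 0 1, k 0 2, k (vec3 1 0 0) 0, k (vec3 1 0 0) 1,
  k (vec3 1 0 0) 2, k (vec3 0 1 0) 2).
rewrite !kact_kmx !vec3E !zeroE => -[[[[[[e1 e2] e3] e4] e5] e6] e7].
by split; [lra..|split; lra].
Qed.

Lemma kmx_scale (s a p q r u v w : R) : s *: kmx a p q r u v w =
  kmx (s * a) (s * p) (s * q) (s * r) (s * u) (s * v) (s * w).
Proof. by have := kmx_lin s a p q r u v w 0 0 0 0 0 0 0; rewrite kmx0 !addr0. Qed.

(** The rotation vector spans the kernel of the skew part; it is sent to the third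
    axis. *)
Lemma rotate_kmx (a p q r u v w : R) :
  exists2 A : 'M[R]_3, A^T *m A = 1%:M & exists r' u' v' w',
    rho (1, A, 0) *m kmx a p q r u v w *m rho (cinv (1, A, 0)) =
      kmx a 0 0 r' u' v' w' /\ (r' = 0 -> [/\ p = 0, q = 0 & r = 0]).
Proof.
pose om := vec3 p q r.
have [/nsq_eq0 om0|om0] := eqVneq (nsq om) 0.
  have [p0 q0 r0] : [/\ p = 0, q = 0 & r = 0].
    have k i := congr1 (fun x : 'cV[R]_3 => x i 0) om0.
    by have := (k 0, k 1, k 2); rewrite /om !vec3E !zeroE => -[[]].
  exists 1%:M; first by rewrite trmx1 mulmx1.
  have ci : cinv (conf1 R) = conf1 R.
    by rewrite -[LHS]cmul1g cmulgV //; exact: Conf_conf1.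
  exists 0, u, v, w; split; last by [].
  by rewrite -/(conf1 R) ci rho1 mulmx1 mul1mx p0 q0 r0.
have [A AA Aom] := rotate_to_axis om; exists A => //.
have AAT : A *m A^T = 1%:M by exact: mulmx1C.
have AC := Conf_rotation AA; have iA := Conf_invmx AC; rewrite /= in iA.
pose N := cols3 (vec3 a r (- q)) (vec3 (- r) a p) (vec3 q (- p) a).
pose N' := A *m N *m A^T.
have -> : rho (1, A, 0) *m kmx a p q r u v w *m rho (cinv (1, A, 0)) =
    block_mx N' (A *m vec3 u v w) 0 0.
  rewrite /rho /kmx !mulmx_block /= iA.
  by rewrite !(scaler0, oppr0, invr1, mulmx0, mul0mx, addr0, add0r, mulmx1, scale1r).
have NT : N^T + N = (2 * a)%:M.
  apply: col3P; apply: ord3_ind; apply: vec3P;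
    by rewrite !mxE /=; ring.
have N'T : N'^T + N' = (2 * a)%:M.
  rewrite /N' !trmx_mul trmxK mulmxA -mulmxDl -mulmxDr NT.
  by rewrite mul_mx_scalar -scalemxAl AAT scalemx1.
have l0 : Num.sqrt (nsq om) != 0.
  by rewrite sqrtr_eq0 -ltNge lt_def om0 nsq_ge0.
have Nom : N *m om = a *: om.
  by rewrite /N /om cols3_mul; apply: vec3P; rewrite !(entryE, vec3E); ring.
have N'e : N' *m vec3 0 0 (Num.sqrt (nsq om)) = a *: vec3 0 0 (Num.sqrt (nsq om)).
  by rewrite -Aom /N' -!mulmxA (mulmxA A^T) AA mul1mx Nom -scalemxAr.
have N'i i : N' i 2 * Num.sqrt (nsq om) = a * vec3 0 0 (Num.sqrt (nsq om)) i 0.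
  have /matrixP/(_ i 0) := N'e; rewrite mxE sum3 !vec3E scaleE.
  by rewrite !mulr0 !add0r.
have n02 : N' 0 2 = 0.
  by have := N'i 0; rewrite vec3E mulr0 => /eqP; rewrite mulf_eq0 (negPf l0) orbF => /eqP.
have n12 : N' 1 2 = 0.
  by have := N'i 1; rewrite vec3E mulr0 => /eqP; rewrite mulf_eq0 (negPf l0) orbF => /eqP.
have n21 : N' 2 1 = 0.
  have /matrixP/(_ 1 2) := N'T; move: n12; clearbody N' => n12.
  by rewrite !mxE /= n12 addr0.
have kE := block_kmx (A *m vec3 u v w) N'T; rewrite n02 n21 in kE.
exists (N' 1 0), ((A *m vec3 u v w) 0 0), ((A *m vec3 u v w) 1 0),
  ((A *m vec3 u v w) 2 0); split.
  by rewrite kE; congr kmx; field.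
move=> r'0; have N'1 : N' = a%:M.
  move: kE; rewrite r'0 /kmx => /eq_block_mx[-> _ _ _].
  apply: col3P; apply: ord3_ind; rewrite col_cols3; apply: vec3P;
    by rewrite !mxE /= ?oppr0 //; field.
have N1 : N = a%:M.
  have : A^T *m N' *m A = N.
    by rewrite /N' !mulmxA AA mul1mx -mulmxA AA mulmx1.
  by move=> <-; rewrite N'1 mul_mx_scalar -scalemxAl AA scalemx1.
have k i j := congr1 (fun M : 'M[R]_3 => M i j) N1.
have := (k 1 0, k 2 0, k 2 1); rewrite !mxE /= => -[[-> /eqP]].
by rewrite oppr_eq0 => /eqP -> ->.
Qed.

End PlanarDomains.

Section OneParameterGroups.
Variable R : realType.
Implicit Types (g h c : triple R) (G : set (triple R)) (x y : 'cV[R]_3).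

Lemma thin_path_ode G (a r b : R) gam : subgroup G ->
  (forall Y, tangent G Y -> exists s : R, Y = s *: kmx a 0 0 r 0 0 b) ->
  path_in G gam -> exists L : R -> R, forall t : R, exists s : R,
    is_derive t 1 L (s * a) /\ forall x, let y u := cact (gam u) x in
    [/\ is_derive t 1 (fun u => y u 0 0) (s * (a * y t 0 0 - r * y t 1 0)),
        is_derive t 1 (fun u => y u 1 0) (s * (r * y t 0 0 + a * y t 1 0)) &
        is_derive t 1 (fun u => y u 2 0) (s * (a * y t 2 0 + b))].
Proof.
move=> sG thinG pg; have [L LP] := path_ode sG pg; exists L => t.
have [a' [p [q [r' [u [v [w [TY dL dy]]]]]]]] := LP t.
have [s] := thinG _ TY; rewrite kmx_scale !mulr0 => /kmx_inj[ea ep eq er [eu ev ew]].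
exists s; rewrite -ea; split=> // x y.
by split; have := dy x; [move=> /(_ 0) | move=> /(_ 1) | move=> /(_ 2)];
  rewrite kact_kmx vec3E /y ?ea ?ep ?eq ?er ?eu ?ev ?ew => /derive_eq; apply; ring.
Qed.

(** The time along an orbit is read off from the scaling factor or, in the absence
    of scaling, from the third coordinate. *)
Lemma thin_orbit_flow G (a r b : R) x y : subgroup G -> C1_connected G ->
  (forall Y, tangent G Y -> exists s : R, Y = s *: kmx a 0 0 r 0 0 b) ->
  a * b = 0 -> (a != 0) || (b != 0) -> conf_orbit G x y -> flow_rel a r b x y.
Proof.
move=> sG Gc thinG ab ab0; apply: orbit_invariant => // {x y}.
- exact: flow_rel_refl.
- by move=> x y z; exact: flow_rel_trans.
move=> gam s t x pg; have [L LP] := thin_path_ode sG thinG pg.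
have [tau tauP] : exists tau : R -> R, forall t : R, exists s : R,
    is_derive t 1 tau s /\ let y u := cact (gam u) x in
    [/\ is_derive t 1 (fun u => y u 0 0) (s * (a * y t 0 0 - r * y t 1 0)),
        is_derive t 1 (fun u => y u 1 0) (s * (r * y t 0 0 + a * y t 1 0)) &
        is_derive t 1 (fun u => y u 2 0) (s * (a * y t 2 0 + b))].
  have [a0|a0] := eqVneq a 0; last first.
    exists (fun u => a^-1 * L u) => {}t; have [k [dL dy]] := LP t; exists k.
    split; last exact: dy.
    by apply: is_derive_eq; rewrite /GRing.scale /=; field.
  rewrite a0 eqxx /= in ab0.
  exists (fun u => b^-1 * cact (gam u) x 2 0) => {}t.
  have [k [dL dy]] := LP t; exists k; split; last exact: dy.
  have [_ _ d2] := dy x.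
  by apply: is_derive_eq; rewrite a0 /GRing.scale /=; field.
have h01 (u : R) : exists s : R, [/\ is_derive u 1 tau s,
    is_derive u 1 (fun u => cact (gam u) x 0 0)
      (s * (a * cact (gam u) x 0 0 - r * cact (gam u) x 1 0)) &
    is_derive u 1 (fun u => cact (gam u) x 1 0)
      (s * (r * cact (gam u) x 0 0 + a * cact (gam u) x 1 0))].
  by have [k [? []]] := tauP u; exists k.
have h2 (u : R) : exists s : R, is_derive u 1 tau s /\
    is_derive u 1 (fun u => cact (gam u) x 2 0) (s * (a * cact (gam u) x 2 0 + b)).
  by have [k [? []]] := tauP u; exists k.
exists (tau t - tau s); have [e0 e1] := planar_flow h01 s t.
by split=> //; exact: (vertical_flow ab h2).
Qed.

Lemma rotation_orbit_invariant G (r : R) x y : subgroup G -> C1_connected G ->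
  (forall Y, tangent G Y -> exists s : R, Y = s *: kmx 0 0 0 r 0 0 0) ->
  conf_orbit G x y ->
  x 0 0 ^+ 2 + x 1 0 ^+ 2 = y 0 0 ^+ 2 + y 1 0 ^+ 2 /\ x 2 0 = y 2 0.
Proof.
move=> sG Gc thinG.
apply: (orbit_invariant (E := fun x y => x 0 0 ^+ 2 + x 1 0 ^+ 2 =
  y 0 0 ^+ 2 + y 1 0 ^+ 2 /\ x 2 0 = y 2 0)) => // {x y}.
  by move=> x y z [-> ->] [-> ->].
move=> gam s t x pg; have [L LP] := thin_path_ode sG thinG pg.
split.
  apply: (is_derive_0_is_cst
    (f := fun u => cact (gam u) x 0 0 ^+ 2 + cact (gam u) x 1 0 ^+ 2)) => u.
  have [k [_ /(_ x)[? ? _]]] := LP u.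
  by apply: is_derive_eq; rewrite /GRing.scale /=; ring.
apply: (is_derive_0_is_cst (f := fun u => cact (gam u) x 2 0)) => u.
have [k [_ /(_ x)[_ _ d2]]] := LP u.
by apply: derive_eq d2 _; ring.
Qed.

Lemma coord_E3_continuous (i : 'I_3) : continuous (fun x : E3 R => x i 0 : R).
Proof. exact: coord_continuous. Qed.

Lemma nsq_continuous : continuous (fun x : E3 R => nsq x : R).
Proof.
move=> x; have cc i := @coord_E3_continuous i x.
have -> : (fun x : E3 R => nsq x) = ((fun x => x 0 0) \* (fun x => x 0 0) \+
    (fun x => x 1 0) \* (fun x => x 1 0)) \+ (fun x => x 2 0) \* (fun x => x 2 0).
  by apply/funext => y; rewrite /nsq /= !expr2.
by apply: continuousD; first apply: continuousD; apply: continuousM; exact: cc.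
Qed.

(** The norm (a != 0) or the third coordinate (b != 0) is injective on an orbit;
    on a circle about the axis the first coordinate takes each value at most
    twice. *)
Lemma axial_thin_not_thick G (a r b : R) : subgroup G -> C1_connected G ->
  (forall Y, tangent G Y -> exists s : R, Y = s *: kmx a 0 0 r 0 0 b) ->
  a * b = 0 -> ~ thick G.
Proof.
move=> sG Gc thinG ab [U [phi [x [Uo U0 phic phii phiG]]]].
have [ab0|] := boolP ((a != 0) || (b != 0)); last first.
  rewrite negb_or !negbK => /andP[/eqP a0 /eqP b0]; rewrite a0 b0 in thinG.
  have oi y := rotation_orbit_invariant (y := y) sG Gc thinG.
  apply: (planar_fibre3 Uo U0 phic phii phiG (@coord_E3_continuous 0)).
  move=> y1 y2 y3 /oi[e1 z1] /oi[e2 z2] /oi[e3 z3] f2 f3.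
  have sq2 : y2 1 0 ^+ 2 == y1 1 0 ^+ 2.
    by apply/eqP; move: e1 e2; rewrite f2; lra.
  have sq3 : y3 1 0 ^+ 2 == y1 1 0 ^+ 2.
    by apply/eqP; move: e1 e3; rewrite f3; lra.
  move: sq2 sq3; rewrite !eqf_sqr => /orP[/eqP s2 _|/eqP s2 /orP[/eqP s3|/eqP s3]].
  - by constructor 1; apply: vec3P => //; rewrite -z1 -z2.
  - by constructor 2; apply: vec3P => //; rewrite -z1 -z3.
  - constructor 3; apply: vec3P; first by rewrite -f2.
      by rewrite s2 s3.
    by rewrite -z2 -z3.
have fl y : conf_orbit G x y -> flow_rel a r b x y by exact: thin_orbit_flow.
have same y1 y2 : conf_orbit G x y1 -> conf_orbit G x y2 ->
    (if a == 0 then y1 2 0 = y2 2 0 else nsq y1 = nsq y2) -> y1 = y2.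
  move=> /fl[d [p0 p1 p2]] /fl[d' [q0 q1 q2]].
  case: eqVneq => [a0|a0].
    rewrite a0 eqxx /= in ab0; rewrite p2 q2 a0 !mul0r => /addrI/(mulfI ab0) dd.
    by apply: vec3P; rewrite ?p0 ?q0 ?p1 ?q1 ?p2 ?q2 dd.
  have b0 : b = 0 by move/eqP: ab; rewrite mulf_eq0 (negPf a0) => /eqP.
  have nE k y : y 0 0 = expR (a * k) * (cos (r * k) * x 0 0 - sin (r * k) * x 1 0) ->
      y 1 0 = expR (a * k) * (sin (r * k) * x 0 0 + cos (r * k) * x 1 0) ->
      y 2 0 = expR (a * k) * x 2 0 + b * k -> nsq y = expR (a * k) ^+ 2 * nsq x.
    move=> e0 e1 e2; rewrite /nsq e0 e1 e2 b0.
    have := cos2Dsin2 (r * k); move: (cos _) (sin _) (expR _) => C S E CS.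
    rewrite mul0r addr0 (_ : _ + _ = E ^+ 2 * ((C ^+ 2 + S ^+ 2) *
      (x 0 0 ^+ 2 + x 1 0 ^+ 2) + x 2 0 ^+ 2)); last by ring.
    by rewrite CS mul1r.
  rewrite (nE _ _ p0 p1 p2) (nE _ _ q0 q1 q2) => e.
  have [/nsq_eq0 x0|x0] := eqVneq (nsq x) 0.
    move: p0 p1 p2 q0 q1 q2; rewrite x0 !zeroE b0 !(mulr0, mul0r, subr0, addr0).
    by move=> p0 p1 p2 q0 q1 q2; apply: vec3P; rewrite ?p0 ?q0 ?p1 ?q1 ?p2 ?q2.
  move/(mulIf x0): e => /eqP.
  rewrite eqrXn2 ?expR_ge0 // => /eqP/expR_inj/(mulfI a0) dd.
  by apply: vec3P; rewrite ?p0 ?q0 ?p1 ?q1 ?p2 ?q2 dd.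
pose f : E3 R -> R := if a == 0 then fun y => y 2 0 else fun y => nsq y.
have fc : continuous f.
  by rewrite /f; case: ifP => _; [exact: coord_E3_continuous | exact: nsq_continuous].
apply: (planar_fibre3 Uo U0 phic phii phiG fc) => y1 y2 y3 O1 O2 _ f12 _.
by constructor 1; apply: same O1 O2 _; move: f12; rewrite /f; case: ifP.
Qed.

Lemma thin_generator (G : set (triple R)) : subgroup G -> thin G ->
  exists a p q r u v w : R, forall Y, tangent G Y ->
    exists s : R, Y = s *: kmx a p q r u v w.
Proof.
move=> sG [X XP]; have GC : G `<=` Conf R by case: sG.
have [[Y TY Y0]|nY] := pselect (exists2 Y, tangent G Y & Y != 0).
  have [a [p [q [r [u [v [w YE]]]]]]] := tangent_kmx GC TY.
  exists a, p, q, r, u, v, w => Z /XP[s ->]; have [t] := XP _ TY.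
  rewrite -YE => Yt; have t0 : t != 0.
    by apply: contraNneq Y0 => t0; rewrite Yt t0 scale0r.
  by exists (s / t); rewrite Yt scalerA divfK.
exists 0, 0, 0, 0, 0, 0, 0 => Z TZ; exists 0; rewrite scale0r.
by apply: contrapT => /eqP Z0; apply: nY; exists Z.
Qed.

Lemma conj_multiples c G X : Conf R c ->
  (forall Y, tangent G Y -> exists s : R, Y = s *: X) ->
  forall Y, tangent (conj_set c G) Y ->
    exists s : R, Y = s *: (rho c *m X *m rho (cinv c)).
Proof.
move=> cC XP Y /(tangent_conjV cC)/XP[s sE]; exists s.
by rewrite -(rho_conjK Y cC) sE -scalemxAr -scalemxAl.
Qed.

(** A rotation aligns the axis of the generator (or its direction, for a
    translation), and a translation moves the axis or the fixed point to the
    origin. *)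
Lemma thin_not_thick G : subgroup G -> C1_connected G -> thin G -> ~ thick G.
Proof.
move=> sG Gc thinG.
have [a [p [q [r [u [v [w XP]]]]]]] := thin_generator sG thinG.
have [A AA [r1 [u1 [v1 [w1 [XE r10]]]]]] := rotate_kmx a p q r u v w.
have cC := Conf_rotation AA; set c := (1, A, 0) in cC XE.
have {r10} XP' := conj_multiples cC XP; rewrite XE in XP'.
have [ar0|/eqP/eqP ar0] := eqVneq (a ^+ 2 + r1 ^+ 2) 0.
  have [a0 r0] : a = 0 /\ r1 = 0.
    move/eqP: ar0; rewrite paddr_eq0 ?sqr_ge0 // !sqrf_eq0.
    by move=> /andP[/eqP ? /eqP ?].
  rewrite a0 r0 in XP'.
  have [B BB Bu] := rotate_to_axis (vec3 u1 v1 w1).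
  have dC := Conf_rotation BB.
  have := conj_multiples dC XP'.
  have := trans_rot_conj B (vec3 u1 v1 w1); rewrite !vec3E Bu !vec3E => -> XP''.
  move=> /(thick_conj cC)/(thick_conj dC); apply: axial_thin_not_thick XP'' _.
  - exact: subgroup_conj dC (subgroup_conj cC sG).
  - exact: C1_connected_conj dC (C1_connected_conj cC Gc).
  - by rewrite mul0r.
(* - b is a zero of the field, up to a translation along the axis if a = 0 *)
pose n := a ^+ 2 + r1 ^+ 2.
pose b := vec3 ((a * u1 + r1 * v1) / n) ((a * v1 - r1 * u1) / n) (w1 / a).
have dC := Conf_translation b.
have := conj_multiples dC XP'; rewrite kmx_trans_conj kact_kmx !vec3E.
rewrite !(oppr0, mul0r, add0r, addr0, subr0).
rewrite (_ : u1 - _ = 0); last by rewrite /n; field.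
rewrite (_ : v1 - _ = 0); last by rewrite /n; field.
move=> XP'' /(thick_conj cC)/(thick_conj dC); apply: axial_thin_not_thick XP'' _.
- exact: subgroup_conj dC (subgroup_conj cC sG).
- exact: C1_connected_conj dC (C1_connected_conj cC Gc).
- have [->|a0] := eqVneq a 0; first by rewrite mul0r.
  by field.
Qed.

End OneParameterGroups.

(** * Classification of the Lie algebras *)

Section NormalForms.
Variable R : realType.
Implicit Types (g h c : triple R) (G : set (triple R)) (x y : 'cV[R]_3).

(** What remains of a connected Lie subgroup of cohomogeneity one: orbits are
    neither all at most one-dimensional nor ever open. *)
Definition nice G : Prop :=
  [/\ subgroup G, C1_connected G, thick G & forall x, ~ orbit_open G x].

Lemma nice_conj c G : Conf R c -> nice G -> nice (conj_set c G).
Proof.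
move=> cC [sG Gc Gt Go]; split.
- exact: subgroup_conj.
- exact: C1_connected_conj.
- exact: thick_conj.
- by move=> x; rewrite -(cactKV x cC) => /(orbit_open_conj cC); exact: Go.
Qed.

Definition lie G (a p q r u v w : R) : Prop := tangent G (kmx a p q r u v w).

Lemma lie_lin G (k a p q r u v w a' p' q' r' u' v' w' : R) : subgroup G ->
  lie G a p q r u v w -> lie G a' p' q' r' u' v' w' ->
  lie G (k * a + a') (k * p + p') (k * q + q') (k * r + r')
    (k * u + u') (k * v + v') (k * w + w').
Proof. by move=> sG X Y; rewrite /lie -kmx_lin; exact: tangent_lin. Qed.

Lemma lie_scale G (k a p q r u v w : R) : subgroup G ->
  lie G a p q r u v w ->
  lie G (k * a) (k * p) (k * q) (k * r) (k * u) (k * v) (k * w).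
Proof. by move=> sG X; rewrite /lie -kmx_scale; exact: tangentZ. Qed.

Lemma lie_bracket G (a p q r u v w a' p' q' r' u' v' w' : R) : subgroup G ->
  lie G a p q r u v w -> lie G a' p' q' r' u' v' w' ->
  lie G 0 (q * r' - r * q') (r * p' - p * r') (p * q' - q * p')
    (a * u' - r * v' + q * w' - (a' * u - r' * v + q' * w))
    (r * u' + a * v' - p * w' - (r' * u + a' * v - p' * w))
    (- q * u' + p * v' + a * w' - (- q' * u + p' * v + a' * w)).
Proof. by move=> sG X Y; rewrite /lie -kmx_bracket; exact: tangent_bracket. Qed.

Lemma lie_eq G (a p q r u v w a' p' q' r' u' v' w' : R) :
  lie G a p q r u v w ->
  a = a' -> p = p' -> q = q' -> r = r' -> u = u' -> v = v' -> w = w' ->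
  lie G a' p' q' r' u' v' w'.
Proof. by move=> H <- <- <- <- <- <- <-. Qed.

Lemma cinv_translation (b : 'cV[R]_3) :
  cinv (1, 1%:M, b) = (1, 1%:M, - b) :> triple R.
Proof. by rewrite /cinv /= invr1 invmx1 mul1mx scale1r. Qed.

Lemma cinv_rotation (A : 'M[R]_3) : A^T *m A = 1%:M ->
  cinv (1, A, 0) = (1, A^T, 0) :> triple R.
Proof.
move=> AA; have := Conf_invmx (Conf_rotation AA); rewrite /= => iA.
by rewrite /cinv /= invr1 iA mulmx0 scaler0 oppr0.
Qed.

Lemma lie_translate G (b0 b1 b2 a p q r u v w : R) :
  lie (conj_set (1, 1%:M, vec3 b0 b1 b2) G) a p q r
    (u - (a * b0 - r * b1 + q * b2)) (v - (r * b0 + a * b1 - p * b2))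
    (w - (- q * b0 + p * b1 + a * b2)) <-> lie G a p q r u v w.
Proof.
have tr b G' u' v' w' : lie G' a p q r u' v' w' ->
    lie (conj_set (1, 1%:M, b) G') a p q r
      (u' - (a * b 0 0 - r * b 1 0 + q * b 2 0))
      (v' - (r * b 0 0 + a * b 1 0 - p * b 2 0))
      (w' - (- q * b 0 0 + p * b 1 0 + a * b 2 0)).
  move=> /(tangent_conj (Conf_translation b)).
  by rewrite kmx_trans_conj kact_kmx !vec3E !addr0.
split=> [|/(tr (vec3 b0 b1 b2))]; last by rewrite !vec3E.
move=> /(tr (- vec3 b0 b1 b2)).
rewrite -cinv_translation conj_setK; last exact: Conf_translation.
rewrite !oppE !vec3E => H.
by apply: lie_eq H _ _ _ _ _ _ _; ring.
Qed.

Lemma trans_rotate G (A : 'M[R]_3) y : A^T *m A = 1%:M ->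
  lie G 0 0 0 0 (y 0 0) (y 1 0) (y 2 0) ->
  lie (conj_set (1, A, 0) G) 0 0 0 0 ((A *m y) 0 0) ((A *m y) 1 0) ((A *m y) 2 0).
Proof.
move=> AA /(tangent_conj (Conf_rotation AA)).
by rewrite trans_rot_conj.
Qed.

Definition no_trans G := forall u v w, lie G 0 0 0 0 u v w ->
  [/\ u = 0, v = 0 & w = 0].

Lemma no_trans_rotate G (A : 'M[R]_3) : A^T *m A = 1%:M ->
  no_trans G -> no_trans (conj_set (1, A, 0) G).
Proof.
move=> AA nG u v w; pose y := vec3 u v w.
have AT : (A^T)^T *m A^T = 1%:M by rewrite trmxK mulmx1C.
rewrite -[u](vec3E u v w).1.1 -[v in lie _ _ _ _ _ _ v](vec3E u v w).1.2.
rewrite -[w in lie _ _ _ _ _ _ _ w](vec3E u v w).2 -/y => /(trans_rotate AT).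
rewrite -(cinv_rotation AA) conj_setK; last exact: Conf_rotation.
move=> /nG[e0 e1 e2]; have Ay0 : A^T *m y = 0 by apply: vec3P; rewrite zeroE.
have y0 : y = 0 by rewrite -[y]mul1mx -(mulmx1C AA) -mulmxA Ay0 mulmx0.
have k i := congr1 (fun z : 'cV[R]_3 => z i 0) y0.
by have := (k 0, k 1, k 2); rewrite /y !vec3E !zeroE => -[[-> ->] ->].
Qed.

Lemma no_trans_translate G (b0 b1 b2 : R) :
  no_trans G -> no_trans (conj_set (1, 1%:M, vec3 b0 b1 b2) G).
Proof.
move=> nG u v w H; apply/nG/(lie_translate _ b0 b1 b2).
by apply: lie_eq H _ _ _ _ _ _ _; ring.
Qed.

(** As no orbit is open, three fields are dependent at every point. *)
Lemma lie_det0 G (a p q r u v w a' p' q' r' u' v' w'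
    a'' p'' q'' r'' u'' v'' w'' : R) x : nice G ->
  lie G a p q r u v w -> lie G a' p' q' r' u' v' w' ->
  lie G a'' p'' q'' r'' u'' v'' w'' ->
  det3 (kact (kmx a p q r u v w) x) (kact (kmx a' p' q' r' u' v' w') x)
    (kact (kmx a'' p'' q'' r'' u'' v'' w'') x) = 0.
Proof.
move=> [sG _ _ Go] X Y Z; apply: contrapT => /eqP d0.
exact: (Go x) (tangent_spans_orbit_open sG X Y Z d0).
Qed.

Lemma nice_not_thin G : nice G -> ~ thin G.
Proof. by move=> [sG Gc Gt _] /(thin_not_thick sG Gc). Qed.

Lemma lie_thin G (X : 'M[R]_(3 + 1)) : subgroup G ->
  (forall a p q r u v w, lie G a p q r u v w ->
     exists s : R, kmx a p q r u v w = s *: X) -> thin G.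
Proof.
move=> [GC _ _ _] XP; exists X => Y TY.
have [a [p [q [r [u [v [w YE]]]]]]] := tangent_kmx GC TY.
by rewrite YE; apply: XP; rewrite /lie -YE.
Qed.

(** The orbits will be planes; cylinders about the third axis over circles
    (a = 0), half-lines (r = 0) or logarithmic spirals; cones about the third axis;
    spheres. *)
Definition planar_type G := lie G 0 0 0 0 1 0 0 /\ lie G 0 0 0 0 0 1 0.

Definition cylindrical_type G (a r : R) :=
  [/\ lie G 0 0 0 0 0 0 1, lie G a 0 0 r 0 0 0, a ^+ 2 + r ^+ 2 != 0 &
   forall a' p' q' r' u' v' w', lie G a' p' q' r' u' v' w' ->
     [/\ p' = 0, q' = 0, u' = 0, v' = 0 & a * r' = r * a']].

Definition conical_type G :=
  [/\ lie G 1 0 0 0 0 0 0, lie G 0 0 0 1 0 0 0 &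
   forall a' p' q' r' u' v' w', lie G a' p' q' r' u' v' w' ->
     [/\ p' = 0, q' = 0, u' = 0, v' = 0 & w' = 0]].

Definition spherical_type G :=
  [/\ lie G 0 1 0 0 0 0 0, lie G 0 0 1 0 0 0 0, lie G 0 0 0 1 0 0 0 &
   forall a' p' q' r' u' v' w', lie G a' p' q' r' u' v' w' ->
     [/\ a' = 0, u' = 0, v' = 0 & w' = 0]].

Definition normal_form G :=
  [\/ planar_type G, (exists a r, cylindrical_type G a r),
      conical_type G | spherical_type G].

Definition has_normal_form G :=
  exists2 c, Conf R c & nice (conj_set c G) /\ normal_form (conj_set c G).

Lemma normal_form_conj c G : Conf R c ->
  has_normal_form (conj_set c G) -> has_normal_form G.
Proof.
move=> cC [d dC]; rewrite conj_setM // => H; exists (cmul d c) => //.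
exact: Conf_cmul.
Qed.

Lemma normal_form_refl G : nice G -> normal_form G -> has_normal_form G.
Proof.
move=> nG nf; exists (conf1 R); first exact: Conf_conf1.
by rewrite conj_set1.
Qed.

Lemma sumsq_neq0 (a b : R) : a != 0 \/ b != 0 -> a ^+ 2 + b ^+ 2 != 0.
Proof.
move=> ab; rewrite paddr_eq0 ?sqr_ge0 // !sqrf_eq0.
by case: ab => /negPf ->; rewrite ?andbF.
Qed.

Lemma dot_isometry (A : 'M[R]_3) x y : A^T *m A = 1%:M ->
  (A *m x) 0 0 * (A *m y) 0 0 + (A *m x) 1 0 * (A *m y) 1 0 +
  (A *m x) 2 0 * (A *m y) 2 0 =
  x 0 0 * y 0 0 + x 1 0 * y 1 0 + x 2 0 * y 2 0.
Proof.
move=> AA; have dE (z t : 'cV[R]_3) : (z^T *m t) 0 0 =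
    z 0 0 * t 0 0 + z 1 0 * t 1 0 + z 2 0 * t 2 0.
  by rewrite mxE sum3 !mxE.
by rewrite -!dE trmx_mul -mulmxA (mulmxA A^T) AA mul1mx.
Qed.

(** A rotation carries the plane spanned by the two translations to the
    horizontal one. *)
Lemma two_translations G (u v w : R) : nice G -> lie G 0 0 0 0 0 0 1 ->
  lie G 0 0 0 0 u v w -> u != 0 \/ v != 0 -> has_normal_form G.
Proof.
move=> nG e3 Luvw uv; have [sG _ _ _] := nG.
have n0 := sumsq_neq0 uv.
have plane y : y 0 0 * v = y 1 0 * u -> lie G 0 0 0 0 (y 0 0) (y 1 0) (y 2 0).
  move=> yuv; pose k := (y 0 0 * u + y 1 0 * v) / (u ^+ 2 + v ^+ 2).
  have H := lie_lin k sG Luvw (lie_scale (y 2 0 - k * w) sG e3).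
  have ku : k * u = y 0 0.
    apply: (mulIf n0); rewrite /k mulrAC divfK //.
    have -> : (y 0 0 * u + y 1 0 * v) * u = y 0 0 * u ^+ 2 + (y 1 0 * u) * v by ring.
    by rewrite -yuv; ring.
  have kv : k * v = y 1 0.
    apply: (mulIf n0); rewrite /k mulrAC divfK //.
    have -> : (y 0 0 * u + y 1 0 * v) * v = (y 0 0 * v) * u + y 1 0 * v ^+ 2 by ring.
    by rewrite yuv; ring.
  by apply: lie_eq H _ _ _ _ _ _ _; rewrite ?ku ?kv; ring.
pose n := vec3 v (- u) 0; have [A AA An] := rotate_to_axis n.
have l0 : Num.sqrt (nsq n) != 0.
  rewrite sqrtr_eq0 -ltNge lt_def nsq_ge0 andbT /nsq !vec3E sqrrN expr0n addr0.
  by rewrite addrC.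
apply: (normal_form_conj (Conf_rotation AA)).
apply: normal_form_refl; first exact: nice_conj (Conf_rotation AA) nG.
have horiz (z : 'cV[R]_3) : z 2 0 = 0 ->
    lie (conj_set (1, A, 0) G) 0 0 0 0 (z 0 0) (z 1 0) (z 2 0).
  move=> z2; have Az : A *m (A^T *m z) = z by rewrite mulmxA mulmx1C // mul1mx.
  rewrite -{1 2 3}Az; apply: trans_rotate => //; apply: plane.
  have := dot_isometry n (A^T *m z) AA; rewrite Az An !vec3E z2.
  rewrite !(mul0r, mulr0, addr0) => /esym.
  by move: (A^T *m z) => y; lra.
constructor 1; split.
  by have := horiz (vec3 1 0 0); rewrite !vec3E; apply.
by have := horiz (vec3 0 1 0); rewrite !vec3E; apply.
Qed.

End NormalForms.

Section Classification.
Variable R : realType.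
Implicit Types (g h c : triple R) (G : set (triple R)) (x y : 'cV[R]_3).

(** If all translations of the group are parallel to e3, the bracket with e3
    shows that the linear parts preserve this direction, so the group acts on
    the plane orthogonal to it; there it has a fixed point, and all its elements
    are proportional, as otherwise some orbit would be open. *)
Lemma one_translation G : nice G -> lie G 0 0 0 0 0 0 1 ->
  (forall u v w, lie G 0 0 0 0 u v w -> u = 0 /\ v = 0) -> has_normal_form G.
Proof.
move=> nG e3 tr; have [sG _ _ _] := nG.
have axial a p q r u v w : lie G a p q r u v w -> p = 0 /\ q = 0.
  move=> X; have := lie_bracket sG X e3.
  rewrite !(mul0r, mulr0, mulr1, subr0, addr0, add0r, oppr0, sub0r).
  by move=> /tr[-> /eqP]; rewrite oppr_eq0 => /eqP ->.
have [[[[[[a r] u] v] w] /= X ar0]|nX] := pselect (exists2 X : R * R * R * R * R,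
    lie G X.1.1.1.1 0 0 X.1.1.1.2 X.1.1.2 X.1.2 X.2 &
    X.1.1.1.1 ^+ 2 + X.1.1.1.2 ^+ 2 != 0); last first.
  case: (nice_not_thin nG); apply: (@lie_thin _ _ (kmx 0 0 0 0 0 0 1)) => //.
  move=> a p q r u v w X; have [p0 q0] := axial _ _ _ _ _ _ _ X.
  have [a0 r0] : a = 0 /\ r = 0.
    have [ar|ar] := eqVneq (a ^+ 2 + r ^+ 2) 0.
      move/eqP: ar; rewrite paddr_eq0 ?sqr_ge0 // !sqrf_eq0.
      by move=> /andP[/eqP ? /eqP ?].
    by case: nX; exists (a, r, u, v, w) => //=; rewrite p0 q0 in X.
  have [u0 v0] : u = 0 /\ v = 0 by apply: (tr _ _ w); rewrite a0 p0 q0 r0 in X.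
  by exists w; rewrite kmx_scale a0 p0 q0 r0 u0 v0 !mulr0 mulr1.
(* - (b0, b1) is the zero of the field X in the horizontal plane *)
pose n := a ^+ 2 + r ^+ 2.
pose b0 := (a * u + r * v) / n; pose b1 := (a * v - r * u) / n.
pose c : triple R := (1, 1%:M, vec3 b0 b1 0).
have cC : Conf R c by exact: Conf_translation.
apply: (normal_form_conj cC); have nG' := nice_conj cC nG.
apply: normal_form_refl => //; have [sG' _ _ _] := nG'.
have e3' : lie (conj_set c G) 0 0 0 0 0 0 1.
  have /(lie_translate _ b0 b1 0) H := e3.
  by apply: lie_eq H _ _ _ _ _ _ _; ring.
have X' : lie (conj_set c G) a 0 0 r 0 0 0.
  have /(lie_translate _ b0 b1 0) H := X.
  have := lie_lin (- w) sG' e3' H.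
  by move=> /lie_eq; apply; rewrite /b0 /b1 /n; field.
constructor 2; exists a, r; split=> // a' p' q' r' u' v' w' Y.
have [p0 q0] : p' = 0 /\ q' = 0.
  apply: (axial a' p' q' r' (u' + (a' * b0 - r' * b1 + q' * 0))
    (v' + (r' * b0 + a' * b1 - p' * 0)) (w' + (- q' * b0 + p' * b1 + a' * 0))).
  apply/(lie_translate _ b0 b1 0).
  by apply: lie_eq Y _ _ _ _ _ _ _; ring.
rewrite p0 q0 in Y; have d0 x := lie_det0 x nG' X' Y e3'.
(* a quadratic polynomial that vanishes everywhere; three values suffice *)
have := (d0 (vec3 1 0 0), d0 (vec3 (- 1) 0 0), d0 (vec3 0 1 0)).
rewrite /det3 !kact_kmx !vec3E => -[[d1 d2] d3].
have ar : a * r' = r * a' by move: d1 d2; lra.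
have e1 : a * v' - r * u' = 0 by move: d1 d2; lra.
have e2 : r * v' + a * u' = 0 by move: d3 ar; lra.
split=> //; apply: (mulIf ar0); rewrite mul0r.
  have -> : u' * (a ^+ 2 + r ^+ 2) = a * (r * v' + a * u') - r * (a * v' - r * u') by ring.
  by rewrite e1 e2 !mulr0 subr0.
have -> : v' * (a ^+ 2 + r ^+ 2) = r * (r * v' + a * u') + a * (a * v' - r * u') by ring.
by rewrite e1 e2 !mulr0 addr0.
Qed.

Lemma no_trans_eq G (a p q r u v w u' v' w' : R) : subgroup G -> no_trans G ->
  lie G a p q r u v w -> lie G a p q r u' v' w' ->
  [/\ u = u', v = v' & w = w'].
Proof.
move=> sG nt X Y; have H := lie_lin (- 1) sG Y X.
have [] := nt (- 1 * u' + u) (- 1 * v' + v) (- 1 * w' + w).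
  by apply: lie_eq H _ _ _ _ _ _ _ => //; ring.
by split; lra.
Qed.

Lemma lie_exists_trans G (a p q r u v w a' p' q' r' : R) :
  lie G a p q r u v w -> a = a' -> p = p' -> q = q' -> r = r' ->
  exists u v w, lie G a' p' q' r' u v w.
Proof. by move=> H <- <- <- <-; exists u, v, w. Qed.

(** The algebra is not spanned by the rotation, so it contains a dilation, whose
    fixed point is moved to the origin. The bracket of the dilation and the
    rotation is then the translation part of the latter, and vanishes. *)
Lemma conical_case G (a r u v w : R) : nice G -> no_trans G -> r != 0 ->
  lie G a 0 0 r u v w ->
  (forall a p q r u v w, lie G a p q r u v w -> p = 0 /\ q = 0) ->
  has_normal_form G.
Proof.
move=> nG nt r0 X axial; have [sG _ _ _] := nG.
have [[[[[a' u'] v'] w'] [/= Y a'0]]|nD] := pselect (exists Y : R * R * R * R,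
    lie G Y.1.1.1 0 0 0 Y.1.1.2 Y.1.2 Y.2 /\ Y.1.1.1 != 0); last first.
  case: (nice_not_thin nG); apply: (lie_thin (X := kmx a 0 0 r u v w)) => //.
  move=> a1 p1 q1 r1 u1 v1 w1 Y; have [p0 q0] := axial _ _ _ _ _ _ _ Y.
  rewrite p0 q0 in Y *; have H := lie_lin (- (r1 / r)) sG X Y.
  have a10 : - (r1 / r) * a + a1 = 0.
    apply: contrapT => /eqP k0; apply: nD.
    exists (- (r1 / r) * a + a1, - (r1 / r) * u + u1, - (r1 / r) * v + v1,
      - (r1 / r) * w + w1); split=> //=.
    by apply: lie_eq H _ _ _ _ _ _ _ => //; by [ring | field].
  have [] := nt (- (r1 / r) * u + u1) (- (r1 / r) * v + v1) (- (r1 / r) * w + w1).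
    by apply: lie_eq H _ _ _ _ _ _ _ => //; by [ring | field].
  move=> u0 v0 w0; exists (r1 / r); rewrite kmx_scale.
  by apply: kmx_eq; [lra | ring | ring | field | lra | lra | lra].
pose b0 := u' / a'; pose b1 := v' / a'; pose b2 := w' / a'.
pose c : triple R := (1, 1%:M, vec3 b0 b1 b2).
have cC : Conf R c by exact: Conf_translation.
apply: (normal_form_conj cC); have nG' := nice_conj cC nG.
apply: normal_form_refl => //; have [sG' _ _ _] := nG'.
have nt' := @no_trans_translate _ _ b0 b1 b2 nt.
have D : lie (conj_set c G) 1 0 0 0 0 0 0.
  have /(lie_translate _ b0 b1 b2)/(lie_scale a'^-1 sG') H := Y.
  by apply: lie_eq H _ _ _ _ _ _ _; rewrite /b0 /b1 /b2; field.
have [u1 [v1 [w1 S]]] : exists u v w, lie (conj_set c G) 0 0 0 1 u v w.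
  have /(lie_translate _ b0 b1 b2) H := X.
  have := lie_scale r^-1 sG' (lie_lin (- a) sG' D H).
  by move=> H'; apply: lie_exists_trans H' _ _ _ _; [ring | ring | ring | field].
have [u10 v10 w10] : [/\ u1 = 0, v1 = 0 & w1 = 0].
  by apply: nt'; have H := lie_bracket sG' D S; apply: lie_eq H _ _ _ _ _ _ _; ring.
rewrite u10 v10 w10 in S; constructor 3; split=> // a2 p2 q2 r2 u2 v2 w2 Z.
have [p0 q0] : p2 = 0 /\ q2 = 0.
  apply: (axial a2 p2 q2 r2 (u2 + (a2 * b0 - r2 * b1 + q2 * b2))
    (v2 + (r2 * b0 + a2 * b1 - p2 * b2)) (w2 + (- q2 * b0 + p2 * b1 + a2 * b2))).
  apply/(lie_translate _ b0 b1 b2).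
  by apply: lie_eq Z _ _ _ _ _ _ _; ring.
rewrite p0 q0 in Z *; split=> //.
all: have [] := nt' u2 v2 w2 => //;
  have H := lie_lin (- r2) sG' S (lie_lin (- a2) sG' D Z);
  by apply: lie_eq H _ _ _ _ _ _ _; ring.
Qed.

(** Two rotations about different axes generate so(3) modulo translations. The
    translation part of its lift is a derivation, hence the field of the
    rotation about a fixed point. *)
Lemma spherical_case G (a r u v w a' p' q' r' u' v' w' : R) :
  nice G -> no_trans G -> r != 0 ->
  lie G a 0 0 r u v w -> lie G a' p' q' r' u' v' w' -> p' != 0 \/ q' != 0 ->
  has_normal_form G.
Proof.
move=> nG nt r0 X Y pq; have [sG _ _ _] := nG.
have n0 := sumsq_neq0 pq.
have [t0 [t1 [t2 Z1]]] : exists u v w, lie G 0 (- q') p' 0 u v w.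
  have H := lie_scale r^-1 sG (lie_bracket sG X Y).
  by apply: lie_exists_trans H _ _ _ _; [ring | field | field | ring].
have [s0 [s1 [s2 Z2]]] : exists u v w, lie G 0 (- p') (- q') 0 u v w.
  have H := lie_scale r^-1 sG (lie_bracket sG X Z1).
  by apply: lie_exists_trans H _ _ _ _; [ring | field | field | ring].
have [u1 [v1 [w1 E1]]] : exists u v w, lie G 0 1 0 0 u v w.
  have H := lie_scale (p' ^+ 2 + q' ^+ 2)^-1 sG
    (lie_lin (- q') sG Z1 (lie_scale (- p') sG Z2)).
  by apply: lie_exists_trans H _ _ _ _; [ring | field | field | ring].
have [u2 [v2 [w2 E2]]] : exists u v w, lie G 0 0 1 0 u v w.
  have H := lie_scale (p' ^+ 2 + q' ^+ 2)^-1 sG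
    (lie_lin p' sG Z1 (lie_scale (- q') sG Z2)).
  by apply: lie_exists_trans H _ _ _ _; [ring | field | field | ring].
have [u3 [v3 [w3 E3]]] : exists u v w, lie G 0 0 0 1 u v w.
  have H := lie_bracket sG E1 E2.
  by apply: lie_exists_trans H _ _ _ _; [ring | ring | ring | ring].
have [d1 d2 d3] : [/\ u3 = - w1, v3 = - w2 & w3 = u1 + v2].
  apply: (no_trans_eq sG nt E3 _); have H := lie_bracket sG E1 E2.
  by apply: lie_eq H _ _ _ _ _ _ _; ring.
have [d4 d5 d6] : [/\ u1 = w3 + v2, v1 = - u2 & w1 = - u3].
  apply: (no_trans_eq sG nt E1 _); have H := lie_bracket sG E2 E3.
  by apply: lie_eq H _ _ _ _ _ _ _; ring.
have [d7 d8 d9] : [/\ u2 = - v1, v2 = u1 + w3 & w2 = - v3].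
  apply: (no_trans_eq sG nt E2 _); have H := lie_bracket sG E3 E1.
  by apply: lie_eq H _ _ _ _ _ _ _; ring.
(* (w2, - w1, v1) is the common zero of the three fields *)
pose c : triple R := (1, 1%:M, vec3 (- w2) w1 (- v1)).
have cC : Conf R c by exact: Conf_translation.
apply: (normal_form_conj cC); have nG' := nice_conj cC nG.
apply: normal_form_refl => //; have [sG' _ _ _] := nG'.
have F1 : lie (conj_set c G) 0 1 0 0 0 0 0.
  have /(lie_translate _ (- w2) w1 (- v1)) H := E1.
  by apply: lie_eq H _ _ _ _ _ _ _ => //; lra.
have F2 : lie (conj_set c G) 0 0 1 0 0 0 0.
  have /(lie_translate _ (- w2) w1 (- v1)) H := E2.
  by apply: lie_eq H _ _ _ _ _ _ _ => //; lra.
have F3 : lie (conj_set c G) 0 0 0 1 0 0 0.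
  have /(lie_translate _ (- w2) w1 (- v1)) H := E3.
  by apply: lie_eq H _ _ _ _ _ _ _ => //; lra.
constructor 4; split=> // a4 p4 q4 r4 u4 v4 w4 Z.
have {}Z := lie_lin (- p4) sG' F1 (lie_lin (- q4) sG' F2 (lie_lin (- r4) sG' F3 Z)).
have {}Z : lie (conj_set c G) a4 0 0 0 u4 v4 w4.
  by apply: lie_eq Z _ _ _ _ _ _ _; ring.
have d0 x := lie_det0 x nG' Z F2 F3.
have := (d0 (vec3 1 0 0), d0 (vec3 (- 1) 0 0), d0 (vec3 1 1 0), d0 (vec3 1 0 1)).
rewrite /det3 !kact_kmx !vec3E => -[[[f1 f2] f3] f4].
by split; lra.
Qed.

Theorem nice_classification G : nice G -> has_normal_form G.
Proof.
move=> nG; have [sG _ _ _] := nG.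
have [nt|tr] := pselect (no_trans G); last first.
  have [y [Ty y0]] : exists y : 'cV[R]_3,
      lie G 0 0 0 0 (y 0 0) (y 1 0) (y 2 0) /\ nsq y != 0.
    apply: contrapT => H; apply: tr => u v w T.
    have [/nsq_eq0 y0|y0] := eqVneq (nsq (vec3 u v w)) 0; last first.
      by case: H; exists (vec3 u v w); rewrite !vec3E.
    have k i := congr1 (fun z : 'cV[R]_3 => z i 0) y0.
    by have := (k 0, k 1, k 2); rewrite !vec3E !zeroE => -[[]].
  have [A AA Ay] := rotate_to_axis y; have AAC := Conf_rotation AA.
  have l0 : Num.sqrt (nsq y) != 0.
    by rewrite sqrtr_eq0 -ltNge lt_def y0 nsq_ge0.
  apply: (normal_form_conj AAC); have nG' := nice_conj AAC nG.
  have [sG' _ _ _] := nG'.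
  have e3 : lie (conj_set (1, A, 0) G) 0 0 0 0 0 0 1.
    have := lie_scale (Num.sqrt (nsq y))^-1 sG' (trans_rotate AA Ty).
    by rewrite Ay !vec3E !mulr0 mulVf.
  have [[[[u v] w] [/= T uv]]|H] := pselect (exists T : R * R * R,
      lie (conj_set (1, A, 0) G) 0 0 0 0 T.1.1 T.1.2 T.2 /\ (T.1.1 != 0 \/ T.1.2 != 0)).
    exact: two_translations T uv.
  apply: one_translation => // u v w T.
  by split; apply: contrapT => /eqP k0; apply: H; exists (u, v, w);
    split=> //=; [left | right].
have [[[[[[[[a p] q] r] u] v] w] [/= X om0]]|nX] := pselect (exists X :
    R * R * R * R * R * R * R,
    lie G X.1.1.1.1.1.1 X.1.1.1.1.1.2 X.1.1.1.1.2 X.1.1.1.2 X.1.1.2 X.1.2 X.2 /\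
    ~ [/\ X.1.1.1.1.1.2 = 0, X.1.1.1.1.2 = 0 & X.1.1.1.2 = 0]); last first.
  have om a p q r u v w : lie G a p q r u v w -> [/\ p = 0, q = 0 & r = 0].
    by move=> X; apply: contrapT => k; apply: nX; exists (a, p, q, r, u, v, w).
  case: (nice_not_thin nG).
  have [[[[[a u] v] w] [/= D a0]]|nD] := pselect (exists Y : R * R * R * R,
    lie G Y.1.1.1 0 0 0 Y.1.1.2 Y.1.2 Y.2 /\ Y.1.1.1 != 0).
    apply: (lie_thin (X := kmx a 0 0 0 u v w)) => // a1 p1 q1 r1 u1 v1 w1 Y.
    have [p0 q0 r0] := om _ _ _ _ _ _ _ Y; rewrite p0 q0 r0 in Y *.
    have H := lie_lin (- (a1 / a)) sG D Y.
    have [] := nt (- (a1 / a) * u + u1) (- (a1 / a) * v + v1) (- (a1 / a) * w + w1).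
      by apply: lie_eq H _ _ _ _ _ _ _ => //; by [ring | field].
    move=> u0 v0 w0; exists (a1 / a); rewrite kmx_scale.
    by apply: kmx_eq; [field | ring | ring | ring | lra | lra | lra].
  apply: (lie_thin (X := 0)) => // a1 p1 q1 r1 u1 v1 w1 Y; exists 0.
  have [p0 q0 r0] := om _ _ _ _ _ _ _ Y; rewrite p0 q0 r0 in Y *.
  have a0 : a1 = 0.
    by apply: contrapT => /eqP k; apply: nD; exists (a1, u1, v1, w1).
  by rewrite a0 in Y *; have [-> -> ->] := nt _ _ _ Y; rewrite scale0r kmx0.
have [A AA [r1 [u1 [v1 [w1 [XE r10]]]]]] := rotate_kmx a p q r u v w.
have AAC := Conf_rotation AA; apply: (normal_form_conj AAC).
have nG' := nice_conj AAC nG; have nt' := no_trans_rotate AA nt.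
have X' : lie (conj_set (1, A, 0) G) a 0 0 r1 u1 v1 w1.
  by rewrite /lie -XE; exact: tangent_conj.
have {}r10 : r1 != 0 by apply/eqP => /r10.
have [[[[[[[[a' p'] q'] r'] u'] v'] w'] [/= Y pq]]|nY] := pselect (exists Y :
    R * R * R * R * R * R * R,
    lie (conj_set (1, A, 0) G) Y.1.1.1.1.1.1 Y.1.1.1.1.1.2 Y.1.1.1.1.2
      Y.1.1.1.2 Y.1.1.2 Y.1.2 Y.2 /\
    (Y.1.1.1.1.1.2 != 0 \/ Y.1.1.1.1.2 != 0)).
  exact: spherical_case X' Y pq.
apply: conical_case X' _ => // a' p' q' r' u' v' w' Y.
by split; apply: contrapT => /eqP k; apply: nY;
  exists (a', p', q', r', u', v', w'); split=> //=; [left | right].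
Qed.

End Classification.

(** * Orbits that fill a leaf *)

Section Leaves.
Variable R : realType.
Implicit Types (g h c : triple R) (G : set (triple R)) (x y z : 'cV[R]_3).

Lemma mxder_block m1 m2 n1 n2 (A : R -> 'M[R]_(m1, n1)) (B : R -> 'M[R]_(m1, n2))
    (C : R -> 'M[R]_(m2, n1)) (D : R -> 'M[R]_(m2, n2)) (t : R) A' B' C' D' :
  mxder A t A' -> mxder B t B' -> mxder C t C' -> mxder D t D' ->
  mxder (fun t => block_mx (A t) (B t) (C t) (D t)) t (block_mx A' B' C' D').
Proof.
move=> dA dB dC dD i j.
case: (split_ordP i) => i' ->; case: (split_ordP j) => j' ->.
- by under eq_fun do rewrite block_mxEul; rewrite block_mxEul.
- by under eq_fun do rewrite block_mxEur; rewrite block_mxEur.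
- by under eq_fun do rewrite block_mxEdl; rewrite block_mxEdl.
- by under eq_fun do rewrite block_mxEdr; rewrite block_mxEdr.
Qed.

Definition dilation_path (t : R) : triple R := (expR t, 1%:M, 0).
Definition rotation_path (t : R) : triple R := (1, rotz t, 0).
Definition translation_path (b : 'cV[R]_3) (t : R) : triple R := (1, 1%:M, t *: b).

Definition transversal (gam : R -> triple R) (X : 'M[R]_(3 + 1)) :=
  [/\ C1path gam, gam 0 = conf1 R & mxder (fun t => rho (gam t)) 0 X].

Lemma dilation_transversal : transversal dilation_path (kmx 1 0 0 0 0 0 0).
Proof.
split.
- split; [exact: C1_expR | exact: C1mx_cst | exact: C1mx_cst].
- by rewrite /dilation_path expR0.
rewrite /rho /kmx /=; apply: mxder_block; try exact: mxder_cst.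
- have -> : cols3 (vec3 1 0 (- 0)) (vec3 (- 0) 1 0) (vec3 0 (- 0) 1) = 1%:M :> 'M[R]_3.
    by apply: col3P; apply: ord3_ind; rewrite col_cols3; apply: vec3P;
      rewrite vec3E !mxE /= ?oppr0.
  move=> i j; have ? := is_derive_expR (0 : R); under eq_fun do rewrite mxE.
  by apply: is_derive_eq; rewrite /GRing.scale /= expR0 !mxE; ring.
- have -> : vec3 0 0 0 = 0 :> 'cV[R]_3 by apply: vec3P; rewrite vec3E zeroE.
  exact: mxder_cst.
Qed.

Lemma C1mx_vec3 (f g h : R -> R) : C1 f -> C1 g -> C1 h ->
  C1mx (fun t => vec3 (f t) (g t) (h t)).
Proof.
move=> Cf Cg Ch i j; rewrite ord1; elim/ord3_ind: i;
  by under eq_fun do rewrite vec3E.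
Qed.

Lemma mxder_vec3 (f g h : R -> R) (t a b c : R) :
  is_derive t 1 f a -> is_derive t 1 g b -> is_derive t 1 h c ->
  mxder (fun t => vec3 (f t) (g t) (h t)) t (vec3 a b c).
Proof.
move=> df dg dh i j; rewrite ord1; elim/ord3_ind: i; rewrite vec3E;
  by under eq_fun do rewrite vec3E.
Qed.

Lemma C1mx_cols3 (X Y Z : R -> 'cV[R]_3) : C1mx X -> C1mx Y -> C1mx Z ->
  C1mx (fun t => cols3 (X t) (Y t) (Z t)).
Proof.
move=> CX CY CZ i j; elim/ord3_ind: j; under eq_fun do rewrite cols3E;
  [exact: CX | exact: CY | exact: CZ].
Qed.

Lemma mxder_cols3 (X Y Z : R -> 'cV[R]_3) (t : R) x y z :
  mxder X t x -> mxder Y t y -> mxder Z t z ->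
  mxder (fun t => cols3 (X t) (Y t) (Z t)) t (cols3 x y z).
Proof.
move=> dX dY dZ i j; elim/ord3_ind: j; rewrite cols3E;
  under eq_fun do rewrite cols3E; [exact: dX | exact: dY | exact: dZ].
Qed.

Lemma rotzE (t : R) : rotz t =
  cols3 (vec3 (cos t) (- sin t) 0) (vec3 (sin t) (cos t) 0) (vec3 0 0 1).
Proof.
by apply: col3P; apply: ord3_ind; rewrite col_cols3; apply: vec3P;
  rewrite vec3E !mxE.
Qed.

Lemma rotz0 : rotz (0 : R) = 1%:M.
Proof.
apply: col3P; apply: ord3_ind; rewrite rotzE col_cols3 ?cos0 ?sin0 ?oppr0;
  by apply: vec3P; rewrite vec3E !mxE.
Qed.

Lemma rotation_transversal : transversal rotation_path (kmx 0 0 0 (- 1) 0 0 0).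
Proof.
have [Cc Cs] := (@C1_cos R, @C1_sin R).
have CN : C1 (fun t : R => - sin t) by exact: C1N.
split.
- split; [exact: C1_cst | | exact: C1mx_cst].
  rewrite /rotation_path /=; under eq_fun do rewrite rotzE.
  by apply: C1mx_cols3; apply: C1mx_vec3 => //; exact: C1_cst.
- by rewrite /rotation_path rotz0.
rewrite /rho /kmx /=; apply: mxder_block; try exact: mxder_cst; last first.
  have -> : vec3 0 0 0 = 0 :> 'cV[R]_3 by apply: vec3P; rewrite vec3E zeroE.
  exact: mxder_cst.
under eq_fun do rewrite scale1r rotzE.
have dc : is_derive (0 : R) 1 cos 0.
  by apply: derive_eq (is_derive_cos _) _; rewrite sin0 oppr0.
have ds : is_derive (0 : R) 1 sin 1.
  by apply: derive_eq (is_derive_sin _) _; rewrite cos0.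
have dN : is_derive (0 : R) 1 (fun t => - sin t) (- 1) by exact: is_deriveN.
rewrite oppr0 opprK.
by apply: mxder_cols3; apply: mxder_vec3 => //; exact: is_derive_cst.
Qed.

Lemma translation_transversal b :
  transversal (translation_path b) (kmx 0 0 0 0 (b 0 0) (b 1 0) (b 2 0)).
Proof.
split.
- split; [exact: C1_cst | exact: C1mx_cst |].
  by apply: C1mxZ; [exact: C1_id | exact: C1mx_cst].
- by rewrite /translation_path scale0r.
rewrite /rho /kmx /=; apply: mxder_block; try exact: mxder_cst.
- have -> : cols3 (vec3 0 0 (- 0)) (vec3 (- 0) 0 0) (vec3 0 (- 0) 0) = 0 :> 'M[R]_3.
    by apply: col3P; apply: ord3_ind; rewrite col_cols3; apply: vec3P;
      rewrite vec3E !mxE /= ?oppr0.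
  exact: mxder_cst.
- rewrite vec3K => i j; under eq_fun do rewrite mxE.
  by apply: is_derive_eq; rewrite /GRing.scale /=; ring.
Qed.

(** The parameters s with c s in the orbit of c 0 form an open and closed set, as
    the orbits of G are open in the leaves of E. *)
Lemma path_in_orbit G (E : 'cV[R]_3 -> 'cV[R]_3 -> Prop) (c : R -> E3 R) :
  subgroup G ->
  (forall x, exists2 d : R, 0 < d & forall y, E x y -> `|y - x| < d ->
     conf_orbit G x y) ->
  continuous c -> (forall s t, E (c s) (c t)) -> conf_orbit G (c 0) (c 1).
Proof.
move=> sG loc cc cE; pose P t := conf_orbit G (c 0) (c t).
have near_same t : nbhs t [set t' | P t <-> P t'].
  have [d d0 dP] := loc (c t).
  have /cvgrPdist_lt/(_ d d0) := cc t.
  apply: filterS => t'; rewrite distrC => /(dP _ (cE t t')) ctt'.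
  split=> H; first exact: orbit_trans H ctt'.
  by apply: orbit_trans H _ => //; exact: orbit_sym ctt'.
pose B := `[0, 1]%classic `&` [set t | P t].
suff : B = `[0, 1]%classic.
  move=> /seteqP[_ /(_ 1)] []//=.
  by rewrite in_itv /= ler01 lexx.
apply: segment_connected.
- by exists 0; split; rewrite /= ?in_itv /= ?lexx ?ler01 //; exact: orbit_refl.
- exists ([set t | P t]°); first exact: open_interior.
  apply/seteqP; split=> t [It Pt]; split=> //; last exact: interior_subset Pt.
  by apply: filterS (near_same t) => t' /= <-.
- exists (~` ([set t | ~ P t]°)); first exact/open_closedC/open_interior.
  apply/seteqP; split=> t [It Pt]; split=> //.
    by move=> /interior_subset; apply.
  apply: contrapT => nP; apply: Pt.
  by apply: filterS (near_same t) => t' /= <-.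
Qed.

(** Along gam one leaves the leaf of E immediately. Among the products of gam and
    two paths in G, which fill a neighbourhood of x, the points of the leaf are
    therefore those with trivial gam part. *)
Lemma local_leaf G (E : 'cV[R]_3 -> 'cV[R]_3 -> Prop) gam X1 X2 X3 x : subgroup G ->
  transversal gam X1 -> tangent G X2 -> tangent G X3 ->
  det3 (kact X1 x) (kact X2 x) (kact X3 x) != 0 ->
  (forall y, conf_orbit G x y -> E x y) ->
  (forall s z, `|s| < 1 -> E x z -> E x (cact (gam s) z) -> s = 0) ->
  exists2 d : R, 0 < d & forall y, E x y -> `|y - x| < d -> conf_orbit G x y.
Proof.
move=> sG [C1g g0 dg] [gam2 [C2g G2g] [g2 d2]] [gam3 [C3g G3g] [g3 d3]] dn0 GE Es.
have [d d0 dP] := paths_locally_onto C1g C2g C3g g0 g2 g3 dg d2 d3 dn0 ltr01.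
exists d => // y Exy /dP[s1 [s2 [s3 [s11 _ _ yE]]]].
have Oz : conf_orbit G x (cact (gam2 s2) (cact (gam3 s3) x)).
  rewrite -cact_cmul; exists (cmul (gam2 s2) (gam3 s3)) => //.
  by case: sG => _ _ GM _; apply: (GM).
by move: Exy; rewrite yE => /(Es _ _ s11 (GE _ Oz)) ->; rewrite g0 cact1.
Qed.

(** The analogue for one-dimensional leaves, with two transversal paths. *)
Lemma local_leaf_axis G (E : 'cV[R]_3 -> 'cV[R]_3 -> Prop) gam1 gam2 X1 X2 X3 x :
  subgroup G -> transversal gam1 X1 -> transversal gam2 X2 -> tangent G X3 ->
  det3 (kact X1 x) (kact X2 x) (kact X3 x) != 0 ->
  (forall y, conf_orbit G x y -> E x y) ->
  (forall s t z, E x z -> E x (cact (gam1 s) (cact (gam2 t) z)) -> s = 0 /\ t = 0) ->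
  exists2 d : R, 0 < d & forall y, E x y -> `|y - x| < d -> conf_orbit G x y.
Proof.
move=> sG [C1g g1 d1] [C2g g2 d2] [gam3 [C3g G3g] [g3 d3]] dn0 GE Es.
have [d d0 dP] := paths_locally_onto C1g C2g C3g g1 g2 g3 d1 d2 d3 dn0 ltr01.
exists d => // y Exy /dP[s1 [s2 [s3 [_ _ _ yE]]]].
have Oz : conf_orbit G x (cact (gam3 s3) x) by exists (gam3 s3).
move: Exy; rewrite yE => /(Es _ _ _ (GE _ Oz))[-> ->].
by rewrite g1 g2 !cact1.
Qed.

(** The cosine and sine of t are the normalised scalar and cross products. *)
Lemma polar (p q u v : R) : p ^+ 2 + q ^+ 2 = u ^+ 2 + v ^+ 2 ->
  exists t : R, u = cos t * p - sin t * q /\ v = sin t * p + cos t * q.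
Proof.
move=> e; have [n0|n0] := eqVneq (p ^+ 2 + q ^+ 2) 0.
  exists 0; have z a b : a ^+ 2 + b ^+ 2 = 0 -> a = 0 /\ b = 0 :> R.
    move=> /eqP; rewrite paddr_eq0 ?sqr_ge0 // !sqrf_eq0.
    by move=> /andP[/eqP ? /eqP ?].
  have [-> ->] := z _ _ n0; have [-> ->] := z u v (etrans (esym e) n0).
  by rewrite !mulr0 subr0 addr0.
pose n := p ^+ 2 + q ^+ 2; pose C := (p * u + q * v) / n.
pose S := (p * v - q * u) / n.
have CS : C ^+ 2 + S ^+ 2 = 1.
  have -> : C ^+ 2 + S ^+ 2 = (p ^+ 2 + q ^+ 2) * (u ^+ 2 + v ^+ 2) / n ^+ 2.
    by rewrite /C /S; field.
  by rewrite -e -/n; field.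
have [t tC tS] : exists2 t : R, cos t = C & sin t = S.
  have C1 : -1 <= C <= 1.
    rewrite -ler_norml -(ler_pXn2r (n := 2)) ?nnegrE // expr1n -normrX.
    by rewrite ger0_norm ?sqr_ge0 // -CS lerDl sqr_ge0.
  have s2 : sin (acos C) ^+ 2 == S ^+ 2.
    apply/eqP; have := cos2Dsin2 (acos C); rewrite acosK ?in_itv //= -CS.
    by move=> /addrI.
  move: s2; rewrite eqf_sqr => /orP[/eqP s2|/eqP s2].
    by exists (acos C); rewrite ?acosK ?in_itv.
  by exists (- acos C); rewrite ?cosN ?sinN ?acosK ?in_itv //= s2 opprK.
exists t; rewrite tC tS /C /S /n.
by split; field.
Qed.

Lemma vec3_continuous (f g h : R -> R) : continuous f -> continuous g ->
  continuous h -> continuous (fun s => vec3 (f s) (g s) (h s) : E3 R).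
Proof.
move=> fc gc hc.
have -> : (fun s => vec3 (f s) (g s) (h s) : E3 R) =
    (fun s => (0 : E3 R) + f s *: (vec3 1 0 0 : E3 R) + g s *: (vec3 0 1 0 : E3 R) +
      h s *: (vec3 0 0 1 : E3 R)).
  by apply/funext => s; apply: vec3P; rewrite !(entryE, vec3E); ring.
move=> s; apply: cvgD; first exact: affine_arc_continuous.
by apply: cvgZr_tmp; exact: hc.
Qed.

End Leaves.

(** * Orbits of the normal forms *)

Section OrbitsOfNormalForms.
Variable R : realType.
Implicit Types (g h c : triple R) (G H : set (triple R)) (x y z : 'cV[R]_3).

(** The squared distance to the third axis. *)
Definition axis2 x : R := x 0 0 ^+ 2 + x 1 0 ^+ 2.

Lemma axis2_ge0 x : 0 <= axis2 x.
Proof. by rewrite addr_ge0 // sqr_ge0. Qed.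

Lemma axis2_eq0 x : axis2 x = 0 -> x 0 0 = 0 /\ x 1 0 = 0.
Proof.
move=> /eqP; rewrite paddr_eq0 ?sqr_ge0 // !sqrf_eq0.
by move=> /andP[/eqP ? /eqP ?].
Qed.

(** The horizontal parts of x and y lie on the same logarithmic spiral, which is a
    circle for a = 0 and a half-line for r = 0. *)
Definition planar_rel (a r : R) x y := exists d : R,
  y 0 0 = expR (a * d) * (cos (r * d) * x 0 0 - sin (r * d) * x 1 0) /\
  y 1 0 = expR (a * d) * (sin (r * d) * x 0 0 + cos (r * d) * x 1 0).

Lemma planar_rel_refl a r x : planar_rel a r x x.
Proof. by exists 0; rewrite !mulr0 expR0 cos0 sin0 !(mul1r, mul0r) subr0 add0r. Qed.

Lemma planar_rel_trans a r x y z :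
  planar_rel a r x y -> planar_rel a r y z -> planar_rel a r x z.
Proof.
move=> [d [y0 y1]] [d' [z0 z1]]; exists (d + d').
by rewrite !mulrDr expRD cosD sinD z0 z1 y0 y1; split; ring.
Qed.

Lemma planar_rel_sym a r x y : planar_rel a r x y -> planar_rel a r y x.
Proof.
move=> [d [y0 y1]]; exists (- d); rewrite !mulrN cosN sinN y0 y1.
have e1 : expR (- (a * d)) * expR (a * d) = 1 by rewrite expRN mulVf // expR_eq0.
have := cos2Dsin2 (r * d); move: e1.
move: (expR _) (expR _) (cos _) (sin _) => B A c s BA cs.
by split; rewrite -[LHS]mul1r -BA -[LHS]mul1r -cs; ring.
Qed.

Lemma rotation_norm (t p q : R) :
  (cos t * p - sin t * q) ^+ 2 + (sin t * p + cos t * q) ^+ 2 = p ^+ 2 + q ^+ 2.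
Proof.
rewrite -[RHS]mul1r -(cos2Dsin2 t); ring.
Qed.

Lemma planar_rel_axis2 a r x y : planar_rel a r x y ->
  exists2 d : R, axis2 y = expR (a * d) ^+ 2 * axis2 x &
  y 0 0 = expR (a * d) * (cos (r * d) * x 0 0 - sin (r * d) * x 1 0) /\
  y 1 0 = expR (a * d) * (sin (r * d) * x 0 0 + cos (r * d) * x 1 0).
Proof.
move=> [d e]; exists d => //; case: e => y0 y1.
by rewrite /axis2 y0 y1 -(rotation_norm (r * d) (x 0 0) (x 1 0)); ring.
Qed.

Lemma planar_rel_axis a r x y : planar_rel a r x y -> (axis2 y == 0) = (axis2 x == 0).
Proof.
by move=> /planar_rel_axis2[d -> _]; rewrite mulf_eq0 sqrf_eq0 expR_eq0.
Qed.

Lemma axis2_planar_rel r x y : r != 0 -> axis2 x = axis2 y -> planar_rel 0 r x y.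
Proof.
move=> r0 /polar[t [y0 y1]]; exists (t / r).
by rewrite mul0r expR0 !mul1r mulrCA divff // mulr1.
Qed.

Lemma same_orbits_rel G H (E : 'cV[R]_3 -> 'cV[R]_3 -> Prop) :
  (forall x y, conf_orbit G x y <-> E x y) ->
  (forall x y, conf_orbit H x y <-> E x y) -> same_orbits_upto_conj G H.
Proof.
move=> GE HE; exists (conf1 R); first exact: Conf_conf1.
move=> x; rewrite conj_set1; apply/seteqP; split=> y.
  by move=> /GE/HE.
by move=> /HE/GE.
Qed.

Lemma planar_type_orbit G x y : nice G -> planar_type G ->
  (conf_orbit G x y <-> x 2 0 = y 2 0).
Proof.
move=> nG [e1 e2]; have [sG Gc _ _] := nG.
have GE x' y' : conf_orbit G x' y' -> x' 2 0 = y' 2 0.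
  apply: (orbit_invariant (E := fun x y => x 2 0 = y 2 0)) => // {x y x' y'}.
    by move=> x y z -> ->.
  move=> gam s t x pg; have [L LP] := path_ode sG pg.
  apply: (is_derive_0_is_cst (f := fun u => cact (gam u) x 2 0)) => u.
  have [a [p [q [r [u' [v [w [T _ dy]]]]]]]] := LP u.
  apply: derive_eq (dy x 2) _.
  have := lie_det0 (cact (gam u) x) nG e1 e2 T.
  rewrite /det3 !kact_kmx !vec3E; lra.
split=> [|xy]; first exact: GE.
pose c (s : R) : E3 R := vec3 (x 0 0 + s * (y 0 0 - x 0 0))
  (x 1 0 + s * (y 1 0 - x 1 0)) (x 2 0).
have c0 : c 0 = x by apply: vec3P; rewrite vec3E ?mul0r ?addr0.
have c1 : c 1 = y by apply: vec3P; rewrite vec3E ?mul1r // addrC subrK.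
rewrite -c0 -c1.
apply: (path_in_orbit (E := fun x y => x 2 0 = y 2 0)) => //.
- move=> {c c0 c1 xy}x'.
  apply: (@local_leaf _ _ (fun x y => x 2 0 = y 2 0) _ _ _ _ _ sG
    (translation_transversal (vec3 0 0 1)) e1 e2) => //.
  + rewrite /det3 !kact_kmx !vec3E.
    by rewrite !(mul0r, mulr0, addr0, add0r, subr0, mul1r, oppr0, sub0r, mulr1) oner_neq0.
  + by move=> y'; exact: GE.
  move=> s z _ ->; rewrite /cact /= mul1mx !entryE vec3E; lra.
- have aff p q : continuous (fun s : R => p + s * q).
    apply: C1_continuous; apply: C1D; first exact: C1_cst.
    by apply: C1M; [exact: C1_id | exact: C1_cst].
  apply: vec3_continuous => //; apply: C1_continuous; exact: C1_cst.
- by move=> s t; rewrite !vec3E.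
Qed.

Lemma grpP_orbit x y : conf_orbit (grpP R) x y <-> x 2 0 = y 2 0.
Proof.
have b0 : basis_vec R 0 = vec3 1 0 0 by apply: vec3P; rewrite vec3E mxE.
have b1 : basis_vec R 1 = vec3 0 1 0 by apply: vec3P; rewrite vec3E mxE.
split=> [[_ [a [b ->]] <-]|xy].
  by rewrite /cact /= mul1mx b0 b1 !entryE !vec3E; ring.
exists (1, 1%:M, (y 0 0 - x 0 0) *: basis_vec R 0 + (y 1 0 - x 1 0) *: basis_vec R 1).
  by do 2 eexists.
rewrite /cact /= mul1mx b0 b1; apply: vec3P; rewrite !entryE !vec3E ?xy; ring.
Qed.

Lemma affine_C1 (p q : R) : C1 (fun s : R => p + s * q).
Proof.
apply: C1D; first exact: C1_cst.
by apply: C1M; [exact: C1_id | exact: C1_cst].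
Qed.

Lemma spiral_C1 (a r p q : R) :
  C1 (fun s : R => expR (s * a) * (cos (s * r) * p - sin (s * r) * q)) /\
  C1 (fun s : R => expR (s * a) * (sin (s * r) * p + cos (s * r) * q)).
Proof.
have lin k : C1 (fun s : R => s * k) by apply: C1M; [exact: C1_id | exact: C1_cst].
have Ce := C1_comp (@C1_expR R) (lin a).
have Cc := C1_comp (@C1_cos R) (lin r); have Cs := C1_comp (@C1_sin R) (lin r).
split; apply: C1M => //; apply: C1D; try apply: C1N;
  by apply: C1M => //; exact: C1_cst.
Qed.

Lemma small_rotation_fix (s p q : R) : `|s| < 1 -> p ^+ 2 + q ^+ 2 != 0 ->
  cos s * p + sin s * q = p -> - sin s * p + cos s * q = q -> s = 0.
Proof.
move=> s1 n0 e0 e1; have : sin s * (p ^+ 2 + q ^+ 2) = 0.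
  have -> : sin s * (p ^+ 2 + q ^+ 2) =
    (cos s * p + sin s * q) * q - (- sin s * p + cos s * q) * p by ring.
  by rewrite e0 e1; ring.
move=> /eqP; rewrite mulf_eq0 (negPf n0) orbF => /eqP ss.
have pi1 : 1 <= pi / 2 :> R by have := pi_ge2 R; lra.
move: s1; rewrite ltr_norml => /andP[sl sr].
by apply: (@sin_inj R); rewrite ?sin0 // in_itv /=; apply/andP; split; lra.
Qed.

Lemma kmx_e3 x : kact (kmx 0 0 0 0 0 0 1) x = vec3 0 0 1.
Proof. by rewrite kact_kmx; apply: vec3P; rewrite !vec3E; ring. Qed.

(** Two transversal translations test whether a point leaves the axis. *)
Lemma local_leaf_on_axis G (E : 'cV[R]_3 -> 'cV[R]_3 -> Prop) (X : 'M[R]_(3 + 1)) x :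
  subgroup G -> tangent G X -> kact X x 2 0 != 0 ->
  (forall y, conf_orbit G x y -> E x y) ->
  (forall y, E x y -> y 0 0 = 0 /\ y 1 0 = 0) ->
  exists2 d : R, 0 < d & forall y, E x y -> `|y - x| < d -> conf_orbit G x y.
Proof.
move=> sG TX X2 GE Ex.
apply: (local_leaf_axis sG (translation_transversal (vec3 1 0 0))
  (translation_transversal (vec3 0 1 0)) TX _ GE).
  rewrite /det3 !kact_kmx !vec3E.
  by rewrite !(mul0r, mulr0, addr0, add0r, subr0, mul1r, oppr0, sub0r, mulr1).
move=> s t z /Ex[z0 z1] /Ex[]; rewrite /cact /= !mul1mx !entryE !vec3E z0 z1.
by split; lra.
Qed.

Section Cylindrical.
Variables (G : set (triple R)) (a r : R).
Hypotheses (nG : nice G) (cG : cylindrical_type G a r).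

Let sG : subgroup G. Proof. by case: nG. Qed.

(** Modulo translations along the axis, the fields are proportional to the one
    with parameters a and r. The time is the logarithm of the scaling factor over
    a; for a = 0 the distance to the axis is constant. *)
Lemma cylindrical_orbit_rel x y : conf_orbit G x y -> planar_rel a r x y.
Proof.
have [e3 X ar0 Yall] := cG; have [_ Gc _ _] := nG.
apply: orbit_invariant => // {x y}; first exact: planar_rel_refl.
  exact: planar_rel_trans.
move=> gam s t x pg; have [L LP] := path_ode sG pg.
have {}LP : forall t : R, exists k : R,
    [/\ is_derive t 1 L (k * a),
    is_derive t 1 (fun u => cact (gam u) x 0 0)
      (k * (a * cact (gam t) x 0 0 - r * cact (gam t) x 1 0)) &
    is_derive t 1 (fun u => cact (gam u) x 1 0)
      (k * (r * cact (gam t) x 0 0 + a * cact (gam t) x 1 0))].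
  move=> {}t; have [a' [p' [q' [r' [u' [v' [w' [T dL dy]]]]]]]] := LP t.
  have [p0 q0 u0 v0 arr] := Yall _ _ _ _ _ _ _ T.
  pose k := (a * a' + r * r') / (a ^+ 2 + r ^+ 2).
  have ka : a' = k * a.
    apply: (mulIf ar0); rewrite /k mulrAC divfK //.
    have -> : (a * a' + r * r') * a = a' * a ^+ 2 + r * (a * r') by ring.
    by rewrite arr; ring.
  have kr : r' = k * r.
    apply: (mulIf ar0); rewrite /k mulrAC divfK //.
    have -> : (a * a' + r * r') * r = (r * a') * a + r' * r ^+ 2 by ring.
    by rewrite -arr; ring.
  exists k; split; first by rewrite -ka.
    by apply: derive_eq (dy x 0) _; rewrite kact_kmx vec3E ka kr q0 u0; ring.
  by apply: derive_eq (dy x 1) _; rewrite kact_kmx vec3E ka kr p0 v0; ring.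
have [a0|a0] := eqVneq a 0; last first.
  have H u : exists k : R, [/\ is_derive (u : R) 1 (fun u => a^-1 * L u) k,
    is_derive u 1 (fun u => cact (gam u) x 0 0)
      (k * (a * cact (gam u) x 0 0 - r * cact (gam u) x 1 0)) &
    is_derive u 1 (fun u => cact (gam u) x 1 0)
      (k * (r * cact (gam u) x 0 0 + a * cact (gam u) x 1 0))].
    have [k [dL d0 d1]] := LP u; exists k; split=> //.
    by apply: is_derive_eq; rewrite /GRing.scale /=; field.
  by exists (a^-1 * L t - a^-1 * L s); exact: (planar_flow H s t).
have r0 : r != 0 by apply: contraNneq ar0 => ->; rewrite a0 !expr0n addr0.
rewrite a0; apply: axis2_planar_rel => //.
apply: (is_derive_0_is_cst
  (f := fun u => cact (gam u) x 0 0 ^+ 2 + cact (gam u) x 1 0 ^+ 2)) => u.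
have [k [_ ? ?]] := LP u.
by apply: is_derive_eq; rewrite a0 /GRing.scale /=; ring.
Qed.

(** Off the axis, rotations leave the spiral if a != 0, and dilations leave the
    circle if a = 0. *)
Lemma cylindrical_local x : exists2 d : R, 0 < d &
  forall y, planar_rel a r x y -> `|y - x| < d -> conf_orbit G x y.
Proof.
have [e3 X ar0 Yall] := cG.
have GE y : conf_orbit G x y -> planar_rel a r x y by exact: cylindrical_orbit_rel.
have [x0|x0] := eqVneq (axis2 x) 0.
  apply: (local_leaf_on_axis sG e3) => //.
    by rewrite kmx_e3 vec3E oner_neq0.
  move=> y /planar_rel_axis2[d + _]; rewrite x0 mulr0.
  exact: axis2_eq0.
have [a0|a0] := eqVneq a 0.
  have r0 : r != 0 by apply: contraNneq ar0 => ->; rewrite a0 !expr0n addr0.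
  apply: (local_leaf sG (dilation_transversal R) X e3) => //.
    rewrite kmx_e3 /det3 !kact_kmx !vec3E a0.
    apply: contraNneq x0 => e; apply/eqP; apply: (mulfI r0); rewrite mulr0 -e /axis2; ring.
  move=> s z _ xz xsz; have := planar_rel_trans (planar_rel_sym xz) xsz.
  move=> /planar_rel_axis2[d + _]; rewrite a0 mul0r expR0 expr1n mul1r.
  have z0 : axis2 z != 0 by rewrite (planar_rel_axis xz).
  rewrite {1}/axis2 /cact /= mul1mx addr0 !entryE => e.
  have : expR s ^+ 2 * axis2 z = 1 ^+ 2 * axis2 z.
    by rewrite expr1n mul1r -[RHS]e /axis2; ring.
  move=> /(mulIf z0)/eqP; rewrite eqrXn2 ?expR_ge0 // -expR0 => /eqP.
  exact: expR_inj.
apply: (local_leaf sG (rotation_transversal R) X e3) => //.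
  rewrite kmx_e3 /det3 !kact_kmx !vec3E.
  apply: contraNneq x0 => e; apply/eqP; apply: (mulfI a0); rewrite mulr0 -e /axis2; ring.
move=> s z s1 xz xsz.
have z0 : axis2 z != 0 by rewrite (planar_rel_axis xz).
have [d ed [d0 d1]] := planar_rel_axis2 (planar_rel_trans (planar_rel_sym xz) xsz).
have RE i : cact (rotation_path s) z i 0 =
    vec3 (cos s * z 0 0 + sin s * z 1 0) (- sin s * z 0 0 + cos s * z 1 0) (z 2 0) i 0.
  rewrite /rotation_path /cact /= scale1r addr0 rotzE cols3_mul.
  by elim/ord3_ind: i; rewrite !(entryE, vec3E); ring.
have rn : axis2 (cact (rotation_path s) z) = axis2 z.
  rewrite {1}/axis2 !RE !vec3E /axis2 -[RHS]mul1r -(cos2Dsin2 s); ring.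
have dd : d = 0.
  move: ed; rewrite rn -{1}[axis2 z]mul1r -(expr1n _ 2) => /(mulIf z0)/esym/eqP.
  rewrite eqrXn2 ?expR_ge0 // -expR0 => /eqP/expR_inj/eqP.
  by rewrite mulf_eq0 (negPf a0) => /eqP.
move: d0 d1; rewrite !RE !vec3E dd !mulr0 expR0 cos0 sin0 !(mul1r, mul0r) subr0 add0r.
exact: small_rotation_fix.
Qed.

Lemma cylindrical_orbit x y : conf_orbit G x y <-> planar_rel a r x y.
Proof.
split=> [|xy]; first exact: cylindrical_orbit_rel.
have [d [y0 y1]] := xy.
pose c (s : R) : E3 R := vec3
  (expR (s * (a * d)) * (cos (s * (r * d)) * x 0 0 - sin (s * (r * d)) * x 1 0))
  (expR (s * (a * d)) * (sin (s * (r * d)) * x 0 0 + cos (s * (r * d)) * x 1 0))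
  (x 2 0 + s * (y 2 0 - x 2 0)).
have c0 : c 0 = x.
  by apply: vec3P; rewrite vec3E !mul0r ?expR0 ?cos0 ?sin0; ring.
have c1 : c 1 = y.
  by apply: vec3P; rewrite vec3E !mul1r ?y0 ?y1 // addrC subrK.
have xc s : planar_rel a r x (c s).
  by exists (s * d); rewrite !vec3E ![s * (_ * d)]mulrCA.
rewrite -c0 -c1; apply: (path_in_orbit (E := planar_rel a r)) => //.
- exact: cylindrical_local.
- have [C0 C1'] := spiral_C1 (a * d) (r * d) (x 0 0) (x 1 0).
  by apply: vec3_continuous; apply: C1_continuous => //; exact: affine_C1.
- move=> s t; exact: planar_rel_trans (planar_rel_sym (xc s)) (xc t).
Qed.

End Cylindrical.

End OrbitsOfNormalForms.

Section ConicalSpherical.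
Variable R : realType.
Implicit Types (g h c : triple R) (G H : set (triple R)) (x y z : 'cV[R]_3).

Definition cone_rel x y := exists d t : R,
  [/\ y 0 0 = expR d * (cos t * x 0 0 - sin t * x 1 0),
      y 1 0 = expR d * (sin t * x 0 0 + cos t * x 1 0) &
      y 2 0 = expR d * x 2 0].

Lemma cone_rel_refl x : cone_rel x x.
Proof.
by exists 0, 0; rewrite expR0 cos0 sin0 !(mul1r, mul0r) subr0 add0r.
Qed.

Lemma cone_rel_trans x y z : cone_rel x y -> cone_rel y z -> cone_rel x z.
Proof.
move=> [d [t [y0 y1 y2]]] [d' [t' [z0 z1 z2]]]; exists (d + d'), (t + t').
by rewrite expRD cosD sinD z0 z1 z2 y0 y1 y2; split; ring.
Qed.

Lemma cone_rel_sym x y : cone_rel x y -> cone_rel y x.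
Proof.
move=> [d [t [y0 y1 y2]]]; exists (- d), (- t); rewrite cosN sinN y0 y1 y2.
have e1 : expR (- d) * expR d = 1 by rewrite expRN mulVf // expR_eq0.
have := cos2Dsin2 t; move: e1.
move: (expR _) (expR _) (cos _) (sin _) => B A c s BA cs.
split; last by rewrite mulrA BA mul1r.
  by rewrite -[LHS]mul1r -BA -[LHS]mul1r -cs; ring.
by rewrite -[LHS]mul1r -BA -[LHS]mul1r -cs; ring.
Qed.

Lemma cone_rel_axis2 x y : cone_rel x y -> exists d t : R,
  [/\ axis2 y = expR d ^+ 2 * axis2 x, y 2 0 = expR d * x 2 0,
   y 0 0 = expR d * (cos t * x 0 0 - sin t * x 1 0) &
   y 1 0 = expR d * (sin t * x 0 0 + cos t * x 1 0)].
Proof.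
move=> [d [t [y0 y1 y2]]]; exists d, t; split=> //.
by rewrite /axis2 y0 y1 -(rotation_norm t (x 0 0) (x 1 0)); ring.
Qed.

Lemma axis2_cone_rel (d : R) x y :
  axis2 y = expR d ^+ 2 * axis2 x -> y 2 0 = expR d * x 2 0 -> cone_rel x y.
Proof.
move=> e2 y2; have E0 : expR d != 0 by rewrite expR_eq0.
have [|t [y0 y1]] := @polar _ (x 0 0) (x 1 0) (y 0 0 / expR d) (y 1 0 / expR d).
  have -> : (y 0 0 / expR d) ^+ 2 + (y 1 0 / expR d) ^+ 2 = axis2 y / expR d ^+ 2.
    by rewrite /axis2; field.
  by rewrite e2 mulrAC divff ?mul1r // sqrf_eq0.
by exists d, t; rewrite -y0 -y1 !(mulrC (expR d) (_ / _)) !divfK.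
Qed.

(** Up to the common scaling factor, the distance to the axis and the third
    coordinate are first integrals. Vertical translations are transversal to the
    cones; the axis consists of the origin and two half-line orbits. *)
Lemma conical_orbit G x y : nice G -> conical_type G ->
  (conf_orbit G x y <-> cone_rel x y).
Proof.
move=> nG [D S Yall]; have [sG Gc _ _] := nG.
have GE x' y' : conf_orbit G x' y' -> cone_rel x' y'.
  apply: orbit_invariant => // {x y x' y'}; first exact: cone_rel_refl.
    exact: cone_rel_trans.
  move=> gam s t x pg; have [L LP] := path_ode sG pg.
  pose y i (u : R) := cact (gam u) x i 0.
  have {}LP : forall u : R, exists a r : R, [/\ is_derive u 1 L a,
      is_derive u 1 (y 0) (a * y 0 u - r * y 1 u),
      is_derive u 1 (y 1) (r * y 0 u + a * y 1 u) &
      is_derive u 1 (y 2) (a * y 2 u)].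
    move=> u; have [a [p [q [r [u' [v [w [T dL dy]]]]]]]] := LP u.
    have [p0 q0 u0 v0 w0] := Yall _ _ _ _ _ _ _ T; exists a, r; split=> //.
    - by apply: derive_eq (dy x 0) _; rewrite kact_kmx vec3E q0 u0 /y; ring.
    - by apply: derive_eq (dy x 1) _; rewrite kact_kmx vec3E p0 v0 /y; ring.
    - by apply: derive_eq (dy x 2) _; rewrite kact_kmx vec3E p0 q0 w0 /y; ring.
  pose E (u : R) := expR (- 1 * L u).
  have dE u a : is_derive (u : R) 1 L a -> is_derive u 1 E (- a * E u).
    move=> dL; have dN : is_derive u 1 (fun u => - 1 * L u) (- a).
      by apply: is_derive_eq; rewrite /GRing.scale /=; ring.
    apply: derive_eq (@is_derive1_comp R expR _ u _ _ (is_derive_expR _) dN) _.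
    by rewrite /E mulrC.
  have c2 : E t * y 2 t = E s * y 2 s.
    apply: (is_derive_0_is_cst (f := fun u => E u * y 2 u)) => u.
    have [a [r [dL ? ? ?]]] := LP u; have ? := dE u a dL.
    by apply: is_derive_eq; rewrite /GRing.scale /=; ring.
  have c01 : E t ^+ 2 * (y 0 t ^+ 2 + y 1 t ^+ 2) =
      E s ^+ 2 * (y 0 s ^+ 2 + y 1 s ^+ 2).
    apply: (is_derive_0_is_cst (f := fun u => E u ^+ 2 * (y 0 u ^+ 2 + y 1 u ^+ 2))) => u.
    have [a [r [dL ? ? ?]]] := LP u; have ? := dE u a dL.
    by apply: is_derive_eq; rewrite /GRing.scale /=; ring.
  have Et : E t != 0 by rewrite expR_eq0.
  have EE : expR (L t - L s) = E s / E t.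
    by rewrite /E -expRN -expRD; congr expR; ring.
  apply: (@axis2_cone_rel (L t - L s)); rewrite EE.
    apply: (mulfI (x := E t ^+ 2)); first by rewrite sqrf_eq0.
    by rewrite [LHS]c01 /axis2 /y; field.
  by apply: (mulfI Et); rewrite [LHS]c2 /y; field.
split=> [|xy]; first exact: GE.
have loc x' : exists2 d : R, 0 < d &
    forall y, cone_rel x' y -> `|y - x'| < d -> conf_orbit G x' y.
  have [x0|x0] := eqVneq (axis2 x') 0; last first.
    apply: (local_leaf sG (translation_transversal (vec3 0 0 1)) D S) => //.
      rewrite /det3 !kact_kmx !vec3E; apply: contraNneq x0 => e; apply/eqP.
      by rewrite -e /axis2; ring.
    by move=> y'; exact: GE.
    move=> s z _ xz xsz; have := cone_rel_trans (cone_rel_sym xz) xsz.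
    have z0 : axis2 z != 0.
      have [d [t [-> _ _ _]]] := cone_rel_axis2 xz.
      by rewrite mulf_neq0 // sqrf_eq0 expR_eq0.
    move=> /cone_rel_axis2[d [t [+ + _ _]]].
    rewrite {1}/axis2 /cact /= scale1r mul1mx !entryE !vec3E !(mulr0, add0r, addr0, mulr1).
    rewrite -/(axis2 z) -{1}[axis2 z]mul1r -(expr1n _ 2) => /(mulIf z0)/esym/eqP.
    rewrite eqrXn2 ?expR_ge0 // => /eqP ->.
    by rewrite mul1r; lra.
  have ax y' : cone_rel x' y' -> y' 0 0 = 0 /\ y' 1 0 = 0.
    move=> /cone_rel_axis2[d [t [+ _ _ _]]]; rewrite x0 mulr0.
    exact: axis2_eq0.
  have [x20|x20] := eqVneq (x' 2 0) 0.
    exists 1 => // y' xy' _; have [y0 y1] := ax _ xy'.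
    have [x00 x10] := axis2_eq0 x0.
    have -> : y' = x'.
      have [d [t [_ y2 _ _]]] := cone_rel_axis2 xy'.
      by apply: vec3P; rewrite ?y0 ?y1 ?x00 ?x10 // y2 x20 mulr0.
    exact: orbit_refl.
  apply: (local_leaf_on_axis sG D) => //; last by move=> y'; exact: GE.
  by rewrite kact_kmx vec3E oppr0 !mul0r !add0r mul1r addr0.
have [d [t [y0 y1 y2]]] := xy.
pose c (s : R) : E3 R := vec3
  (expR (s * d) * (cos (s * t) * x 0 0 - sin (s * t) * x 1 0))
  (expR (s * d) * (sin (s * t) * x 0 0 + cos (s * t) * x 1 0))
  (expR (s * d) * x 2 0).
have c0 : c 0 = x.
  by apply: vec3P; rewrite vec3E !mul0r ?expR0 ?cos0 ?sin0; ring.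
have c1 : c 1 = y.
  by apply: vec3P; rewrite vec3E !mul1r ?y0 ?y1 ?y2.
have xc s : cone_rel x (c s) by exists (s * d), (s * t); rewrite !vec3E.
rewrite -c0 -c1; apply: (path_in_orbit (E := cone_rel)) => //.
- have [C0 C1'] := spiral_C1 d t (x 0 0) (x 1 0).
  apply: vec3_continuous; apply: C1_continuous => //.
  apply: C1M; last exact: C1_cst.
  by apply: (C1_comp (@C1_expR R)); apply: C1M; [exact: C1_id | exact: C1_cst].
- move=> s s'; exact: cone_rel_trans (cone_rel_sym (xc s)) (xc s').
Qed.

(** Dilations are transversal to the spheres. At each point other than the origin
    two of the three rotations about the axes have independent velocities. *)
Lemma spherical_orbit G x y : nice G -> spherical_type G ->
  (conf_orbit G x y <-> nsq x = nsq y).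
Proof.
move=> nG [F1 F2 F3 Yall]; have [sG Gc _ _] := nG.
have GE x' y' : conf_orbit G x' y' -> nsq x' = nsq y'.
  apply: (orbit_invariant (E := fun x y => nsq x = nsq y)) => // {x y x' y'}.
    by move=> x y z -> ->.
  move=> gam s t x pg; have [L LP] := path_ode sG pg; rewrite /nsq.
  apply: (is_derive_0_is_cst (f := fun u => cact (gam u) x 0 0 ^+ 2 +
    cact (gam u) x 1 0 ^+ 2 + cact (gam u) x 2 0 ^+ 2)) => u.
  have [a [p [q [r [u' [v [w [T dL dy]]]]]]]] := LP u.
  have [a0 u0 v0 w0] := Yall _ _ _ _ _ _ _ T.
  have := (dy x 0, dy x 1, dy x 2); rewrite kact_kmx !vec3E => -[[? ?] ?].
  by apply: is_derive_eq; rewrite a0 u0 v0 w0 /GRing.scale /=; ring.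
have loc x' : exists2 d : R, 0 < d &
    forall y, nsq x' = nsq y -> `|y - x'| < d -> conf_orbit G x' y.
  have [x0|x0] := eqVneq (nsq x') 0.
    exists 1 => // y' xy' _; rewrite (nsq_eq0 x0) (@nsq_eq0 _ y') -?xy' //.
    exact: orbit_refl.
  have small s z : `|s| < 1 -> nsq x' = nsq z ->
      nsq x' = nsq (cact (dilation_path s) z) -> s = 0.
    move=> _ xz; rewrite /cact /= mul1mx addr0 {2}/nsq !entryE => e.
    have : 1 ^+ 2 * nsq x' = expR s ^+ 2 * nsq x'.
      by rewrite expr1n mul1r {1}e xz /nsq; ring.
    move=> /(mulIf x0)/esym/eqP; rewrite eqrXn2 ?expR_ge0 // -expR0 => /eqP.
    exact: expR_inj.
  have use X Y : tangent G X -> tangent G Y ->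
      det3 (kact (kmx 1 0 0 0 0 0 0) x') (kact X x') (kact Y x') != 0 ->
      exists2 d : R, 0 < d &
        forall y, nsq x' = nsq y -> `|y - x'| < d -> conf_orbit G x' y.
    move=> TX TY d0; apply: (@local_leaf _ _ (fun x y => nsq x = nsq y) _ _ _ _ _ sG
      (dilation_transversal R) TX TY d0) => //.
    by move=> y'; exact: GE.
  have [x2|x2] := eqVneq (x' 2 0) 0; last first.
    apply: (use _ _ F1 F2); rewrite /det3 !kact_kmx !vec3E.
    apply: contraNneq (mulf_neq0 x2 x0) => e; apply/eqP; rewrite -e /nsq; ring.
  have [x1|x1] := eqVneq (x' 1 0) 0; last first.
    apply: (use _ _ F3 F1); rewrite /det3 !kact_kmx !vec3E.
    apply: contraNneq (mulf_neq0 x1 x0) => e; apply/eqP; rewrite -e /nsq; ring.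
  apply: (use _ _ F2 F3); rewrite /det3 !kact_kmx !vec3E.
  have x00 : x' 0 0 != 0.
    by apply: contraNneq x0 => e; rewrite /nsq e x1 x2 expr0n !addr0.
  apply: contraNneq (mulf_neq0 x00 x0) => e; apply/eqP; rewrite -e /nsq; ring.
split=> [|xy]; first exact: GE.
have turn (c : R -> E3 R) : continuous c -> (forall s, nsq (c s) = nsq (c 0)) ->
    conf_orbit G (c 0) (c 1).
  move=> cc cn; apply: (path_in_orbit (E := fun x y => nsq x = nsq y)) => //.
  by move=> s t; rewrite !cn.
have arc p q (t : R) : C1 (fun s : R => cos (s * t) * p - sin (s * t) * q) /\
    C1 (fun s : R => sin (s * t) * p + cos (s * t) * q).
  have lin : C1 (fun s : R => s * t) by apply: C1M; [exact: C1_id | exact: C1_cst].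
  have Cc := C1_comp (@C1_cos R) lin; have Cs := C1_comp (@C1_sin R) lin.
  by split; apply: C1D; try apply: C1N; apply: C1M => //; exact: C1_cst.
(* every point is turned first into the plane of the last two axes, then onto
   the third axis *)
have pole z : conf_orbit G z (vec3 0 0 (Num.sqrt (nsq z))).
  pose r := Num.sqrt (axis2 z).
  have r2 : r ^+ 2 = axis2 z by rewrite sqr_sqrtr // axis2_ge0.
  have [|t [t0 t1]] := @polar _ (z 0 0) (z 1 0) 0 r.
    by rewrite expr0n add0r r2.
  have h1 : conf_orbit G z (vec3 0 r (z 2 0)).
    pose c (s : R) : E3 R := vec3 (cos (s * t) * z 0 0 - sin (s * t) * z 1 0)
      (sin (s * t) * z 0 0 + cos (s * t) * z 1 0) (z 2 0).
    have c0 : c 0 = z by apply: vec3P; rewrite vec3E ?mul0r ?cos0 ?sin0; ring.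
    have c1 : c 1 = vec3 0 r (z 2 0) by rewrite /c !mul1r -t0 -t1.
    rewrite -c1 -{1}c0; apply: turn => [|s]; last first.
      by rewrite c0 /nsq !vec3E rotation_norm.
    have [C0 C1'] := arc (z 0 0) (z 1 0) t.
    by apply: vec3_continuous; apply: C1_continuous => //; exact: C1_cst.
  have n2 : Num.sqrt (nsq z) ^+ 2 = nsq z by rewrite sqr_sqrtr // nsq_ge0.
  have [|t' [t'0 t'1]] := @polar _ r (z 2 0) 0 (Num.sqrt (nsq z)).
    by rewrite expr0n add0r n2 r2.
  apply: orbit_trans h1 _ => //.
  pose c (s : R) : E3 R := vec3 0 (cos (s * t') * r - sin (s * t') * z 2 0)
      (sin (s * t') * r + cos (s * t') * z 2 0).
  have c0 : c 0 = vec3 0 r (z 2 0).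
    by apply: vec3P; rewrite !vec3E ?mul0r ?cos0 ?sin0; ring.
  have c1 : c 1 = vec3 0 0 (Num.sqrt (nsq z)) by rewrite /c !mul1r -t'0 -t'1.
  rewrite -c1 -{1}c0; apply: turn => [|s]; last first.
    by rewrite c0 /nsq !vec3E -!addrA rotation_norm.
  have [C0 C1'] := arc r (z 2 0) t'.
  by apply: vec3_continuous; apply: C1_continuous => //; exact: C1_cst.
apply: (orbit_trans sG (pole x)); rewrite xy.
exact: orbit_sym sG (pole y).
Qed.

End ConicalSpherical.

(** * Orbits of the model groups *)

Section ModelGroups.
Variable R : realType.
Implicit Types (g h c : triple R) (A B G H : set (triple R)) (x y z : 'cV[R]_3).

Lemma generated_sub A g : A g -> generated A g.
Proof. by move=> Ag H _; apply. Qed.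

Lemma generated_mul A g h :
  generated A g -> generated A h -> generated A (cmul g h).
Proof.
move=> Ag Ah H sH AH; have [_ _ HM _] := sH.
by apply: (HM); [exact: Ag | exact: Ah].
Qed.

(** The similarities that preserve the classes of E form a subgroup. *)
Lemma generated_orbit A (E : 'cV[R]_3 -> 'cV[R]_3 -> Prop) x y :
  A `<=` Conf R -> (forall x, E x x) -> (forall x y, E x y -> E y x) ->
  (forall x y z, E x y -> E y z -> E x z) ->
  (forall g x, A g -> E x (cact g x)) ->
  conf_orbit (generated A) x y -> E x y.
Proof.
move=> AC Er Es Et AE [g Ag <-].
have [] := Ag [set g | Conf R g /\ forall x, E x (cact g x)]; last by [].
  split.
  - by move=> h [].
  - by split; [exact: Conf_conf1 | move=> z; rewrite cact1].
  - move=> h k [hC hE] [kC kE]; split; first exact: Conf_cmul.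
    by move=> z; rewrite cact_cmul; exact: Et (kE z) (hE _).
  - move=> h [hC hE]; split; first exact: Conf_cinv.
    by move=> z; apply: Es; rewrite -{2}[z](cactKV z hC).
by move=> h Ah; split; [exact: AC | move=> z; exact: AE].
Qed.

Lemma rotz_mul (t : R) x : rotz t *m x =
  vec3 (cos t * x 0 0 + sin t * x 1 0) (- sin t * x 0 0 + cos t * x 1 0) (x 2 0).
Proof. by rewrite rotzE cols3_mul; apply: vec3P; rewrite !(entryE, vec3E); ring. Qed.

Lemma rotz_orthogonal (t : R) : (rotz t)^T *m rotz t = 1%:M.
Proof.
apply/matrixP => i j; rewrite rotzE mxE sum3 !mxE.
elim/ord3_ind: i; elim/ord3_ind: j; rewrite /= ?mxE /=;
  have := cos2Dsin2 t; lra.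
Qed.

Lemma grpL_Conf : grpL R `<=` Conf R.
Proof. by move=> _ [k ->]; exact: Conf_translation. Qed.

Lemma basis_vec2 : basis_vec R 2 = vec3 0 0 1.
Proof. by apply: vec3P; rewrite vec3E mxE. Qed.

Lemma grpL_planar_rel (a r : R) g x : grpL R g -> planar_rel a r x (cact g x).
Proof.
move=> [k ->]; exists 0; rewrite !mulr0 expR0 cos0 sin0 /cact /= mul1mx basis_vec2.
by rewrite !entryE !vec3E; split; ring.
Qed.

(** Covers the models with factor SO(2), N_a and R_+^* at once. *)
Lemma axial_group_orbit A (a r : R) x y :
  (forall g, A g <-> exists d : R, g = (expR (a * d), rotz (- (r * d)), 0)) ->
  conf_orbit (grp_prod A (grpL R)) x y <-> planar_rel a r x y.
Proof.
move=> AP; split.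
  apply: generated_orbit => [g||||g z [/AP[d ->]|]].
  - move=> [/AP[d ->]|/grpL_Conf//]; split; first by rewrite /= expR_eq0.
    exact: rotz_orthogonal.
  - exact: planar_rel_refl.
  - exact: planar_rel_sym.
  - exact: planar_rel_trans.
  - exists d; rewrite /cact /= rotz_mul !entryE !vec3E cosN sinN.
    by split; ring.
  - exact: grpL_planar_rel.
move=> [d [y0 y1]].
have Ag : A (expR (a * d), rotz (- (r * d)), 0) by apply/AP; exists d.
exists (cmul (1, 1%:M, (y 2 0 - expR (a * d) * x 2 0) *: basis_vec R 2)
  (expR (a * d), rotz (- (r * d)), 0)).
  apply: generated_mul; apply: generated_sub; last by left.
  by right; eexists.
rewrite cact_cmul {1}/cact /= mul1mx basis_vec2 /cact /= rotz_mul.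
by apply: vec3P; rewrite !(entryE, vec3E) ?y0 ?y1 ?cosN ?sinN; ring.
Qed.

Lemma grpSO2_orbit (r : R) x y : r != 0 ->
  conf_orbit (grp_prod (grpSO2 R) (grpL R)) x y <-> planar_rel 0 r x y.
Proof.
move=> r0; apply: axial_group_orbit => g; split=> [[t ->]|[d ->]].
  by exists (- t / r); rewrite mul0r expR0 mulrCA divff // mulr1 opprK.
by exists (- (r * d)); rewrite mul0r expR0.
Qed.

Lemma grpN_orbit (a r : R) x y : r != 0 ->
  conf_orbit (grp_prod (grpN R (- a / r)) (grpL R)) x y <-> planar_rel a r x y.
Proof.
move=> r0; apply: axial_group_orbit => g; split=> [[t ->]|[d ->]].
  exists (- t / r); rewrite [r * _]mulrCA divff // mulr1 opprK.
  by congr (expR _, _, _); field.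
by exists (- (r * d)); congr (expR _, _, _); field.
Qed.

Lemma grpRpos_orbit (a : R) x y : a != 0 ->
  conf_orbit (grp_prod (grpRpos R) (grpL R)) x y <-> planar_rel a 0 x y.
Proof.
move=> a0; apply: axial_group_orbit => g; split=> [[k k0 ->]|[d ->]].
  exists (ln k / a); rewrite mul0r oppr0 rotz0 mulrCA divff // mulr1.
  by rewrite lnK // posrE.
by exists (expR (a * d)); rewrite ?expR_gt0 // mul0r oppr0 rotz0.
Qed.

Lemma cone_group_orbit x y :
  conf_orbit (grp_prod (grpRpos R) (grpSO2 R)) x y <-> cone_rel x y.
Proof.
split.
  apply: generated_orbit => [g||||g z [[k k0 ->]|[t ->]]].
  - move=> [[k k0 ->]|[t ->]].
      by split; rewrite /= ?gt_eqF // trmx1 mulmx1.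
    exact/Conf_rotation/rotz_orthogonal.
  - exact: cone_rel_refl.
  - exact: cone_rel_sym.
  - exact: cone_rel_trans.
  - exists (ln k), 0; rewrite lnK ?posrE // cos0 sin0 /cact /= mul1mx !entryE.
    by split; ring.
  - exists 0, (- t); rewrite expR0 cosN sinN /cact /= rotz_mul !entryE !vec3E.
    by split; ring.
move=> [d [t [y0 y1 y2]]].
exists (cmul (expR d, 1%:M, 0) (1, rotz (- t), 0)).
  apply: generated_mul; apply: generated_sub.
    by left; exists (expR d); rewrite ?expR_gt0.
  by right; exists (- t).
rewrite cact_cmul /cact /= mul1mx rotz_mul.
by apply: vec3P; rewrite !(entryE, vec3E) ?y0 ?y1 ?y2 ?cosN ?sinN; ring.
Qed.

Lemma grpSO3_orbit x y : conf_orbit (grpSO3 R) x y <-> nsq x = nsq y.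
Proof.
split=> [[_ [A [AA _] ->] <-]|/rotation_exists[A [AA dA <-]]].
  by rewrite /cact /= scale1r addr0 nsq_isometry.
by exists (1, A, 0); [exists A | rewrite /cact /= scale1r addr0].
Qed.

Definition model_orbits G : Prop :=
  same_orbits_upto_conj G (grpP R) \/
  same_orbits_upto_conj G (grp_prod (grpSO2 R) (grpL R)) \/
  (exists2 a : R, a != 0 &
     same_orbits_upto_conj G (grp_prod (grpN R a) (grpL R))) \/
  same_orbits_upto_conj G (grp_prod (grpRpos R) (grpL R)) \/
  same_orbits_upto_conj G (grpSO3 R) \/
  same_orbits_upto_conj G (grp_prod (grpRpos R) (grpSO2 R)).

Lemma normal_form_orbits G : nice G -> normal_form G -> model_orbits G.
Proof.
move=> nG [pG|[a [r cG]]|cG|sG].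
- left; apply: same_orbits_rel => x y; [exact: planar_type_orbit | exact: grpP_orbit].
- right; have [_ _ ar0 _] := cG.
  have GE x y : conf_orbit G x y <-> planar_rel a r x y by exact: cylindrical_orbit.
  have [a0|a0] := eqVneq a 0.
    have r0 : r != 0 by apply: contraNneq ar0 => ->; rewrite a0 !expr0n addr0.
    rewrite a0 in GE; left; apply: same_orbits_rel GE _ => x y.
    exact: grpSO2_orbit.
  have [r0|r0] := eqVneq r 0.
    rewrite r0 in GE; do 2 right; left; apply: same_orbits_rel GE _ => x y.
    exact: grpRpos_orbit.
  right; left; exists (- a / r); first by rewrite mulf_neq0 ?invr_eq0 ?oppr_eq0.
  by apply: same_orbits_rel GE _ => x y; exact: grpN_orbit.
- do 5 right; apply: same_orbits_rel => x y;
    [exact: conical_orbit | exact: cone_group_orbit].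
- do 4 right; left; apply: same_orbits_rel => x y;
    [exact: spherical_orbit | exact: grpSO3_orbit].
Qed.

Lemma model_orbits_conj c G : Conf R c ->
  model_orbits (conj_set c G) -> model_orbits G.
Proof.
move=> cC; have sc H := @same_orbits_conj R c G H cC.
move=> [/sc|[/sc|[[a a0 /sc]|[/sc|[/sc|/sc]]]]] H; rewrite /model_orbits;
  try tauto.
by do 2 right; left; exists a.
Qed.

Theorem nice_orbits G : nice G -> model_orbits G.
Proof.
move=> /nice_classification[c cC [nG nf]].
exact: model_orbits_conj cC (normal_form_orbits nG nf).
Qed.

End ModelGroups.

(** * From Lie subgroups to paths *)

Section FromManifolds.
Variable R : realType.
Implicit Types (G : set (triple R)) (x y z : 'cV[R]_3).

Lemma is_derive_chain (V W : normedModType R) (f : V -> W) (c : R -> V) (t : R) v :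
  differentiable f (c t) -> is_derive t 1 c v ->
  is_derive t 1 (f \o c) ('d f (c t) v).
Proof.
move=> df dc; have dt : differentiable c t.
  by apply/derivable1_diffP; exact: (@ex_derive _ _ _ _ _ _ _ dc).
have dfc : differentiable (f \o c) t by exact: differentiable_comp.
apply: DeriveDef; first exact: diff_derivable.
rewrite deriveE // diff_comp //=; congr ('d f (c t) _).
by rewrite -deriveE //; case: dc.
Qed.

Lemma is_derive_linear (V W : normedModType R) (l : {linear V -> W}) (c : R -> V)
    (t : R) v : continuous l -> is_derive t 1 c v -> is_derive t 1 (l \o c) (l v).
Proof.
move=> cl dc; have := is_derive_chain (linear_differentiable (c t) cl) dc.
by rewrite diff_lin.
Qed.

Lemma C1_smooth_arc (U V : normedModType R) (D : set U) (f : U -> V)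
    (l : {linear V -> R^o}) (u w : U) :
  continuous l -> smooth D f -> (forall t : R, D (u + sin t *: w)) ->
  C1 (fun t => l (f (u + sin t *: w))).
Proof.
move=> cl sf Dc; have [df cdf] := sf 1%N.
pose c (t : R) := u + sin t *: w.
have dc t : is_derive (t : R) 1 c (cos t *: w).
  have ? := is_derive_sin t.
  have dw : is_derive t 1 (fun s : R => sin s *: w) (cos t *: w).
    have dsc := is_diff_scalel (sin t) w.
    have dd : differentiable (fun s : R => s *: w) (sin t) by exact: ex_diff.
    by have := is_derive_chain dd (is_derive_sin t); rewrite diff_val.
  have := is_deriveD (is_derive_cst u t 1) dw.
  by rewrite add0r.
have dfc t : is_derive (t : R) 1 (fun t => l (f (c t))) (l ('d f (c t) (cos t *: w))).
  apply: (is_derive_linear (c := f \o c) cl).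
  by apply: is_derive_chain (dc t); exact: df (Dc t).
exists (fun t => cos t * l ('d f (c t) w)); last first.
  move=> t; apply: is_derive_eq (dfc t) _.
  by rewrite !linearZ.
move=> t; apply: cvgM; first exact: continuous_cos.
have cc : {for t, continuous c}.
  apply: differentiable_continuous.
  by apply/derivable1_diffP; exact: (@ex_derive _ _ _ _ _ _ _ (dc t)).
apply: (@continuous_comp _ _ _ (fun t => 'd f (c t) w) l); last exact: cl.
exact: (@continuous_comp R U V c (fun p : U => 'd f p w) t cc (cdf w _ (Dc t))).
Qed.

Lemma C1path_smooth_arc (U : normedModType R) (D : set U) (f : U -> triple R)
    (u w : U) : smooth D f -> (forall t : R, D (u + sin t *: w)) ->
  C1path (fun t => f (u + sin t *: w)).
Proof.
move=> sf Dc.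
have coord (l : {linear (triple R) -> R^o}) : continuous l ->
    C1 (fun t => l (f (u + sin t *: w))).
  by move=> cl; exact: C1_smooth_arc sf Dc.
have lin (l : triple R -> R^o) : linear l -> continuous l ->
    C1 (fun t => l (f (u + sin t *: w))).
  move=> ll cl; pose m := GRing.isLinear.Build _ _ _ _ _ ll.
  pose l' : {linear _ -> _} := HB.pack l m.
  exact: (coord l').
have c1 : continuous (fun g : triple R => g.1).
  by move=> p; exact: cvg_fst.
have c11 : continuous (fun g : triple R => g.1.1).
  move=> p; apply: (@continuous_comp _ _ _ (fun g : triple R => g.1) fst).
    exact: c1.
  exact: cvg_fst.
have c12 : continuous (fun g : triple R => g.1.2).
  move=> p; apply: (@continuous_comp _ _ _ (fun g : triple R => g.1) snd).
    exact: c1.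
  exact: cvg_snd.
have c2 : continuous (fun g : triple R => g.2).
  by move=> p; exact: cvg_snd.
split=> [|i j|i j].
- by apply: (lin (fun g => g.1.1)).
- apply: (lin (fun g => g.1.2 i j)); first by move=> a g h; rewrite /= !mxE.
  move=> p; apply: (@continuous_comp _ _ _ (fun g : triple R => g.1.2)
    (fun M : 'M[R]_3 => M i j)); [exact: c12 | exact: coord_continuous].
- apply: (lin (fun g => g.2 i j)); first by move=> a g h; rewrite /= !mxE.
  move=> p; apply: (@continuous_comp _ _ _ (fun g : triple R => g.2)
    (fun M : 'cV[R]_3 => M i j)); [exact: c2 | exact: coord_continuous].
Qed.

(** In a chart, the arc u + sin(t)(u' - u) stays near u and joins u to u'. *)
Lemma Lie_subgroup_C1_connected G : connected_Lie_subgroup G -> C1_connected G.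
Proof.
move=> [sG [k [M [[GM Mi] _ _ Mc]]]] A A1 AP.
have MG i u : pdom M i u -> G (param M i u).
  by move=> iu; rewrite GM; exists i => //; exists u.
have arc i u : pdom M i u -> exists2 d : R, 0 < d & forall u', `|u' - u| < d ->
    pdom M i u' /\ (A (param M i u) <-> A (param M i u')).
  move=> iu; have [Do Ds _ _ _] := Mi i.
  have /nbhs_normP[d /= d0 dD] : nbhs u (pdom M i) by exact: open_nbhs_nbhs.
  exists d => // u' u'd.
  have Dc (t : R) : pdom M i (u + sin t *: (u' - u)).
    apply: dD; rewrite /ball_ /= opprD addrA subrr add0r normrN normrZ.
    apply: le_lt_trans u'd; rewrite -[leRHS]mul1r ler_wpM2r //.
    by rewrite ler_norml sin_geN1 sin_le1.
  have pg : path_in G (fun t => param M i (u + sin t *: (u' - u))).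
    split; [exact: C1path_smooth_arc Ds Dc | move=> t; exact: MG (Dc t)].
  have e0 : u + sin 0 *: (u' - u) = u by rewrite sin0 scale0r addr0.
  have e1 : u + sin (pi / 2) *: (u' - u) = u'.
    by rewrite sin_pihalf scale1r addrC subrK.
  split; first by rewrite -e1.
  have := AP _ 0 (pi / 2) pg; have := AP _ (pi / 2) 0 pg.
  by rewrite e0 e1.
have openA (B : set (triple R)) :
    (forall g h, G g -> G h -> (A g <-> A h) -> B g -> B h) -> manifold_open M B.
  move=> BA i; rewrite openE => u [iu Bu].
  have [d d0 dP] := arc i u iu.
  rewrite /interior /=; apply: (filterS _ (nbhs_ball_norm u (PosNum d0))) => u'.
  rewrite /ball_ /= distrC => /dP[iu' AA]; split=> //=.
  exact: BA (MG _ _ iu) (MG _ _ iu') AA Bu.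
have G1 : G (conf1 R) by case: sG.
have [||||GA0|GA0] := Mc (G `&` A) (G `\` A).
- by apply: openA => g h Gg Gh gh [_ Ag]; split=> //; apply/gh.
- by apply: openA => g h Gg Gh gh [_ Ag]; split=> // /gh.
- by rewrite setUIDK.
- by apply/seteqP; split=> g //= -[[_ Ag] [_ nAg]].
- by have : (G `&` A) (conf1 R) by []; rewrite GA0.
- move=> g Gg; apply: contrapT => nAg.
  by have : (G `\` A) g by []; rewrite GA0.
Qed.

Lemma Cn_cst (V W : normedModType R) (D : set V) (a : W) n : Cn n D (fun=> a).
Proof.
elim: n a => [|n IH] a /=; first by move=> p _; exact: cvg_cst.
split=> [p _|v]; first exact: differentiable_cst.
have -> : (fun p : V => 'd (fun=> a : W) p v) = fun=> 0.
  by apply/funext => p; rewrite (diff_cst a p).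
exact: IH.
Qed.

Lemma smooth_linear (V W : normedModType R) (D : set V) (f : {linear V -> W}) :
  continuous f -> smooth D f.
Proof.
move=> cf [|n] /=; first by move=> p _; exact: cf.
split=> [p _|v]; first exact: linear_differentiable.
have -> : (fun p : V => 'd f p v) = fun=> f v.
  by apply/funext => p; rewrite diff_lin.
exact: Cn_cst.
Qed.

Definition rV3 : normedModType R := 'rV[R]_3.

Lemma trmx_continuous : continuous (trmx : rV3 -> E3 R).
Proof.
apply: (@lipschitz_continuous R rV3 (E3 R) trmx 1) => // p q; rewrite mul1r.
apply: mx_norm_le => // i j.
by rewrite (_ : (p^T - q^T) i j = (p - q) j i) ?ler_entry_norm // !mxE.
Qed.

(** One chart, indexed by 0, covers S; transposition passes from rows to
    columns. *)
Lemma open_has_dim3 (S : set (E3 R)) : open S -> has_dim S 3.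
Proof.
move=> So.
pose D n : set rV3 := if n is 0%N then (trmx : rV3 -> E3 R) @^-1` S else set0.
have Do n : open (D n).
  case: n => [|n] /=; last exact: open0.
  by apply: open_comp => // p _; exact: trmx_continuous.
exists (@Atlas R 3 (E3 R) D (fun=> trmx)); split=> [|i] /=.
  apply/seteqP; split=> [y Sy|y [[|n] _ [u Du <-]]] //.
  by exists 0%N => //; exists y^T; rewrite /= ?trmxK.
split.
- exact: Do.
- exact (@smooth_linear rV3 (E3 R) (D i) trmx trmx_continuous).
- move=> u _ p q; rewrite (@diff_lin R rV3 (E3 R) trmx u trmx_continuous) => pq.
  exact: trmx_inj pq.
- by move=> u v _ _ /trmx_inj.
move=> j D'.
have D'E : D' = D i `&` D j.
  apply/seteqP; split=> u /= [Du]; first by move=> [v Dv /trmx_inj vu]; split=> //; rewrite -vu.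
  by move=> Dv; split=> //; exists u.
split; first by rewrite D'E; apply: openI; exact: Do.
exists id; split; first exact (@smooth_linear rV3 rV3 D' idfun (fun p => cvg_id)).
by move=> w; rewrite D'E => -[].
Qed.

Lemma open_orbit G x : subgroup G -> orbit_open G x -> open (conf_orbit G x : set (E3 R)).
Proof.
move=> sG [d d0 dP]; have [GC _ _ _] := sG.
rewrite openE => y [g Gg gx]; have gC := GC _ Gg.
have [K K0 KP] := cact_lipschitz (cinv g).
have e0 : 0 < d / K by rewrite divr_gt0.
rewrite /interior /=.
apply: (filterS _ (@nbhs_ball_norm R (E3 R) y (PosNum e0))) => z.
rewrite /ball_ /= distrC => zy.
have Oz : conf_orbit G x (cact (cinv g) z).
  apply: dP; rewrite -{1}[x](cactK x gC) gx.
  by rewrite (le_lt_trans (KP _ _))// mulrC -ltr_pdivlMr.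
by apply: orbit_trans Oz _ => //; exists g; rewrite ?cactKV.
Qed.

Lemma has_dim2_thick G x : subgroup G -> has_dim (conf_orbit G x) 2 -> thick G.
Proof.
move=> sG [M [OM Mi]]; have := orbit_refl x sG; rewrite OM => -[i _ [u iu ux]].
have [Do Ds _ Dinj _] := Mi i.
exists (pdom M i), (param M i), x; split=> //.
- by exists u.
- by move=> v iv; exact: (Ds 0%N).
- by move=> v iv; rewrite OM; exists i => //; exists v.
Qed.

Lemma Lie_subgroup_nice G :
  connected_Lie_subgroup G -> cohomogeneity 1 G -> nice G.
Proof.
move=> GL [[x [d [dimx d3]]] dim_le]; have [sG _] := GL; split=> //.
- exact: Lie_subgroup_C1_connected.
- apply: (has_dim2_thick (x := x)) => //.
  have d2 : d = 2%N by move: d3; rewrite addn1 => -[].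
  by rewrite d2 in dimx.
- move=> y /(open_orbit sG)/open_has_dim3 dim3.
  by have := dim_le _ _ dim3.
Qed.

End FromManifolds.

Theorem theorem3p1 (R : realType) (G : set (triple R)) :
  connected_Lie_subgroup G -> cohomogeneity 1 G ->
  same_orbits_upto_conj G (grpP R) \/
  same_orbits_upto_conj G (grp_prod (grpSO2 R) (grpL R)) \/
  (exists2 a : R, a != 0 &
     same_orbits_upto_conj G (grp_prod (grpN R a) (grpL R))) \/
  same_orbits_upto_conj G (grp_prod (grpRpos R) (grpL R)) \/
  same_orbits_upto_conj G (grpSO3 R) \/
  same_orbits_upto_conj G (grp_prod (grpRpos R) (grpSO2 R)).
Proof. by move=> GL Gc; exact/nice_orbits/Lie_subgroup_nice. Qed.
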